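(* Let $\Omega$ be a $C^2$, convex, unbounded domain in $\mathbb{R}^2$, symmetric with respect to the $y$-axis. Let $a\in(0,+\infty]$ and let $p:(-a,a)\to\mathbb{R}$ be a concave, even, $C^2$ function such that $$\Omega=\{(x,y)\in\mathbb{R}^2:\ -a<x<a,\ y<p(x)\}.$$ Assume that $\Omega$ satisfies a uniform interior sphere condition. Then $$\mu_1^{odd}(\Omega)\ \ge\ \mu_1(-a,a).$$ Moreover, equality holds for every domain of the type $(-a,a)\times(-\infty,b)$ with $b\in\mathbb{R}$, that is, $\mu_1^{odd}\big((-a,a)\times(-\infty,b)\big)=\mu_1(-a,a)$.
   Context: Gaussian measure: $d\gamma_x=\frac{1}{\sqrt{2\pi}}e^{-x^2/2}\,dx$ on $\mathbb{R}$, and $d\gamma_2=d\gamma_x\otimes d\gamma_y=\frac{1}{2\pi}e^{-(x^2+y^2)/2}\,dx\,dy$ on $\mathbb{R}^2$. Uniform interior sphere condition: there is $r>0$ such that for every $P\in\partial\Omega$ there is an open disk of radius $r$ contained in $\Omega$ whose boundary contains $P$. Neumann eigenvalue problem: for a (possibly unbounded) domain $\Omega\subset\mathbb{R}^2$ with outward normal $\nu$, consider $$-\mathrm{div}\left(e^{-\frac{x^2+y^2}{2}}\nabla u\right)=\mu\, e^{-\frac{x^2+y^2}{2}}u\ \text{ in }\Omega,\qquad \frac{\partial u}{\partial\nu}=0\ \text{ on }\partial\Omega,$$ understood in the weak sense: $u\in H^1(\Omega,d\gamma_2)$, $u\neq 0$, and $\int_\Omega \nabla u\cdot\nabla\varphi\,d\gamma_2=\mu\int_\Omega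 u\varphi\,d\gamma_2$ for all $\varphi\in H^1(\Omega,d\gamma_2)$. Here $H^1(\Omega,d\gamma_2)$ is the weighted Sobolev space of functions which, together with their weak first derivatives, belong to $L^2(\Omega,d\gamma_2)$. For $\Omega$ symmetric with respect to the $y$-axis, $\mu_1^{odd}(\Omega)$ is the lowest eigenvalue $\mu$ of this problem having a corresponding eigenfunction $u$ that is odd with respect to the $y$-axis, i.e. $u(-x,y)=-u(x,y)$. For $-\infty\le \alpha<\beta\le\infty$, $\mu_1(\alpha,\beta)$ is the first nontrivial eigenvalue of the one-dimensional problem $-v''+xv'=\mu v$ in $(\alpha,\beta)$, $v'(\alpha)=v'(\beta)=0$; equivalently $$\mu_1(\alpha,\beta)=\min\left\{\frac{\int_\alpha^\beta (z')^2\,d\gamma_x}{\int_\alpha^\beta z^2\,d\gamma_x}:\ z\in H^1((\alpha,\beta),d\gamma_x),\ z\ne0,\ \int_\alpha^\beta z\,d\gamma_x=0\right\}.$$ *)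

(* Defs.v *)
From HB Require Import structures.
From mathcomp Require Import all_boot all_order all_algebra.
From mathcomp Require Import all_classical all_reals all_analysis.

Set Implicit Arguments.
Unset Strict Implicit.
Unset Printing Implicit Defensive.

Import Order.TTheory GRing.Theory Num.Theory.
Import numFieldNormedType.Exports.

Local Open Scope classical_set_scope.
Local Open Scope ring_scope.

(* C^k regularity on an open set D.  Quantifying over all directions v is, in
   finite dimension, the same as quantifying over the coordinate directions. *)
Fixpoint Ck (R : realType) (V : normedModType R) (D : set V) (k : nat)
    (f : V -> R) : Prop :=
  (forall x, D x -> {for x, continuous f}) /\
  match k with
  | 0 => True
  | k'.+1 => (forall x v, D x -> derivable f x v) /\
             (forall v, Ck D k' (fun x => 'D_v f x))
  end.

Definition test_function (R : realType) (V : normedModType R) (D : set V)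
    (phi : V -> R) : Prop :=
  [/\ forall k, Ck setT k phi,
      compact (closure [set x | phi x != 0]) &
      closure [set x | phi x != 0] `<=` D].

Definition L2 d (T : measurableType d) (R : realType)
    (mu : {measure set T -> \bar R}) (D : set T) (u : T -> R) : Prop :=
  measurable_fun D u /\ mu.-integrable D (fun x => (u x ^+ 2)%:E).

Section gaussian_dim1.
Variable R : realType.

Definition gamma1 : probability (measurableTypeR R) R := normal_prob 0 1.

Definition weak_deriv1 (I : set R) (z g : R -> R) : Prop :=
  forall phi : R -> R, test_function I phi ->
    \int[@lebesgue_measure R]_(x in I) (z x * 'D_1 phi x) =
    - \int[@lebesgue_measure R]_(x in I) (g x * phi x).

(* z \in H^1(I, gamma1), with weak derivative g *)
Definition H1_dim1 (I : set R) (z g : R -> R) : Prop :=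
  [/\ L2 gamma1 I z, L2 gamma1 I g & weak_deriv1 I z g].

Definition oitv (al be : \bar R) : set R := [set x | (al < x%:E < be)%E].

Definition mu1 (al be : \bar R) : \bar R :=
  let I := oitv al be in
  ereal_inf [set q : \bar R | exists z g : R -> R,
    [/\ H1_dim1 I z g,
        ~ {ae gamma1, forall x, I x -> z x = 0},
        \int[gamma1]_(x in I) z x = 0 &
        q = ((\int[gamma1]_(x in I) (g x ^+ 2)) /
             (\int[gamma1]_(x in I) (z x ^+ 2)))%:E]].

End gaussian_dim1.

Section gaussian_dim2.
Variable R : realType.

Definition gamma2 :
    {measure set (measurableTypeR R * measurableTypeR R) -> \bar R} :=
  (gamma1 R \x gamma1 R)%E.

Definition leb2 :
    {measure set (measurableTypeR R * measurableTypeR R) -> \bar R} :=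
  (@lebesgue_measure R \x @lebesgue_measure R)%E.

Definition weak_deriv2 (Om : set (R * R)) (v : R * R) (u g : R * R -> R) :
    Prop :=
  forall phi : R * R -> R, test_function Om phi ->
    \int[leb2]_(z in Om) (u z * 'D_v phi z) =
    - \int[leb2]_(z in Om) (g z * phi z).

(* u \in H^1(Om, gamma2), with weak gradient (gx, gy) *)
Definition H1_dim2 (Om : set (R * R)) (u gx gy : R * R -> R) : Prop :=
  [/\ L2 gamma2 Om u, L2 gamma2 Om gx, L2 gamma2 Om gy,
      weak_deriv2 Om (1, 0) u gx & weak_deriv2 Om (0, 1) u gy].

Definition neumann_eigenfunction (Om : set (R * R)) (mu : R)
    (u : R * R -> R) : Prop :=
  ~ {ae gamma2, forall z, Om z -> u z = 0} /\
  exists ux uy : R * R -> R, H1_dim2 Om u ux uy /\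
    forall phi phix phiy : R * R -> R, H1_dim2 Om phi phix phiy ->
      \int[gamma2]_(z in Om) (ux z * phix z + uy z * phiy z) =
      mu * \int[gamma2]_(z in Om) (u z * phi z).

Definition odd_eigenvalue (Om : set (R * R)) (mu : R) : Prop :=
  exists u : R * R -> R, neumann_eigenfunction Om mu u /\
    {ae gamma2, forall z, Om z -> u (- z.1, z.2) = - u z}.

Definition mu1odd (Om : set (R * R)) : \bar R :=
  ereal_inf [set mu%:E | mu in odd_eigenvalue Om].

Definition boundary (Om : set (R * R)) : set (R * R) :=
  closure Om `\` interior Om.

(* Near each boundary point, Om is the strict epigraph of a C^2 function in
   some orthonormal frame; (c, s) is the first vector of the frame.  The graph
   function may be taken on the whole line, after shrinking the neighbourhood
   and extending. *)
Definition C2_domain (Om : set (R * R)) : Prop :=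
  [/\ open Om, connected Om, Om !=set0 &
    forall P, boundary Om P ->
      exists (c s : R) (h : R -> R),
        [/\ c ^+ 2 + s ^+ 2 = 1, Ck setT 2 h &
          \forall z \near P,
            Om z <-> h (c * z.1 + s * z.2) < - s * z.1 + c * z.2]].

Definition sqdist (z w : R * R) : R := (z.1 - w.1) ^+ 2 + (z.2 - w.2) ^+ 2.

(* The norm of R * R is the maximum norm, hence the explicit disks. *)
Definition uniform_interior_sphere (Om : set (R * R)) : Prop :=
  exists2 r : R, 0 < r & forall P, boundary Om P ->
    exists c : R * R,
      [set z | sqdist z c < r ^+ 2] `<=` Om /\ sqdist P c = r ^+ 2.

End gaussian_dim2.

(* Main.v *)
Require Import Defs.
From HB Require Import structures.
From mathcomp Require Import all_boot all_order all_algebra.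
From mathcomp Require Import all_classical all_reals all_analysis.
From mathcomp Require Import measurable_realfun ring lra.

(** Everything rests on one object, the ground state of the interval
    ]-a, a[: a number mu > 0, an odd function v and its derivative h = v', which
    is even, positive and bounded on ]-a, a[, such that, with w the density of
    gamma1, the integral of v w over [s, a[ equals w(s) h(s) / mu whenever
    0 <= s < a.  This is the integrated form of - v'' + x v' = mu v with the
    Neumann condition at a.  For a = oo one takes v = x, h = 1, mu = 1.  For
    finite a, h is the first even Dirichlet solution of h'' - x h' + l h = 0
    on ]-a, a[, mu = 1 + l and v = (x h - h') / mu; the parameter l is the
    supremum of those for which the solution of the initial value problem stays
    nonnegative on [0, a] ([exists_dirichlet_eigenvalue]).

    The central estimate is a weighted Hardy inequality ([hardy_ineq]): if
    |k(x)| is at most the integral of |g| over [0, x] for almost every x in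
    ]0, a[, then mu times the integral of k^2 w over ]0, a[ is at most that of
    g^2 w.  Indeed Cauchy-Schwarz with the weight h gives
    k(x)^2 <= v(x) * (integral of g^2 / h over [0, x]), and exchanging the order
    of integration in the triangle t < x leaves the tail integral of v w, which
    the ground state evaluates.  Applied to z - z(0) on both halves of ]-a, a[ it
    gives the Poincare inequality with constant mu, and v attains it, so that
    mu1 (-a) a = mu ([mu1_eq]).

    A concave even p is nonincreasing on [0, a[, hence the domain is a union of
    boxes ]-q, q[ x ]-oo, p(q)[ and its horizontal sections are symmetric
    intervals.  Testing the weak derivative in x against products
    psi(x) beta(y) shows that on almost every horizontal line an H^1 function is
    a primitive of its weak x-derivative ([horizontal_difference]).  Test
    functions are taken from a countable family (bumps with rational endpoints),
    so that the exceptional set of lines does not depend on them.  If u is odd,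
    then 2 u(x, y) = u(x, y) - u(-x, y) is controlled by the integral of
    |u_x(t, y)| + |u_x(-t, y)| over [0, x]; the Hardy inequality on each line
    and integration in y give mu * |u|^2 <= |u_x|^2 in L^2(gamma2)
    ([odd_poincare_hypograph]).  For an eigenfunction u the right-hand side is
    at most the Dirichlet energy, which is the eigenvalue times |u|^2; so every
    odd eigenvalue is at least mu.

    On the strip, (x, y) |-> v(x) is an odd eigenfunction with eigenvalue mu.
    The eigenvalue equation is checked line by line: the integral of h phi_x w
    equals mu times that of v phi w, again by exchanging the order of
    integration in the triangle t < x ([gs_duality]). *)

Set Implicit Arguments.
Unset Strict Implicit.
Unset Printing Implicit Defensive.

Import Order.TTheory GRing.Theory Num.Theory.
Import numFieldNormedType.Exports.

Local Open Scope classical_set_scope.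
Local Open Scope ring_scope.

(** * C^k functions *)

Section CkTheory.
Context {R : realType}.
Implicit Types V : normedModType R.

Lemma CkS V k (f : V -> R) : Ck setT k.+1 f -> Ck setT k f.
Proof.
elim: k f => [|k IH] f; first by case.
case=> cf [df Df]; split=> //; split=> [//|v].
exact: IH.
Qed.

Lemma Ck_cst V k (c : R) : Ck (@setT V) k (fun=> c).
Proof.
elim: k c => [|k IH] c; split=> // *; try exact: cvg_cst.
split=> [*|v]; first exact: derivable_cst.
rewrite [X in Ck _ _ X](_ : _ = fun=> 0) //.
by apply/funext => x; rewrite derive_cst.
Qed.

Lemma Ck_add V k (f g : V -> R) :
  Ck setT k f -> Ck setT k g -> Ck setT k (fun x => f x + g x).
Proof.
elim: k f g => [|k IH] f g [cf Df] [cg Dg]; split=> //.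
- by move=> x _; apply: cvgD; [exact: cf|exact: cg].
- by move=> x _; apply: cvgD; [exact: cf|exact: cg].
case: Df => df Df; case: Dg => dg Dg; split=> [x v _|v].
  by apply: derivableD; [exact: df|exact: dg].
rewrite [X in Ck _ _ X](_ : _ = fun x => 'D_v f x + 'D_v g x).
  by apply: IH; [exact: Df|exact: Dg].
by apply/funext => x; rewrite deriveD//; [exact: df|exact: dg].
Qed.

Lemma Ck_mul V k (f g : V -> R) :
  Ck setT k f -> Ck setT k g -> Ck setT k (fun x => f x * g x).
Proof.
elim: k f g => [|k IH] f g hf hg.
  by case: hf => cf _; case: hg => cg _; split=> // x _;
     apply: cvgM; [exact: cf|exact: cg].
have [cf [df Df]] := hf; have [cg [dg Dg]] := hg; split.
  by move=> x _; apply: cvgM; [exact: cf|exact: cg].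
split=> [x v _|v]; first by apply: derivableM; [exact: df|exact: dg].
rewrite [X in Ck _ _ X](_ : _ = fun x => f x * 'D_v g x + g x * 'D_v f x).
  by apply: Ck_add; apply: IH; first [exact: CkS|exact: Dg|exact: Df].
by apply/funext => x; rewrite deriveM//; [exact: df|exact: dg].
Qed.

(** Reduces directional derivatives to derivatives of functions of one real
    variable. *)
Lemma is_derive_line V (P : V -> R) x v dP :
  is_derive x v P dP <-> is_derive (0 : R) 1 (fun t => P (t *: v + x)) dP.
Proof.
pose Q (t : R) := P (t *: v + x).
have E : (fun h : R => h^-1 *: (Q (h *: 1 + 0) - Q 0)) =
         (fun h : R => h^-1 *: ((P \o shift x) (h *: v) - P x)).
  by apply/funext => h; rewrite /Q /= scale0r add0r addr0 [h *: 1]mulr1.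
by split=> -[d D]; split; move: d D; rewrite /derivable /derive /= E.
Qed.

Lemma is_derive_chain V (f : R -> R) (P : V -> R) x v df dP :
  is_derive (P x) 1 f df -> is_derive x v P dP ->
  is_derive x v (f \o P) (df * dP).
Proof.
move=> Hf /is_derive_line HP; apply/is_derive_line.
apply: (@is_derive1_comp _ f (fun t => P (t *: v + x))) => //.
by rewrite scale0r add0r.
Qed.

Lemma derive_dir (f : R -> R) x v :
  derivable f x 1 -> is_derive x v f (v * 'D_1 f x).
Proof.
move=> /derivableP H.
have := @is_derive_chain _ f id x v _ v H.
by rewrite mulrC; apply; exact: is_derive_id.
Qed.

(** The induction works because the derivative of a composition is a product
    of a composition of the same kind and a derivative, both one order less
    regular. *)
Lemma Ck_comp V k (f : R -> R) (P : V -> R) :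
  Ck setT k f -> Ck setT k P -> Ck setT k (fun x => f (P x)).
Proof.
elim: k f => [|k IH] f hf hP.
  case: hf => cf _; case: hP => cP _; split=> // x _.
  by apply: continuous_comp; [exact: cP|exact: cf].
have [cf [df Df]] := hf; have [cP [dP DP]] := hP; split.
  by move=> x _; apply: continuous_comp; [exact: cP|exact: cf].
have D x v : is_derive x v (f \o P) ('D_1 f (P x) * 'D_v P x).
  by apply: is_derive_chain; apply: derivableP; [exact: df|exact: dP].
split=> [x v _|v]; first by case: (D x v).
rewrite [X in Ck _ _ X](_ : _ = fun x => 'D_1 f (P x) * 'D_v P x).
  apply: Ck_mul; last exact: DP.
  exact: (IH (fun x => 'D_1 f x) (Df 1) (CkS hP)).
by apply/funext => x; case: (D x v).
Qed.

(** A continuous linear form has constant derivatives. *)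
Lemma Ck_linear V k (f : V -> R) : continuous f ->
  (forall x v (t : R), f (t *: v + x) = t * f v + f x) -> Ck setT k f.
Proof.
move=> cf lf; have D x v : is_derive x v f (f v).
  apply/is_derive_line.
  rewrite [X in is_derive _ _ X _](_ : _ = (fun t => t * f v + f x)).
    apply: is_derive_eq => //. by rewrite scaler0 add0r addr0 [_%:A]mulr1.
  by apply/funext => t; rewrite lf.
case: k => [|k]; split=> //; first by move=> x _; exact: cf.
  by move=> x _; exact: cf.
split=> [x v _|v]; first by case: (D x v).
rewrite [X in Ck _ _ X](_ : _ = fun=> f v); first exact: Ck_cst.
by apply/funext => x; case: (D x v).
Qed.

Lemma Ck_id k : Ck (@setT R) k id.
Proof. by apply: Ck_linear => // x; exact: cvg_id. Qed.

Lemma Ck_fst k : Ck (@setT (R * R)) k fst.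
Proof. by apply: Ck_linear => // x; exact: cvg_fst. Qed.

Lemma Ck_snd k : Ck (@setT (R * R)) k snd.
Proof. by apply: Ck_linear => // x; exact: cvg_snd. Qed.

Lemma Ck_primitive (f F : R -> R) : (forall x : R, is_derive x (1 : R) F (f x)) ->
  (forall k, Ck setT k f) -> forall k, Ck setT k F.
Proof.
move=> HF hf; have cF x : setT x -> {for x, continuous F}.
  move=> _; apply: differentiable_continuous; apply/derivable1_diffP.
  by case: (HF x).
case=> [|k]; split=> //; split=> [x v _|v].
  by case: (@derive_dir F x v); [case: (HF x)|].
rewrite [X in Ck _ _ X](_ : _ = fun x => v * f x).
  by apply: Ck_mul; [exact: Ck_cst|exact: hf].
apply/funext => x; case: (HF x) => dF e; case: (@derive_dir F x v dF) => _ ->.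
by rewrite e.
Qed.

End CkTheory.

(** * Test functions *)

Section TestFunctions.
Context {R : realType}.

(** The complement of the support is open, so a test function vanishes near
    such a point and its derivatives vanish too. *)
Lemma test_out (V : normedModType R) (D : set V) (phi : V -> R) (x u : V) :
  test_function D phi -> ~ closure [set x | phi x != 0] x ->
  phi x = 0 /\ 'D_u phi x = 0.
Proof.
move=> [_ _ _] nK; set K := closure _ in nK.
have oK : open (~` K) by rewrite openC; exact: closed_closure.
have nx : \forall y \near x, phi y = 0.
  have : nbhs x (~` K) by exact: open_nbhs_nbhs.
  apply: filterS => y nKy; apply/eqP; apply: contraT => fy.
  by exfalso; apply: nKy; exact: subset_closure.
split; first exact: nbhs_singleton nx.
have : is_derive x u phi 0.
  apply: (@near_eq_is_derive _ _ _ (cst 0)) => //.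
  by apply: filterS nx => y ->.
by case.
Qed.

Lemma test_out_dom (V : normedModType R) (D : set V) (phi : V -> R) (x u : V) :
  test_function D phi -> ~ D x -> phi x = 0 /\ 'D_u phi x = 0.
Proof.
move=> tp nD; apply: (test_out _ tp) => Kx; apply: nD.
by case: tp => _ _; exact.
Qed.

Lemma test_bounded (V : normedModType R) (D : set V) (phi : V -> R) :
  test_function D phi -> exists2 r : R, 0 < r & forall (x u : V), r < `|x| -> phi x = 0 /\ 'D_u phi x = 0.
Proof.
move=> tp; have [_ cK _] := tp.
have [M [_ HM]] := compact_bounded cK.
exists (`|M| + 1); first by rewrite ltr_wpDl.
move=> x u Mx; apply: (test_out _ tp) => Kx.
have : `|x| <= `|M| + 1 by apply: (HM _ _ _ Kx); rewrite (le_lt_trans (ler_norm M))// ltrDl.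
by rewrite leNgt Mx.
Qed.

Lemma test_is_derive (D : set R) (phi : R -> R) (x : R) : test_function D phi ->
  is_derive x (1 : R) phi ('D_1 phi x).
Proof. by case=> /(_ 1%N)[_ [d _]] _ _; apply: derivableP; exact: d. Qed.

Lemma test_continuous_derive (V : normedModType R) (D : set V) (phi : V -> R) (u : V) :
  test_function D phi -> continuous (fun x => 'D_u phi x).
Proof. by case=> /(_ 1%N)[_ [_ d]] _ _ x; case: (d u) => c _; exact: c. Qed.

End TestFunctions.

(** * Smooth bump functions *)

Section Bump.
Context {R : realType}.

(** The powers x^-n in front of exp(-1/x) make the family stable under
    differentiation, see [is_derive_flat]; hence every member is smooth. *)
Definition flat (n : nat) (x : R) : R :=
  if 0 < x then x^-1 ^+ n * expR (- x^-1) else 0.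

(** One term of the exponential series bounds the whole. *)
Lemma expn_expRN n (t : R) : 0 <= t -> t ^+ n * expR (- t) <= n`!%:R.
Proof.
move=> t0; rewrite expRN ler_pdivrMr ?expR_gt0//.
case: n => [|n]; first by rewrite expr0 fact0 mul1r -expR0 ler_expR.
have := expR_ge1Dxn n t0; have f0 : 0 < n.+1`!%:R :> R by rewrite ltr0n fact_gt0.
move=> h; rewrite mulrC -ler_pdivrMr//.
by apply: le_trans h; rewrite lerDr.
Qed.

Lemma flat_ge0 n x : 0 <= flat n x.
Proof.
by rewrite /flat; case: ltP => // x0; rewrite mulr_ge0 ?expR_ge0 ?exprn_ge0// invr_ge0 ltW.
Qed.

Lemma flat_le0 n x : x <= 0 -> flat n x = 0.
Proof. by rewrite /flat leNgt => /negbTE ->. Qed.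

Lemma flat_leM n x : 0 < x -> flat n x <= n.+1`!%:R * x.
Proof.
move=> x0; rewrite /flat x0 -ler_pdivrMr// mulrAC -exprSr.
by apply: expn_expRN; rewrite invr_ge0 ltW.
Qed.

Lemma is_derive_quotient (f : R -> R) (x d : R) :
  h^-1 * (f (h + x) - f x) @[h --> 0^'] --> d -> is_derive x (1 : R) f d.
Proof.
move=> H.
have E : (fun h : R => h^-1 *: ((f \o shift x) (h *: 1) - f x)) =
         (fun h : R => h^-1 * (f (h + x) - f x)).
  by apply/funext => h; rewrite /= [h *: 1]mulr1.
split; rewrite /derivable /derive E; first by apply/cvg_ex; exists d.
exact/cvg_lim.
Qed.

Lemma is_derive_expn_expRN n (t : R) :
  is_derive t (1 : R) (fun t => t ^+ n * expR (- t))
    (n%:R * t ^+ n.-1 * expR (- t) - t ^+ n * expR (- t)).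
Proof.
have H1 : is_derive t (1 : R) (fun t : R => t ^+ n) (n%:R * t ^+ n.-1).
  have -> : (fun t : R => t ^+ n) = id ^+ n.
    by apply/funext => y; rewrite fctE.
  by apply: is_derive_eq; rewrite [_%:A]mulr1.
have H2 : is_derive t (1 : R) (fun t : R => expR (- t)) (- expR (- t)).
  have := @is_derive1_comp R expR (fun x => - x) t (expR (- t)) (- 1).
  by rewrite mulrN1; apply; exact: is_derive_eq.
by apply: is_derive_eq; rewrite /GRing.scale/=; ring.
Qed.

(** At 0 the difference quotient of [flat n] is [flat n.+1], which tends to 0
    by [flat_leM]. *)
Lemma is_derive_flat n (x : R) :
  is_derive x (1 : R) (flat n) (- n%:R * flat n.+1 x + flat n.+2 x).
Proof.
have [x0|x0|->] := ltgtP x 0.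
- rewrite !flat_le0 ?ltW// mulr0 addr0.
  apply: (@near_eq_is_derive _ _ _ (cst 0)) => //.
  near=> y; rewrite /= flat_le0// ltW//; near: y; exact: lt_nbhsl.
- rewrite /flat x0.
  have xn0 : x != 0 by rewrite gt_eqF.
  apply: (@near_eq_is_derive _ _ _ ((fun t => t ^+ n * expR (- t)) \o GRing.inv)).
    near=> y; rewrite ifT //; near: y; exact: lt_nbhsr.
  have Hi := @is_deriveV _ id x 1 1 xn0 (is_derive_id _ _).
  have := is_derive1_comp (is_derive_expn_expRN n x^-1) Hi.
  move=> H; apply: (is_derive_eq H).
  rewrite /GRing.scale/= mulr1 -exprVn; set t := x^-1; set E := expR _.
  case: n {H} => [|n] /=; first by rewrite !mul0r; ring.
  by rewrite !exprS; ring.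
- rewrite !flat_le0// mulr0 addr0; apply: is_derive_quotient.
  rewrite (flat_le0 n)//.
  apply/cvgr0Pnorm_le => e e0.
  near=> h; rewrite subr0 addr0.
  have [h0|h0] := leP h 0; first by rewrite flat_le0// mulr0 normr0 ltW.
  have -> : h^-1 * flat n h = flat n.+1 h by rewrite /flat h0 exprS mulrA.
  rewrite ger0_norm ?flat_ge0//.
  apply: (le_trans (flat_leM _ h0)).
  rewrite -ler_pdivlMl ?ltr0n ?fact_gt0// (le_trans (ler_norm _))//.
  near: h; apply: dnbhs0_le.
  by rewrite mulr_gt0// invr_gt0 ltr0n fact_gt0.
Unshelve. all: by end_near. Qed.

Lemma Ck_flat k n : Ck setT k (flat n).
Proof.
have cf n' (x : R) : {for x, continuous (flat n')}.
  apply: differentiable_continuous; apply/derivable1_diffP.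
  by case: (is_derive_flat n' x).
elim: k n => [|k IH] n; split=> //.
split=> [x v _|v].
  by case: (@derive_dir _ (flat n) x v) => //; case: (is_derive_flat n x).
rewrite [X in Ck _ _ X](_ : _ =
   fun x => v * (- n%:R * flat n.+1 x + flat n.+2 x)).
  apply: Ck_mul; first exact: Ck_cst.
  by apply: Ck_add => //; apply: Ck_mul => //; exact: Ck_cst.
apply/funext => x; have [d e] := is_derive_flat n x.
by case: (@derive_dir _ (flat n) x v) => // _ ->; rewrite e.
Qed.

Lemma flat0_le1 x : flat 0 x <= 1.
Proof.
rewrite /flat; case: ltP => // x0.
by rewrite expr0 mul1r -expR0 ler_expR oppr_le0 invr_ge0 ltW.
Qed.

(** Smooth, supported in ]p, s[, and increasing to the indicator of ]p, s[ as n
    grows: the argument of [flat 0] tends to +oo inside the interval and is at most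
    -1 outside. *)
Definition bump (p s : R) (n : nat) (x : R) : R :=
  flat 0 (n%:R * ((x - p) * (s - x)) - 1).

Lemma bump_ge0 p s n x : 0 <= bump p s n x. Proof. exact: flat_ge0. Qed.

Lemma bump_le1 p s n x : bump p s n x <= 1. Proof. exact: flat0_le1. Qed.

Lemma Ck_bump p s n k : Ck setT k (bump p s n).
Proof.
apply: (@Ck_comp _ _ k (flat 0)); first exact: Ck_flat.
apply: Ck_add; last exact: Ck_cst.
apply: Ck_mul; first exact: Ck_cst.
apply: Ck_mul; first by apply: Ck_add; [exact: Ck_id|exact: Ck_cst].
apply: Ck_add; first exact: Ck_cst.
by apply: Ck_linear => [x|x v t]; [apply: cvgN; exact: cvg_id|rewrite opprD mulrN].
Qed.

Lemma bump_neq0 p s n x : bump p s n x != 0 -> 1 < n%:R * ((x - p) * (s - x)).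
Proof.
by apply: contra_neqT; rewrite -leNgt => h; rewrite /bump flat_le0// subr_le0.
Qed.

Lemma ge1_bump_itv (p s x : R) n : p < s -> 1 <= n%:R * ((x - p) * (s - x)) -> p < x < s.
Proof.
move=> ps h; have : 0 < (x - p) * (s - x).
  rewrite ltNge; apply/negP => h'; have n0 : 0 <= n%:R :> R by [].
  by have := mulr_ge0_le0 n0 h'; lra.
by move=> h'; apply/andP; split; rewrite ltNge; apply/negP => h''; nra.
Qed.

Lemma closure_bump p s n :
  closure [set x | bump p s n x != 0] `<=`
  [set x | 1 <= n%:R * ((x - p) * (s - x))].
Proof.
set A := (X in _ `<=` X); have cA : closed A.
  pose F := (fun x : R => n%:R * ((x - p) * (s - x))).
  have -> : A = F @^-1` [set y | 1 <= y] by [].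
  apply: closed_comp; last exact: closed_ge.
  move=> x _; apply: cvgM; first exact: cvg_cst.
  by apply: cvgM; apply: cvgB; first [exact: cvg_id|exact: cvg_cst].
rewrite closureE => x; apply; split=> // y /= /bump_neq0; exact: ltW.
Qed.

Lemma bump_test (I : set R) p s n : p < s -> `]p, s[ `<=` I ->
  test_function I (bump p s n).
Proof.
move=> ps psI; have H : closure [set x | bump p s n x != 0] `<=` `]p, s[.
  by apply: subset_trans; first exact: closure_bump; move=> x /(ge1_bump_itv ps);
    rewrite /= in_itv.
split; first by move=> k; exact: Ck_bump.
  apply: (@subclosed_compact _ _ `[p, s]); first exact: closed_closure.
    exact: segment_compact.
  by apply: subset_trans H _; exact: subset_itv_oo_cc.
exact: subset_trans H psI.
Qed.

Lemma bump_out p s n x : p < s -> ~~ (p < x < s) -> bump p s n x = 0.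
Proof.
move=> ps; apply: contraNeq => /bump_neq0 /ltW; exact: ge1_bump_itv.
Qed.

Lemma cvg_bump p s x : p < s ->
  bump p s n x @[n --> \oo] --> (\1_`]p, s[ x : R).
Proof.
move=> ps; rewrite indicE mem_setE in_itv/=.
have [/andP[px xs]|] := boolP (p < x < s); last first.
  move=> h; rewrite (_ : (bump p s)^~ x = fun=> 0); first exact: cvg_cst.
  by apply/funext => n; rewrite bump_out.
set c := (x - p) * (s - x); have c0 : 0 < c by rewrite mulr_gt0// subr_gt0.
apply/cvgrPdist_le => e e0.
near=> n.
have hn : e^-1 + 1 < n%:R * c.
  rewrite -ltr_pdivrMr//; near: n; exact: nbhs_infty_gtr.
have i0 : 0 < e^-1 by rewrite invr_gt0.
rewrite /bump -/c /flat ifT; last by lra.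
rewrite expr0 mul1r ger0_norm; last first.
  by rewrite subr_ge0 -[leRHS]expR0 ler_expR oppr_le0 invr_ge0; lra.
have : (n%:R * c - 1)^-1 <= e.
  by rewrite -[leRHS]invrK lef_pV2 ?posrE ?invr_gt0//; lra.
have := expR_ge1Dx (- (n%:R * c - 1)^-1).
by move=> h1 h2; rewrite -[true%:R]/(1 : R); lra.
Unshelve. all: by end_near. Qed.

End Bump.

(** * Integration lemmas and the fundamental lemma of the calculus of variations *)

Section AlmostEverywhere.
Context {R : realType} {m : {measure set (measurableTypeR R) -> \bar R}}.
Implicit Types P Q : R -> Prop.

(** States monotonicity with a variable of type [R], so that no measurable
    carrier type appears in the predicates that unification has to find. *)
Lemma ae_mono P Q : (forall x, P x -> Q x) ->
  {ae m, forall x, P x} -> {ae m, forall x, Q x}.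
Proof. exact: (@filterS _ _ (ae_filter_ringOfSetsType m)). Qed.

Lemma ae_mono2 P1 P2 Q : (forall x, P1 x -> P2 x -> Q x) ->
  {ae m, forall x, P1 x} -> {ae m, forall x, P2 x} -> {ae m, forall x, Q x}.
Proof. exact: (@filterS2 _ _ (ae_filter_ringOfSetsType m)). Qed.

Lemma ae_mono3 P1 P2 P3 Q : (forall x, P1 x -> P2 x -> P3 x -> Q x) ->
  {ae m, forall x, P1 x} -> {ae m, forall x, P2 x} -> {ae m, forall x, P3 x} ->
  {ae m, forall x, Q x}.
Proof. exact: (@filterS3 _ _ (ae_filter_ringOfSetsType m)). Qed.

End AlmostEverywhere.

Section IntegralHelpers.
Context d (T : measurableType d) (R : realType).
Variable mu : {measure set T -> \bar R}.

Lemma integrable_mulb (D : set T) (f h : T -> R) (M : R) : measurable D ->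
  mu.-integrable D (EFin \o f) -> measurable_fun D h ->
  (forall x, D x -> `|h x| <= M) ->
  mu.-integrable D (EFin \o (fun x => f x * h x)).
Proof.
move=> mD fi mh hM.
have mf : measurable_fun D f by apply/measurable_EFinP; exact: measurable_int fi.
apply: (@le_integrable _ _ _ _ _ mD _ (fun x => (M * `|f x|)%:E)).
- by apply/measurable_EFinP; exact: measurable_funM.
- move=> x Dx; rewrite /= lee_fin normrM (ger0_norm (_ : 0 <= M * _)).
    by rewrite mulrC ler_wpM2r// hM.
  by rewrite mulr_ge0// (le_trans _ (hM _ Dx)).
- under eq_fun do rewrite EFinM.
  by apply: integrableZl => //; exact: integrable_norm.
Qed.

Lemma Rdominated_cvg (D : set T) (f_ : nat -> T -> R) (f g : T -> R) :
  measurable D -> (forall n, measurable_fun D (f_ n)) ->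
  (forall x, D x -> f_ n x @[n --> \oo] --> f x) ->
  mu.-integrable D (EFin \o g) ->
  (forall n x, D x -> `|f_ n x| <= g x) ->
  mu.-integrable D (EFin \o f) /\
  \int[mu]_(x in D) f_ n x @[n --> \oo] --> \int[mu]_(x in D) f x.
Proof.
move=> mD mf_ cf ig fg.
have mf : measurable_fun D f by exact: measurable_fun_cvg cf.
have [fi _ H] : [/\ mu.-integrable D (EFin \o f),
  (\int[mu]_(x in D) `|(f_ n x)%:E - (f x)%:E| @[n --> \oo] --> 0)%E &
  (\int[mu]_(x in D) (f_ n x)%:E @[n --> \oo] --> \int[mu]_(x in D) (f x)%:E)%E].
  apply: (@dominated_convergence _ _ _ mu D mD (fun n => EFin \o f_ n)
    (EFin \o f) (EFin \o g)) => //.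
  - by move=> n; apply/measurable_EFinP.
  - by apply/measurable_EFinP.
  - by apply: aeW => x Dx; apply: cvg_EFin; [exact: nearW|exact: cf].
  - by apply: aeW => x n Dx; rewrite /= lee_fin; exact: fg.
split=> //; apply: fine_cvg; rewrite fineK//.
by apply: integrable_fin_num.
Qed.

Lemma integrable_restrict (D : set T) (f : T -> R) : measurable D ->
  mu.-integrable D (EFin \o f) -> mu.-integrable setT (EFin \o (f \_ D)).
Proof.
move=> mD fi.
have := (@integrable_mkcond _ T R mu D (EFin \o f) mD).1 fi.
by rewrite restrict_EFin.
Qed.

Lemma Rintegral_sub_set (D E : set T) (f : T -> R) :
  E `<=` D -> (forall x, D x -> ~ E x -> f x = 0) ->
  \int[mu]_(x in E) f x = \int[mu]_(x in D) f x.
Proof.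
move=> ED H; rewrite [LHS]Rintegral_mkcond [RHS]Rintegral_mkcond.
congr Rintegral; apply/funext => x; rewrite !patchE.
have [|xE] := boolP (x \in E).
  by rewrite inE => Ex; rewrite ifT// inE; exact: ED.
case: ifPn => //; rewrite inE => Dx; rewrite H//.
by move: xE; rewrite notin_setE.
Qed.

(** If the integral were 0, then f^2 would vanish almost everywhere. *)
Lemma Rintegral_sq_gt0 (D : set T) (f : T -> R) :
  measurable D -> mu.-integrable D (fun x => (f x ^+ 2)%:E) ->
  ~ {ae mu, forall x, D x -> f x = 0} -> 0 < \int[mu]_(x in D) (f x ^+ 2).
Proof.
move=> mD fi fn0.
rewrite lt_neqAle Rintegral_ge0 ?andbT; last by move=> x _; exact: sqr_ge0.
apply/eqP => Z0; apply: fn0.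
have E0 : (\int[mu]_(x in D) `|(f x ^+ 2)%:E| = 0)%E.
  transitivity (\int[mu]_(x in D) (f x ^+ 2)%:E)%E.
    by apply: eq_integral => x _; rewrite gee0_abs// lee_fin sqr_ge0.
  by rewrite -[LHS]fineK ?integrable_fin_num// -/(Rintegral _ _ _) -Z0.
have mf2 : measurable_fun D (fun x => (f x ^+ 2)%:E) by exact: measurable_int fi.
move: E0 => /(ae_eq_integral_abs mu mD mf2).
apply: filterS => x H Ix; have /eqP := H Ix.
by rewrite eqe sqrf_eq0 => /eqP.
Qed.

Lemma Rintegral_ae_eq (f k : T -> R) :
  mu.-integrable setT (EFin \o f) -> mu.-integrable setT (EFin \o k) ->
  {ae mu, forall x, f x = k x} -> \int[mu]_x f x = \int[mu]_x k x.
Proof.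
move=> fi ki H; rewrite /Rintegral; congr fine; apply: ae_eq_integral => //.
- exact: measurable_int fi.
- exact: measurable_int ki.
- by apply: filterS H => x /= Hx _; congr EFin.
Qed.

(** By |f g| <= f^2 + g^2. *)
Lemma L2_mul (D : set T) (f g : T -> R) :
  measurable D -> L2 mu D f -> L2 mu D g -> mu.-integrable D (EFin \o (fun x => f x * g x)).
Proof.
move=> mD [mf fi] [mg gi].
apply: (@le_integrable _ T R mu D mD _ (EFin \o (fun x => f x ^+ 2 + g x ^+ 2))).
- by apply/measurable_EFinP; exact: measurable_funM.
- move=> x _; rewrite lee_fin [leRHS]ger0_norm ?addr_ge0 ?sqr_ge0// normrM.
  rewrite -(real_normK (num_real (f x))) -(real_normK (num_real (g x))).
  have := sqr_ge0 (`|f x| - `|g x|); have := normr_ge0 (f x); have := normr_ge0 (g x).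
  by nra.
- rewrite (_ : EFin \o _ = (fun x => (f x ^+ 2)%:E) \+ (fun x => (g x ^+ 2)%:E))%E//.
  exact: integrableD.
Qed.

End IntegralHelpers.

Section FundamentalLemma.
Context {R : realType}.
Notation leb := (@lebesgue_measure R).

Lemma measurable_Ck (f : R -> R) (D : set R) : measurable D ->
  Ck setT 0 f -> measurable_fun D f.
Proof.
move=> mD [cf _]; apply: measurable_funTS; apply: continuous_measurable_fun.
by move=> x; exact: cf.
Qed.

Lemma measurable_bump (p s : R) n (D : set R) : measurable D ->
  measurable_fun D (bump p s n).
Proof. by move=> mD; apply: measurable_Ck => //; exact: Ck_bump. Qed.

(** The primitive of f vanishes at the rationals, hence everywhere by continuity;
    by Lebesgue differentiation f is almost everywhere its derivative. *)
Lemma ae0_integral_itv (c d : R) (f : R -> R) : c < d ->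
  leb.-integrable `]c, d[ (EFin \o f) ->
  (forall q : rat, c < ratr q < d -> \int[leb]_(x in `]c, ratr q[) f x = 0) ->
  {ae leb, forall x, x \in `]c, d[ -> f x = 0}.
Proof.
move=> cd fi fq; set D := `]c, d[%classic.
have mD : measurable (D : set (measurableTypeR R)) by exact: measurable_itv.
pose f0 := f \_ D.
have f0i : leb.-integrable setT (EFin \o f0).
  by have := (@integrable_mkcond _ (measurableTypeR R) R leb D (EFin \o f) mD).1 fi; rewrite restrict_EFin.
have f0iA (A : set R) : measurable A -> leb.-integrable A (EFin \o f0).
  by move=> mA; apply: integrableS f0i.
pose F y := \int[leb]_(t in `[c, y]) f0 t.
have FE y : y <= d -> F y = \int[leb]_(x in `]c, y[) f x.
  move=> yd; rewrite /F -Rintegral_itv_bndo_bndc ?f0iA//.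
  rewrite -Rintegral_itv_obnd_cbnd ?f0iA//.
  apply: eq_Rintegral => x; rewrite inE/= in_itv/= => /andP[cx xy].
  by rewrite /f0 patchE mem_set// /D /= in_itv/= cx (lt_le_trans xy).
have cF x : c < x < d -> {for x, continuous F}.
  move=> /andP[cx xd].
  have := @parameterized_integral_continuous R c d f0 (ltW cd) (f0iA _ (measurable_itv _)).
  move=> /(continuous_within_itvP _ cd)[+ _ _]; apply.
  by rewrite in_itv/= cx.
have F0 x : c < x < d -> F x = 0.
  move=> cxd; apply/eqP; apply: contraT => Fx0.
  have : \forall y \near x, F y != 0 /\ c < y < d.
    apply: filterI; first exact: (cvgr_neq0 (F x) (cF x cxd)).
    by move/andP: cxd => [cx xd]; near=> y; apply/andP; split;
      near: y; [exact: lt_nbhsr|exact: lt_nbhsl].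
  move=> [e /= e0 He].
  have [q] : exists q : rat, ratr q \in `]x, x + e[.
    by apply: rat_in_itvoo; rewrite ltrDl.
  rewrite in_itv/= => /andP[xq qe].
  have [|Fq cqd] := He (ratr q).
  - by rewrite /ball/= distrC ger0_norm; lra.
  - by move: Fq; rewrite FE ?fq ?eqxx//; move/andP: cqd => [_ /ltW].
have lf0 : locally_integrable setT f0 by exact: open_integrable_locally openT f0i.
have ae := @FTC1 R f0 (BLeft c) (fun y => f0iA _ (measurable_itv _)) lf0.
apply: (ae_mono _ ae) => x H; rewrite in_itv/= => /andP[cx xd].
have [|_] := H; first by rewrite /Order.lt/= ?bnd_simp.
rewrite derive1E => F'.
have <- : f0 x = f x by rewrite /f0 patchE mem_set// /D/= in_itv/= cx.
rewrite -F'.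
have : is_derive x (1 : R) F 0.
  apply: (@near_eq_is_derive _ _ _ (cst 0)) => //.
  near=> y; rewrite F0//; apply/andP; split; near: y;
    [exact: lt_nbhsr|exact: lt_nbhsl].
by case.
Unshelve. all: by end_near. Qed.

(** The fundamental lemma of the calculus of variations, for a countable family of
    test functions: dominated convergence turns bumps into indicators of
    intervals. *)
Lemma ae0_bump (c d : R) (f : R -> R) : c < d ->
  leb.-integrable `]c, d[ (EFin \o f) ->
  (forall (q : rat) n, c < ratr q < d ->
     \int[leb]_(x in `]c, d[) (f x * bump c (ratr q) n x) = 0) ->
  {ae leb, forall x, x \in `]c, d[ -> f x = 0}.
Proof.
move=> cd fi H; apply: ae0_integral_itv => // q cqd.
have mf : measurable_fun `]c, d[ f by apply/measurable_EFinP; exact: measurable_int fi.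
have /andP[cq qd] := cqd.
have dom n (x : R) : `]c, d[%classic x ->
    `|f x * bump c (ratr q) n x| <= `|f x|.
  move=> _; rewrite normrM (ger0_norm (bump_ge0 _ _ _ _)).
  by rewrite ler_piMr// bump_le1.
have [_] := @Rdominated_cvg _ _ R leb `]c, d[
  (fun n x => f x * bump c (ratr q) n x)
  (fun x => f x * \1_`]c, ratr q[ x) (fun x => `|f x|)
  (measurable_itv _)
  (fun n => measurable_funM mf (measurable_bump c (ratr q) n (measurable_itv _)))
  (fun x _ => cvgM (cvg_cst _) (cvg_bump cq))
  (integrable_norm fi) dom.
under eq_fun do rewrite H//.
move=> /(cvg_lim (@Rhausdorff R)); rewrite lim_cst// => E.
rewrite [RHS]E Rintegral_mkcond [RHS]Rintegral_mkcond.
congr Rintegral; apply/funext => x; rewrite !patchE indicE.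
have [xq|xq] := boolP (x \in _).
  rewrite mulr1 ifT//; move: xq; rewrite !inE/= !in_itv/= => /andP[-> /lt_trans->//].
by rewrite mulr0; case: ifP.
Qed.

End FundamentalLemma.

(** * Fubini for real-valued integrals *)

(** Inner integrals are finite only almost everywhere; taking [fine] changes
    them on a null set. *)
Lemma integrable_fine_total d (T : measurableType d) (R : realType)
    (m : {measure set T -> \bar R}) (F : T -> \bar R) :
  m.-integrable setT F ->
  m.-integrable setT (EFin \o (fun x => fine (F x))) /\
  \int[m]_x fine (F x) = fine (\int[m]_x F x)%E.
Proof.
move=> iF; have mF : measurable_fun setT F := measurable_int _ iF.
have E : {ae m, forall x, setT x -> (fine (F x))%:E = F x}.
  have := integrable_ae measurableT iF.
  by apply: filterS => x /= /(_ I) Fx _; rewrite fineK.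
have mf : measurable_fun setT (EFin \o (fun x => fine (F x))).
  by apply/measurable_EFinP; exact: measurableT_comp.
split; last by rewrite /Rintegral; congr fine; exact: ae_eq_integral.
apply/integrableP; split=> //.
move/integrableP : iF => [_]; apply: le_lt_trans.
rewrite le_eqVlt; apply/orP; left; apply/eqP; apply: ae_eq_integral => //.
- exact: measurableT_comp.
- exact: measurableT_comp.
- by apply: filterS E => x H Tx; congr (`|_|%E); exact: H.
Qed.

Section FubiniHelpers.
Context d1 d2 (T1 : measurableType d1) (T2 : measurableType d2) (R : realType).
Variable m1 : {sigma_finite_measure set T1 -> \bar R}.
Variable m2 : {sigma_finite_measure set T2 -> \bar R}.

Lemma integrable_Rintegral1 (f : T1 * T2 -> R) :
  (m1 \x m2)%E.-integrable setT (EFin \o f) ->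
  m1.-integrable setT (EFin \o (fun x => \int[m2]_y f (x, y))) /\
  \int[m1]_x \int[m2]_y f (x, y) = \int[(m1 \x m2)%E]_z f z.
Proof.
move=> fi; have [i1 E] := integrable_fine_total (integrable_fubini_F fi).
by split=> //; rewrite [LHS]E [RHS]/Rintegral -integral12_prod_meas1.
Qed.

Lemma integrable_Rintegral2 (f : T1 * T2 -> R) :
  (m1 \x m2)%E.-integrable setT (EFin \o f) ->
  m2.-integrable setT (EFin \o (fun y => \int[m1]_x f (x, y))) /\
  \int[m2]_y \int[m1]_x f (x, y) = \int[(m1 \x m2)%E]_z f z.
Proof.
move=> fi; have iF : m2.-integrable setT (fubini_G m1 (EFin \o f)).
  have mf : measurable_fun setT (EFin \o f) by exact: measurable_int fi.
  have fi' : (m2 \x m1)%E.-integrable setT (EFin \o f \o (fun z => (z.2, z.1))).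
    apply/integrable12ltyP; first by apply: measurableT_comp => //; exact: measurable_swap.
    exact/(integrable21ltyP _ _ mf).
  exact: integrable_fubini_F fi'.
have [i1 E] := integrable_fine_total iF.
by split=> //; rewrite [LHS]E [RHS]/Rintegral -integral21_prod_meas1.
Qed.

Lemma integrable_tensor (f : T1 -> R) (h : T2 -> R) :
  m1.-integrable setT (EFin \o f) -> m2.-integrable setT (EFin \o h) ->
  (m1 \x m2)%E.-integrable setT (EFin \o (fun z => f z.1 * h z.2)).
Proof.
move=> fi hi.
have mf : measurable_fun setT f by apply/measurable_EFinP; exact: measurable_int fi.
have mh : measurable_fun setT h by apply/measurable_EFinP; exact: measurable_int hi.
apply/integrable12ltyP.
  apply/measurable_EFinP; apply: measurable_funM; exact: measurableT_comp.
under eq_integral => x _.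
  under eq_integral => y _ do rewrite /= normrM EFinM.
  rewrite ge0_integralZl//; last first.
    by apply/measurable_EFinP; exact: measurableT_comp.
  over.
have := hi; move/integrableP => [_ hi'].
rewrite ge0_integralZr//; last 2 first.
- by apply/measurable_EFinP; exact: measurableT_comp.
- exact: integral_ge0.
by move/integrableP : fi => [_ fi']; apply: lte_mul_pinfty => //;
  [exact: integral_ge0|rewrite ge0_fin_numE//; exact: integral_ge0].
Qed.

End FubiniHelpers.

(** * Primitives of test functions *)

Section Primitive.
Context {R : realType}.
Notation leb := (@lebesgue_measure R).

(** The closure of the support is compact in an open interval, so it has a
    least and a greatest element; the midpoint is added in case it is empty. *)
Lemma test_support (c d : R) (al : R -> R) : c < d ->
  test_function `]c, d[ al ->
  exists c' d', [/\ c < c', c' <= d', d' < d &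
    forall x, ~~ (c' <= x <= d') -> al x = 0].
Proof.
move=> cd [_ cK Ksub]; set K := closure _ in cK Ksub.
(* The midpoint makes the compact set nonempty even if the support is empty. *)
pose m := (c + d) / 2; pose K' := K `|` [set m].
have cK' : compact K' by apply: compactU => //; exact: compact_set1.
have K'0 : K' !=set0 by exists m; right.
have K'sub : K' `<=` `]c, d[.
  move=> x [/Ksub//|->]; rewrite /= in_itv/= /m; apply/andP; split; lra.
have cid : {within K', continuous (id : R -> R)}.
  by apply: continuous_subspaceT => x; exact: cvg_id.
have [y1 /set_mem K'y1 hy1] := compact_EVT_min K'0 cK' cid.
have [y2 /set_mem K'y2 hy2] := compact_EVT_max K'0 cK' cid.
have := K'sub _ K'y1; rewrite /= in_itv/= => /andP[cy1 _].
have := K'sub _ K'y2; rewrite /= in_itv/= => /andP[_ y2d].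
exists y1, y2; split=> //; first by apply: hy1; rewrite inE.
move=> x; apply: contraNeq => alx.
have K'x : x \in K' by rewrite inE; left; apply: subset_closure.
by rewrite hy1// hy2.
Qed.

Lemma test_of_support (c d c' d' : R) (al : R -> R) : c < c' -> d' < d ->
  (forall k, Ck setT k al) -> (forall x, ~~ (c' <= x <= d') -> al x = 0) ->
  test_function `]c, d[ al.
Proof.
move=> cc' dd' Ckal H1; have S : closure [set x | al x != 0] `<=` `[c', d'].
  rewrite closureE => x; apply; split; first exact: itv_closed.
  by move=> y /=; rewrite in_itv/=; apply: contraNT => /H1 ->.
split=> //.
- apply: subclosed_compact S; first exact: closed_closure.
  exact: segment_compact.
- apply: subset_trans S _ => x; rewrite /= !in_itv/= => /andP[? ?].
  by apply/andP; split; lra.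
Qed.

Lemma test_lincomb (c d a b : R) (al be : R -> R) : c < d ->
  test_function `]c, d[ al -> test_function `]c, d[ be ->
  test_function `]c, d[ (fun x => a * al x + b * be x).
Proof.
move=> cd tal tbe.
have [c1 [d1 [cc1 _ dd1 H1]]] := test_support cd tal.
have [c2 [d2 [cc2 _ dd2 H2]]] := test_support cd tbe.
apply: (@test_of_support _ _ (Num.min c1 c2) (Num.max d1 d2)).
- by rewrite lt_min cc1.
- by rewrite gt_max dd1.
- move=> k; apply: Ck_add; apply: Ck_mul; try exact: Ck_cst.
  + by case: tal.
  + by case: tbe.
- move=> x; rewrite negb_and -!ltNge lt_min gt_max => h.
  rewrite H1 ?H2; first by rewrite !mulr0 addr0.
  + by rewrite negb_and -!ltNge; case/orP: h => /andP[h1 h2]; rewrite ?h1 ?h2 ?orbT.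
  + by rewrite negb_and -!ltNge; case/orP: h => /andP[h1 h2]; rewrite ?h1 ?h2 ?orbT.
Qed.

Variables (c d : R) (al : R -> R).
Hypotheses (cd : c < d) (tal : test_function `]c, d[ al).

(** The primitive of a test function is again a test function exactly when the
    integral of the test function is 0 ([prim_test]). *)
Definition prim (x : R) : R := \int[leb]_(t in `[c, x]) al t.

Lemma continuous_test : continuous al.
Proof. by have [/(_ 0%N)[cal _] _ _] := tal => x; exact: cal. Qed.

Lemma integrable_test (A : set R) : measurable (A : set (measurableTypeR R)) ->
  leb.-integrable A (EFin \o al).
Proof.
move=> mA; have [c' [d' [cc' cd' dd' H]]] := test_support cd tal.
have i1 : leb.-integrable `[c', d'] (EFin \o al).
  apply: continuous_compact_integrable; first exact: segment_compact.
  by apply: continuous_subspaceT; exact: continuous_test.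
apply: (@integrableS _ _ _ _ setT) => //.
have := (@integrable_mkcond _ (measurableTypeR R) R leb `[c', d'] (EFin \o al) (measurable_itv _)).1 i1.
rewrite restrict_EFin (_ : al \_ _ = al)//.
apply/funext => x; rewrite patchE; case: ifPn => //.
by rewrite notin_setE/= in_itv/= => /negP/H.
Qed.

Hypothesis al0 : \int[leb]_(x in `]c, d[) al x = 0.

(** To the right of the support the primitive is the full integral, which is 0. *)
Lemma prim_out : exists c' d', [/\ c < c', c' <= d', d' < d &
    forall x, ~~ (c' <= x <= d') -> prim x = 0].
Proof.
have [c' [d' [cc' cd' dd' H]]] := test_support cd tal.
exists c', d'; split=> // x; rewrite negb_and -!ltNge => /orP[xc|xd].
  rewrite /prim -[RHS](Rintegral_set0 leb al) Rintegral_mkcond [RHS]Rintegral_mkcond.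
  congr Rintegral; apply/funext => y; rewrite !patchE.
  rewrite [in RHS]ifF; last by rewrite in_set0.
  case: ifPn => //; rewrite inE/= in_itv/= => /andP[cy yx].
  by rewrite H//; apply/negP => /andP[]; lra.
rewrite -[RHS]al0 /prim Rintegral_mkcond [RHS]Rintegral_mkcond.
congr Rintegral; apply/funext => y; rewrite !patchE !mem_setE !in_itv/=.
have [?|yc] := boolP (c' <= y <= d').
  by rewrite !ifT//; apply/andP; split; lra.
by rewrite H//; case: ifP; case: ifP.
Qed.

Lemma is_derive_prim (x : R) : is_derive x (1 : R) prim (al x).
Proof.
have [c' [d' [cc' cd' dd' H]]] := test_support cd tal.
have [c1 [d1 [cc1 cd1 dd1 H1]]] := prim_out.
have [xc|cx] := leP x c.
  rewrite H; last by apply/negP => /andP[]; lra.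
  apply: (@near_eq_is_derive _ _ _ (cst 0)) => //.
  near=> y; rewrite H1//; apply/negP => /andP[h _].
  have : y < c1; last by lra.
  by near: y; apply: lt_nbhsl; lra.
have xx1 : x < x + 1 by rewrite ltrDl.
have := @continuous_FTC1_closed R al c x (x + 1) xx1
  (integrable_test (measurable_itv _)) cx (@continuous_test x).
by rewrite derive1E => -[D E]; split.
Unshelve. all: by end_near. Qed.

Lemma prim_test : test_function `]c, d[ prim.
Proof.
have [c1 [d1 [cc1 cd1 dd1 H1]]] := prim_out.
apply: (test_of_support cc1 dd1 _ H1).
apply: (@Ck_primitive _ al); first exact: is_derive_prim.
by have [] := tal.
Qed.

End Primitive.

(** * Integration by parts against a primitive *)

Section Triangle.
Context {R : realType}.
Notation leb := (@lebesgue_measure R).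

Definition lower_triangle : set (measurableTypeR R * measurableTypeR R) :=
  [set z | (z.2 : R) < z.1].

Lemma measurable_lower_triangle : measurable lower_triangle.
Proof.
have := @measurable_fun_ltr _ (measurableTypeR R * measurableTypeR R)%type R setT
  fst snd measurable_fst measurable_snd.
have := @measurable_fun_ltr _ (measurableTypeR R * measurableTypeR R)%type R setT
  snd fst measurable_snd measurable_fst.
move=> /(_ measurableT [set true]) H _.
rewrite (_ : lower_triangle = setT `&` (fun x => (x.2 : R) < x.1) @^-1` [set true]).
  exact: H.
by rewrite setTI; apply/seteqP; split.
Qed.

Lemma lower_triangleE (x t : R) : \1_lower_triangle (x, t) = ((t < x)%R : nat)%:R :> R.
Proof.
rewrite indicE (_ : (_ \in _) = (t < x)%R)//.
by apply/idP/idP; rewrite inE.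
Qed.

Lemma integrable_triangle (f h : R -> R) :
  leb.-integrable setT (EFin \o f) -> leb.-integrable setT (EFin \o h) ->
  (leb \x leb)%E.-integrable setT
    (EFin \o (fun z : R * R => f z.1 * h z.2 * \1_lower_triangle z)).
Proof.
move=> fi hi; apply: (@integrable_mulb _ _ _ _ _ _ _ 1) => //.
- exact: integrable_tensor.
- exact: measurable_indic measurable_lower_triangle.
- by move=> x _; rewrite ger0_norm// indicE; case: (_ \in _).
Qed.

(** Both sides integrate f(x) h(t) over the triangle t < x. *)
Lemma Rintegral_triangle (f h : R -> R) :
  leb.-integrable setT (EFin \o f) -> leb.-integrable setT (EFin \o h) ->
  \int[leb]_x (f x * \int[leb]_(t in `]-oo, x[) h t) =
  \int[leb]_t (h t * \int[leb]_(x in `]t, +oo[) f x).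
Proof.
move=> fi hi; have FI := integrable_triangle fi hi.
transitivity (\int[leb]_x \int[leb]_t (f x * h t * \1_lower_triangle (x, t))).
  apply: eq_Rintegral => x _; rewrite -RintegralZl//; last exact: integrableS hi.
  rewrite Rintegral_mkcond; apply: eq_Rintegral => t _.
  rewrite lower_triangleE patchE mem_setE in_itv/=.
  by case: ltP; rewrite ?mulr1 ?mulr0.
transitivity (\int[leb]_t \int[leb]_x (f x * h t * \1_lower_triangle (x, t))).
  have [_ /= ->] := integrable_Rintegral1 FI.
  by have [_ /= ->] := integrable_Rintegral2 FI.
apply: eq_Rintegral => t _; rewrite -RintegralZl//; last exact: integrableS fi.
rewrite [RHS]Rintegral_mkcond; apply: eq_Rintegral => x _.
rewrite lower_triangleE patchE mem_setE in_itv/= andbT.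
by case: ltP => _; rewrite ?mulr1 ?mulr0// mulrC.
Qed.

Lemma integrable_patch (D : set R) (f : R -> R) :
  measurable (D : set (measurableTypeR R)) ->
  leb.-integrable D (EFin \o f) -> leb.-integrable setT (EFin \o (f \_ D)).
Proof. exact: (@integrable_restrict _ (measurableTypeR R)). Qed.

Lemma measurable_prim (c d : R) (g : R -> R) : c <= d ->
  leb.-integrable `[c, d] (EFin \o g) ->
  measurable_fun (`[c, d] : set (measurableTypeR R)) (prim c g).
Proof.
move=> cd gi; apply: subspace_continuous_measurable_fun => //.
exact: (@parameterized_integral_continuous R c d g cd gi).
Qed.

Lemma prim_bound (c d : R) (g : R -> R) (x : R) : x <= d ->
  leb.-integrable `[c, d] (EFin \o g) ->
  `|prim c g x| <= \int[leb]_(t in `[c, d]) `|g t|.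
Proof.
move=> xd gi.
have S : `[c, x] `<=` `[c, d] by apply: subset_itvl; rewrite bnd_simp.
have gi' : leb.-integrable `[c, x] (EFin \o g) by exact: integrableS gi.
apply: le_trans; first exact: le_normr_Rintegral.
rewrite Rintegral_mkcond [leRHS]Rintegral_mkcond.
apply: le_Rintegral => //.
- by apply: integrable_patch => //; exact: integrable_norm.
- by apply: integrable_patch => //; exact: integrable_norm.
move=> t _; rewrite !patchE; case: ifPn => [|_]; last by case: ifP => _; [exact: normr_ge0|exact: lexx].
by rewrite inE => h; rewrite ifT// inE; exact: S.
Qed.

(** Integration by parts, obtained from Fubini on a triangle because g is only
    integrable. *)
Lemma Rintegral_prim (c d : R) (g al : R -> R) : c < d ->
  leb.-integrable `[c, d] (EFin \o g) ->
  test_function `]c, d[ al -> \int[leb]_(x in `]c, d[) al x = 0 ->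
  \int[leb]_(x in `]c, d[) (g x * prim c al x) =
  - \int[leb]_(t in `]c, d[) (al t * prim c g t).
Proof.
move=> cd gi tal al0.
have gi' : leb.-integrable `]c, d[ (EFin \o g).
  by apply: integrableS gi => //; exact: subset_itv_oo_cc.
have ali (A : set R) := @integrable_test R c d al cd tal A.
have Gi : leb.-integrable `]c, d[ (EFin \o (fun t => al t * prim c g t)).
  apply: (@integrable_mulb _ _ _ _ _ _ _ (\int[leb]_(t in `[c, d]) `|g t|)) => //.
  - exact: ali.
  - by apply: measurable_funS (measurable_prim (ltW cd) gi) => //; exact: subset_itv_oo_cc.
  - by move=> x /=; rewrite in_itv/= => /andP[_ /ltW]/prim_bound; apply.
have := @Rintegral_triangle (g \_ `]c, d[) (al \_ `]c, d[)
  (integrable_patch (measurable_itv _) gi')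
  (integrable_patch (measurable_itv _) (ali _ (measurable_itv _))).
set L := (LHS); set L' := (RHS).
have -> : L = \int[leb]_(x in `]c, d[) (g x * prim c al x).
  rewrite [RHS]Rintegral_mkcond; apply: eq_Rintegral => x _; rewrite !patchE.
  case: ifPn => [|_]; last by rewrite mul0r.
  rewrite inE/= in_itv/= => /andP[cx xd]; congr (_ * _).
  rewrite /prim -Rintegral_itv_bndo_bndc ?ali// -Rintegral_itv_obnd_cbnd ?ali//.
  rewrite [LHS]Rintegral_mkcond [RHS]Rintegral_mkcond; apply: eq_Rintegral => t _.
  rewrite !patchE !mem_setE !in_itv/=.
  have [tx|] := ltP t x; last by rewrite andbF.
  by rewrite (lt_trans tx xd).
have -> : L' = \int[leb]_(t in `]c, d[) (al t * (prim c g d - prim c g t)).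
  rewrite [RHS]Rintegral_mkcond; apply: eq_Rintegral => t _; rewrite !patchE.
  case: ifPn => [|_]; last by rewrite mul0r.
  rewrite inE/= in_itv/= => /andP[ct td]; congr (_ * _).
  rewrite /prim Rintegral_itvB ?bnd_simp ?ltW//.
  rewrite -Rintegral_itv_bndo_bndc; last first.
    by apply: integrableS gi => //; apply: subset_itv; rewrite bnd_simp // ltW.
  rewrite [LHS]Rintegral_mkcond [RHS]Rintegral_mkcond; apply: eq_Rintegral => x _.
  rewrite !patchE !mem_setE !in_itv/= andbT.
  have [tx|] := ltP t x; last by [].
  by rewrite (lt_trans ct tx).
move=> ->; under eq_Rintegral do rewrite mulrBr.
rewrite RintegralB//; last first.
  apply: (@integrable_mulb _ _ _ _ _ _ (fun=> prim c g d) `|prim c g d|) => //.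
  exact: ali.
by rewrite RintegralZr ?al0 ?mul0r ?sub0r//; exact: ali.
Qed.

End Triangle.

(** * Functions with an integrable weak derivative on an interval *)

Section WeakDerivative1D.
Context {R : realType}.
Notation leb := (@lebesgue_measure R).

Lemma integrable_bounded_itv (c d M : R) (f : R -> R) :
  measurable_fun (`]c, d[ : set (measurableTypeR R)) f ->
  (forall x, c < x < d -> `|f x| <= M) ->
  leb.-integrable `]c, d[ (EFin \o f).
Proof.
move=> mf fM; apply: measurable_bounded_integrable => //.
  rewrite [ltLHS]lebesgue_measure_itv/=; case: ifP => // _.
  by rewrite -EFinD ltry.
exists M; split; first exact: num_real.
move=> K MK x /=; rewrite in_itv/= => cxd.
by rewrite (le_trans (fM _ cxd))// ltW.
Qed.

Lemma integrable_bump (c d s : R) n : leb.-integrable `]c, d[ (EFin \o bump c s n).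
Proof.
apply: (@integrable_bounded_itv _ _ 1); first exact: measurable_bump.
by move=> x _; rewrite ger0_norm ?bump_ge0// bump_le1.
Qed.

Definition mass (c d s : R) n : R := \int[leb]_(x in `]c, d[) bump c s n x.

(** The masses tend to d - c. *)
Lemma mass_neq0 (c d : R) : c < d -> exists n, mass c d d n != 0.
Proof.
move=> cd.
have i1 : leb.-integrable `]c, d[ (EFin \o (fun=> 1 : R)).
  by apply: (@integrable_bounded_itv _ _ 1) => // x _; rewrite normr1.
have dom n (x : R) : `]c, d[%classic x -> `|bump c d n x| <= 1.
  by move=> _; rewrite ger0_norm ?bump_ge0// bump_le1.
have [_ H] := @Rdominated_cvg _ _ R leb `]c, d[ (bump c d)
  (fun x => \1_`]c, d[ x) (fun=> 1) (measurable_itv _)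
  (fun n => measurable_bump c d n (measurable_itv _))
  (fun x _ => cvg_bump cd) i1 dom.
apply: contrapT => /forallNP N0.
move: H; rewrite (_ : (fun n => _) = fun=> 0); last first.
  by apply/funext => n; apply/eqP; apply: contrapT => /negP; exact: N0.
move=> /(cvg_lim (@Rhausdorff R)); rewrite lim_cst// => /esym.
rewrite (_ : Rintegral _ _ _ = d - c); first by move/eqP; rewrite subr_eq0 gt_eqF.
transitivity (\int[leb]_(x in `]c, d[) (1 : R)).
  by apply: eq_Rintegral => x; rewrite indicE => ->.
by rewrite Rintegral_cst// mul1r [X in fine X]lebesgue_measure_itv/= lte_fin cd.
Qed.

Variables (c d : R).
Hypothesis cd : c < d.

(** A combination of two bumps with integral 0, so that its primitive is a test
    function.  The bump over the whole interval, of level N, is the fixed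
    correction term; q and n range over a countable set. *)
Definition bal_bump (N : nat) (q : rat) (n : nat) (x : R) : R :=
  mass c d d N * bump c (ratr q) n x + - mass c d (ratr q) n * bump c d N x.

Lemma bal_bump_test N q n : c < ratr q < d -> test_function `]c, d[ (bal_bump N q n).
Proof.
move=> /andP[cq qd]; apply: test_lincomb => //; apply: bump_test => //.
by apply: subset_itvl; rewrite bnd_simp ltW.
Qed.

Lemma integral_bal_bump N q n : \int[leb]_(x in `]c, d[) bal_bump N q n x = 0.
Proof.
have Z (k : R) s m : leb.-integrable `]c, d[ (EFin \o (fun x => k * bump c s m x)).
  under [X in _.-integrable _ X]eq_fun do rewrite /= EFinM.
  by apply: integrableZl => //; exact: integrable_bump.
rewrite /bal_bump RintegralD//.
rewrite !RintegralZl//; try exact: integrable_bump.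
by rewrite -!/(mass _ _ _ _) mulNr [X in _ - X]mulrC subrr.
Qed.

Variable N : nat.
Hypothesis massN : mass c d d N != 0.

(** Du Bois-Reymond's lemma.  The difference f of z and the primitive of g is
    orthogonal to all balanced bumps, so f minus a suitable constant is
    orthogonal to all bumps and [ae0_bump] applies. *)
Lemma weak_deriv_primitive (z g : R -> R) :
  leb.-integrable `[c, d] (EFin \o z) -> leb.-integrable `[c, d] (EFin \o g) ->
  (forall q n, c < ratr q < d ->
    \int[leb]_(x in `]c, d[) (z x * bal_bump N q n x) =
    - \int[leb]_(x in `]c, d[) (g x * prim c (bal_bump N q n) x)) ->
  exists C, {ae leb, forall x, x \in `]c, d[ -> z x = C + prim c g x}.
Proof.
move=> zi' gi H.
have zi : leb.-integrable `]c, d[ (EFin \o z).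
  by apply: integrableS zi' => //; exact: subset_itv_oo_cc.
have Gi : leb.-integrable `]c, d[ (EFin \o (prim c g)).
  apply: (@integrable_bounded_itv _ _ (\int[leb]_(t in `[c, d]) `|g t|)).
  - by apply: measurable_funS (measurable_prim (ltW cd) gi) => //; exact: subset_itv_oo_cc.
  - by move=> x /andP[_ /ltW xd]; exact: prim_bound.
pose f x := z x - prim c g x.
have fi : leb.-integrable `]c, d[ (EFin \o f).
  rewrite (_ : EFin \o f = (EFin \o z) \- (EFin \o prim c g))%E//.
  exact: integrableB.
have mb (s : R) m : measurable_fun (`]c, d[ : set (measurableTypeR R)) (bump c s m).
  exact: measurable_bump.
have bb (s x : R) m : `|bump c s m x| <= 1.
  by rewrite ger0_norm ?bump_ge0// bump_le1.
have fbi (s : R) m : leb.-integrable `]c, d[ (EFin \o (fun x => f x * bump c s m x)).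
  by apply: (@integrable_mulb _ _ _ _ _ _ _ 1).
have ti q n : c < ratr q < d -> leb.-integrable `]c, d[ (EFin \o bal_bump N q n).
  by move=> cqd; apply: (integrable_test cd (bal_bump_test N n cqd)).
have H0 q n : c < ratr q < d -> \int[leb]_(x in `]c, d[) (f x * bal_bump N q n x) = 0.
  move=> cqd; under eq_Rintegral do rewrite mulrBl.
  have tb : exists M, forall x : R, `|bal_bump N q n x| <= M.
    exists (`|mass c d d N| + `|mass c d (ratr q) n|) => x.
    rewrite (le_trans (ler_normD _ _))// lerD// normrM ?normrN ler_piMr//.
  have [M tM] := tb.
  have mt : measurable_fun (`]c, d[ : set (measurableTypeR R)) (bal_bump N q n).
    by apply/measurable_EFinP; exact: measurable_int (ti q n cqd).
  rewrite RintegralB//; last 2 first.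
  - exact: (@integrable_mulb _ _ _ _ _ _ _ M).
  - exact: (@integrable_mulb _ _ _ _ _ _ _ M).
  rewrite H// (Rintegral_prim cd gi (bal_bump_test N n cqd) (integral_bal_bump N q n)) opprK.
  by under eq_Rintegral do rewrite mulrC; rewrite subrr.
(* The only constant for which f - C is orthogonal to the fixed bump. *)
pose C := (\int[leb]_(x in `]c, d[) (f x * bump c d N x)) / mass c d d N.
exists C.
have fCi : leb.-integrable `]c, d[ (EFin \o (fun x => f x - C)).
  rewrite (_ : EFin \o _ = (EFin \o f) \- (EFin \o cst C))%E//.
  by apply: integrableB => //; apply: (@integrable_bounded_itv _ _ `|C|).
have Ci k s m : leb.-integrable `]c, d[ (EFin \o (fun x => k * bump c s m x)).
  under [X in _.-integrable _ X]eq_fun do rewrite /= EFinM.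
  by apply: integrableZl => //; exact: integrable_bump.
have K (q : rat) n : c < ratr q < d ->
    \int[leb]_(x in `]c, d[) ((f x - C) * bump c (ratr q) n x) = 0.
  move=> cqd; under eq_Rintegral do rewrite mulrBl.
  rewrite RintegralB// RintegralZl//; last exact: integrable_bump.
  rewrite -/(mass c d (ratr q) n); have := H0 q n cqd; rewrite /bal_bump.
  under eq_Rintegral do rewrite mulrDr ![f _ * (_ * _)]mulrCA.
  rewrite RintegralD//; last 2 first.
  - under [X in _.-integrable _ X]eq_fun do rewrite /= EFinM.
    by apply: integrableZl => //; exact: fbi.
  - under [X in _.-integrable _ X]eq_fun do rewrite /= EFinM.
    by apply: integrableZl => //; exact: fbi.
  rewrite !RintegralZl// /C => E; apply: (mulfI massN).
  by rewrite mulr0 mulrBr -[RHS]E; field.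
have := @ae0_bump R c d (fun x => f x - C) cd fCi K.
apply: (@filterS _ _ (ae_filter_ringOfSetsType leb)) => x /[apply].
by move/eqP; rewrite subr_eq0 /f subr_eq => /eqP.
Qed.

End WeakDerivative1D.

(** * Kummer's series *)

Section EntireSeries.
Context {R : realType}.

(** Coefficients dominated by those of a multiple of exp(M x); this class is stable
    under differentiation of the series and has infinite radius of convergence. *)
Definition exp_bounded (c : R^nat) : Prop :=
  exists C M : R, [/\ 0 <= C, 0 <= M & forall k, `|c k| <= C * (M ^+ k / k`!%:R)].

Lemma exp_bounded_cvg c K : exp_bounded c -> cvgn (pseries c K).
Proof.
move=> [C [M [C0 M0 cM]]]; apply: normed_cvg.
apply: (@series_le_cvg _ _ (fun k => C * exp_coeff (M * `|K|) k)) => [k|k|k|].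
- exact: normr_ge0.
- by rewrite /= /exp_coeff/= mulr_ge0// divr_ge0// exprn_ge0// mulr_ge0.
- rewrite /= normrM normrX /exp_coeff/= exprMn.
  rewrite [leRHS](_ : _ = C * (M ^+ k / k`!%:R) * `|K| ^+ k); last by ring.
  by rewrite ler_wpM2r// exprn_ge0.
- rewrite (_ : series _ = (fun n => C * series (exp_coeff (M * `|K|)) n)).
    by apply: is_cvgMr; exact: is_cvg_series_exp_coeff.
  by apply/funext => n; rewrite /series/= mulr_sumr.
Qed.

Lemma exp_bounded_diffs c : exp_bounded c -> exp_bounded (pseries_diffs c).
Proof.
move=> [C [M [C0 M0 cM]]]; exists (C * M), M; split=> //; first exact: mulr_ge0.
move=> k; rewrite /pseries_diffs normrM ger0_norm//.
apply: le_trans (ler_wpM2l _ (cM k.+1)) _ => //.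
rewrite factS natrM exprS le_eqVlt; apply/orP; left; apply/eqP.
have k0 : 1 + k%:R != 0 :> R by rewrite nat1r pnatr_eq0.
have f0 : k`!%:R != 0 :> R by rewrite pnatr_eq0 -lt0n fact_gt0.
by field; rewrite f0 k0.
Qed.

Lemma is_derive_pseries c (x : R) : exp_bounded c ->
  is_derive x (1 : R) (fun x => limn (pseries c x)) (limn (pseries (pseries_diffs c) x)).
Proof.
move=> cb; apply: (@pseries_snd_diffs _ _ (`|x| + 1)).
- exact: exp_bounded_cvg.
- by apply: exp_bounded_cvg; exact: exp_bounded_diffs.
- by apply: exp_bounded_cvg; do 2 apply: exp_bounded_diffs.
- by rewrite [ltRHS]ger0_norm ?ltrDl// addr_ge0.
Qed.

End EntireSeries.

Section Kummer.
Context {R : realType}.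

(** Coefficients of Kummer's function M(- l / 2, 1 / 2, s / 2), as a power series
    in s; substituting s = x^2 gives the even solution of
    h'' - x h' + l h = 0 with h(0) = 1. *)
Fixpoint kummer_coef (l : R) (k : nat) : R :=
  if k is j.+1 then kummer_coef l j * ((j.*2%:R - l) / (j.*2.+1%:R * j.*2.+2%:R)) else 1.

Lemma kratio (j : nat) (y B : R) : `|y| <= j.*2.+1%:R * B ->
  `|y / (j.*2.+1%:R * j.*2.+2%:R)| <= B / 2 / j.+1%:R.
Proof.
move=> h; have j1 : 0 < j.*2.+1%:R :> R by rewrite ltr0n.
have j2 : j.*2.+2%:R = 2 * j.+1%:R :> R by rewrite -natrM mul2n doubleS.
have j3 : 0 < j.+1%:R :> R by rewrite ltr0n.
rewrite normrM [X in _ * X]ger0_norm; last by rewrite invr_ge0 mulr_ge0.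
rewrite ler_pdivrMr ?mulr_gt0// ?ltr0n// j2.
apply: le_trans h _; rewrite le_eqVlt; apply/orP; left; apply/eqP.
move: (j.*2.+1%:R) (j.+1%:R) j1 j3 => u v u0 v0.
by field; rewrite !gt_eqF.
Qed.

Lemma kratio_num (j : nat) (l L : R) : 0 <= l <= L ->
  `|j.*2%:R - l| <= j.*2.+1%:R * (1 + L).
Proof.
move=> /andP[l0 lL]; have j1 : 0 <= j.*2%:R :> R by [].
by rewrite -natr1 ler_norml; apply/andP; split; nra.
Qed.

Lemma kummer_coef_bound (l L : R) k : 0 <= l <= L ->
  `|kummer_coef l k| <= (1 + L) ^+ k / k`!%:R.
Proof.
move=> lL; have L0 : 0 <= L by move/andP: lL => [l0]; exact: le_trans.
elim: k => [|k IH]; first by rewrite /= normr1 expr0 fact0 divr1.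
rewrite /= normrM.
have := ler_pM (normr_ge0 _) (normr_ge0 _) IH (kratio (kratio_num k lL)).
move=> /le_trans; apply.
rewrite factS natrM exprS.
have k0 : 0 < k.+1%:R :> R by rewrite ltr0n.
have f0 : 0 < k`!%:R :> R by rewrite ltr0n fact_gt0.
rewrite -subr_ge0 (_ : _ - _ = (1 + L) * (1 + L) ^+ k / (2 * k.+1%:R * k`!%:R)).
  by rewrite divr_ge0 ?mulr_ge0 ?exprn_ge0//; lra.
by move: (k.+1%:R) k0 => u u0; field; rewrite !gt_eqF.
Qed.

(** Makes the solution depend on l in a Lipschitz way, uniformly on bounded
    sets. *)
Lemma kummer_coef_lip (l l' L : R) k : 0 <= l <= L -> 0 <= l' <= L ->
  `|kummer_coef l k - kummer_coef l' k| <= `|l - l'| * ((2 * (1 + L)) ^+ k / k`!%:R).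
Proof.
move=> lL lL'; have L0 : 0 <= L by move/andP: lL => [l0]; exact: le_trans.
elim: k => [|k IH]; first by rewrite /= subrr normr0 mulr_ge0// divr_ge0.
rewrite /=; set c := kummer_coef l k in IH *; set c' := kummer_coef l' k in IH *.
set D := k.*2.+1%:R * k.*2.+2%:R.
rewrite (_ : _ - _ = (c - c') * ((k.*2%:R - l) / D) + c' * ((l' - l) / D)); last by ring.
rewrite (le_trans (ler_normD _ _))// normrM [X in _ + X]normrM.
have h1 := ler_pM (normr_ge0 _) (normr_ge0 _) IH (kratio (kratio_num k lL)).
have h2' : `|l' - l| <= k.*2.+1%:R * `|l - l'|.
  by rewrite distrC ler_peMl// ler1n.
have h2 := ler_pM (normr_ge0 _) (normr_ge0 _) (kummer_coef_bound k lL') (kratio h2').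
apply: le_trans (lerD h1 h2) _.
have k0 : 0 < k.+1%:R :> R by rewrite ltr0n.
have f0 : 0 < k`!%:R :> R by rewrite ltr0n fact_gt0.
rewrite factS natrM exprS.
set M := 1 + L; set dl := `|l - l'|.
have M1 : 1 <= M by rewrite /M; lra.
have MM : M ^+ k <= (2 * M) ^+ k by rewrite lerXn2r ?nnegrE//; lra.
have M2 : 0 <= M ^+ k by rewrite exprn_ge0//; lra.
rewrite -subr_ge0 (_ : _ - _ = dl / (k.+1%:R * k`!%:R) *
   (2 * M * (2 * M) ^+ k - ((2 * M) ^+ k * M / 2 + M ^+ k / 2))); last first.
  by move: (k.+1%:R) k0 => u u0; field; rewrite !gt_eqF.
apply: mulr_ge0; first by apply: divr_ge0; [exact: normr_ge0|apply: mulr_ge0; exact: ltW].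
by nra.
Qed.

Lemma kummer_coef_rec (l : R) k :
  (2 * k%:R + 1) * (2 * k%:R + 2) * kummer_coef l k.+1 = (2 * k%:R - l) * kummer_coef l k.
Proof.
rewrite /=; have e0 : k.*2%:R = 2 * k%:R :> R by rewrite -natrM mul2n.
have e1 : k.*2.+1%:R = 2 * k%:R + 1 :> R by rewrite -natr1 e0.
have e2 : k.*2.+2%:R = 2 * k%:R + 2 :> R by rewrite -addn2 natrD e0.
rewrite e0 e1 e2; have : 0 <= k%:R :> R by [].
by move: (k%:R) => x x0; field; apply/andP; split; rewrite gt_eqF//; lra.
Qed.

Lemma kummer_coef_exp_bounded l : 0 <= l -> exp_bounded (kummer_coef l).
Proof.
move=> l0; exists 1, (1 + l); split=> //; first by lra.
by move=> k; rewrite mul1r; apply: kummer_coef_bound; rewrite l0 lexx.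
Qed.

Definition kummer l (s : R) := limn (pseries (kummer_coef l) s).
Definition kummer1 l (s : R) := limn (pseries (pseries_diffs (kummer_coef l)) s).
Definition kummer2 l (s : R) :=
  limn (pseries (pseries_diffs (pseries_diffs (kummer_coef l))) s).

(** By the recursion the partial sums satisfy the equation exactly, once some of
    them are shifted by one. *)
Lemma kummer_ode l s : 0 <= l ->
  4 * s * kummer2 l s + (2 - 2 * s) * kummer1 l s + l * kummer l s = 0.
Proof.
move=> l0; have b0 := kummer_coef_exp_bounded l0.
have b1 := exp_bounded_diffs b0; have b2 := exp_bounded_diffs b1.
pose S0 := pseries (kummer_coef l) s; pose S1 := pseries (pseries_diffs (kummer_coef l)) s.
pose S2 := pseries (pseries_diffs (pseries_diffs (kummer_coef l))) s.
have c0 : S0 n @[n --> \oo] --> kummer l s by have := @exp_bounded_cvg _ _ s b0.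
have c1 : S1 n @[n --> \oo] --> kummer1 l s by have := @exp_bounded_cvg _ _ s b1.
have c2 : S2 n @[n --> \oo] --> kummer2 l s by have := @exp_bounded_cvg _ _ s b2.
have c0S : S0 n.+1 @[n --> \oo] --> kummer l s by move: c0; rewrite -cvg_shiftS.
have c1S : S1 n.+1 @[n --> \oo] --> kummer1 l s by move: c1; rewrite -cvg_shiftS.
(* The sums with a factor s stop one step earlier, so that every term stops at
   the same power of s. *)
have E n : 4 * s * S2 n + 2 * S1 n.+1 - 2 * s * S1 n + l * S0 n.+1 = 0.
  have r (c : R^nat) m : pseries c s m.+1 = pseries c s m + c m * s ^+ m.
    by rewrite /pseries /series /= big_nat_recr.
  have z (c : R^nat) : pseries c s 0 = 0.
    by rewrite /pseries /series /= big_geq.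
  elim: n => [|n IH].
    rewrite /S0 /S1 /S2 !r !z /pseries_diffs /= expr0.
    by rewrite double0; field.
  move: IH; rewrite /S0 /S1 /S2 ![pseries _ s n.+2]r [pseries (pseries_diffs (pseries_diffs _)) s n.+1]r.
  rewrite [pseries (pseries_diffs _) s n.+1 in X in _ -> _ - X + _ = _]r.
  move: (pseries (pseries_diffs (pseries_diffs (kummer_coef l))) s n)
    (pseries (pseries_diffs (kummer_coef l)) s n) (pseries (pseries_diffs (kummer_coef l)) s n.+1)
    (pseries (kummer_coef l) s n.+1) => x2 x1 x1' x0 IH.
  have rec := kummer_coef_rec l n.+1; rewrite /pseries_diffs.
  have e2 : n.+2%:R = n%:R + 2 :> R by rewrite -addn2 natrD.
  have e1 : n.+1%:R = n%:R + 1 :> R by rewrite natr1.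
  move: rec; rewrite e1 e2 => rec; rewrite -[RHS]IH exprS.
  move: (kummer_coef l n.+2) (kummer_coef l n.+1) rec => d2 d1 rec.
  apply/eqP; rewrite -subr_eq0; apply/eqP.
  rewrite [LHS](_ : _ = s * s ^+ n * ((2 * (n%:R + 1) + 1) * (2 * (n%:R + 1) + 2) * d2
    - (2 * (n%:R + 1) - l) * d1)); first by rewrite rec subrr mulr0.
  by ring.
have : 4 * s * S2 n + 2 * S1 n.+1 - 2 * s * S1 n + l * S0 n.+1 @[n --> \oo] -->
  4 * s * kummer2 l s + 2 * kummer1 l s - 2 * s * kummer1 l s + l * kummer l s.
  apply: cvgD; last by apply: cvgM => //; exact: cvg_cst.
  apply: cvgB; last by apply: cvgM => //; exact: cvg_cst.
  by apply: cvgD; apply: cvgM => //; exact: cvg_cst.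
under eq_fun do rewrite E.
move=> /(cvg_lim (@Rhausdorff R)); rewrite lim_cst// => ->; ring.
Qed.

End Kummer.

(** * The first Dirichlet eigenvalue of Hermite's equation *)

Section DirichletGroundState.
Context {R : realType}.

(** The even solution of Hermite's equation h'' - x h' + l h = 0; [herm1 l] is
    its derivative. *)
Definition herm (l x : R) : R := kummer l (x ^+ 2).
Definition herm1 (l x : R) : R := 2 * x * kummer1 l (x ^+ 2).

Lemma is_derive_sqr (x : R) : is_derive x (1 : R) (fun y => y ^+ 2) (2 * x).
Proof.
have -> : (fun y : R => y ^+ 2) = id ^+ 2 by apply/funext => y; rewrite fctE.
by apply: is_derive_eq; rewrite [_%:A]mulr1 expr1.
Qed.

Lemma is_derive_herm (l x : R) : 0 <= l -> is_derive x (1 : R) (herm l) (herm1 l x).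
Proof.
move=> l0; have H := is_derive_pseries (x ^+ 2) (kummer_coef_exp_bounded l0).
have := @is_derive1_comp R _ (fun y => y ^+ 2) x _ _ H (is_derive_sqr x).
by rewrite /herm1 mulrC.
Qed.

Lemma is_derive_herm1 (l x : R) : 0 <= l ->
  is_derive x (1 : R) (herm1 l) (x * herm1 l x - l * herm l x).
Proof.
move=> l0.
have H := is_derive_pseries (x ^+ 2) (exp_bounded_diffs (kummer_coef_exp_bounded l0)).
have H1 := @is_derive1_comp R _ (fun y => y ^+ 2) x _ _ H (is_derive_sqr x).
have H2 : is_derive x (1 : R) (fun y : R => 2 * y) 2.
  by apply: is_derive_eq; rewrite [_%:A]mulr1.
have := is_deriveM H2 H1.
rewrite -[X in is_derive _ _ X]/(herm1 l) => H3.
apply: (is_derive_eq H3); rewrite /GRing.scale/= -/(kummer1 l _) -/(kummer2 l _).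
have := kummer_ode (x ^+ 2) l0; rewrite /herm1 /herm.
move: (kummer2 _ _) (kummer1 _ _) (kummer _ _) => k2 k1 k0 E.
by apply/eqP; rewrite -subr_eq0 -[X in _ == X]E; apply/eqP; ring.
Qed.

Lemma kummer0 (l : R) : kummer l 0 = 1.
Proof.
rewrite /kummer; apply: cvg_lim => //.
rewrite -cvg_shiftS (_ : (fun n => _) = fun=> 1); first exact: cvg_cst.
apply/funext => n; rewrite /pseries /series/= big_nat_recl//= big1 ?addr0 ?expr0 ?mulr1//.
by move=> i _; rewrite expr0n mulr0.
Qed.

Lemma kummer_l0 (s : R) : kummer 0 s = 1.
Proof.
have k0 j : kummer_coef 0 j.+1 = 0 :> R.
  by elim: j => [|j IH]; [rewrite /= double0 subr0 mul0r mulr0|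
    rewrite -[j.+2]/(j.+1.+1) [LHS]/= -/(kummer_coef 0 j.+1) IH mul0r].
rewrite /kummer; apply: cvg_lim => //.
rewrite -cvg_shiftS (_ : (fun n => _) = fun=> 1); first exact: cvg_cst.
apply/funext => n; rewrite /pseries /series/= big_nat_recl//= big1 ?addr0 ?expr0 ?mulr1//.
by move=> i _; rewrite -/(kummer_coef 0 i.+1) k0 mul0r.
Qed.

Lemma kummer_lip (l l' L s : R) : 0 <= l <= L -> 0 <= l' <= L -> 0 <= s ->
  `|kummer l s - kummer l' s| <= `|l - l'| * expR (2 * (1 + L) * s).
Proof.
move=> hl hl' s0.
have l0 : 0 <= l by case/andP: hl.
have l0' : 0 <= l' by case/andP: hl'.
have c1 := @exp_bounded_cvg _ _ s (kummer_coef_exp_bounded l0).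
have c2 := @exp_bounded_cvg _ _ s (kummer_coef_exp_bounded l0').
have -> : kummer l s - kummer l' s =
    limn (fun n => pseries (kummer_coef l) s n - pseries (kummer_coef l') s n).
  by apply/esym/cvg_lim => //; exact: cvgB.
rewrite -lim_norm; last exact: is_cvgB.
apply: limr_le; first by apply: is_cvg_norm; exact: is_cvgB.
apply: nearW => n.
rewrite /pseries /series/= -sumrB (le_trans (ler_norm_sum _ _ _))//.
apply: le_trans (_ : `|l - l'| * series (exp_coeff (2 * (1 + L) * s)) n <= _).
  rewrite /series/= mulr_sumr; apply: ler_sum => i _.
  rewrite -mulrBl normrM (ger0_norm (exprn_ge0 _ s0)).
  rewrite /exp_coeff/= exprMn mulrAC mulrA.
  by rewrite ler_wpM2r ?exprn_ge0// kummer_coef_lip.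
rewrite ler_wpM2l//; apply: nondecreasing_cvgn_le; last exact: is_cvg_series_exp_coeff.
apply/nondecreasing_seqP => k; rewrite /series/= big_nat_recr//= lerDl.
rewrite /exp_coeff/= divr_ge0// exprn_ge0// !mulr_ge0//.
by move/andP: hl => [h1 h2]; lra.
Qed.

Lemma herm_lip (l l' L a x : R) : 0 <= l <= L -> 0 <= l' <= L -> `|x| <= a ->
  `|herm l x - herm l' x| <= `|l - l'| * expR (2 * (1 + L) * a ^+ 2).
Proof.
move=> hl hl' xa; apply: le_trans (kummer_lip hl hl' (sqr_ge0 x)) _.
rewrite ler_wpM2l// ler_expR ler_wpM2l//.
  by move/andP: hl => [h1 h2]; lra.
by rewrite -[leLHS]real_normK ?num_real// lerXn2r ?nnegrE// (le_trans _ xa).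
Qed.

Lemma continuous_is_derive (f df : R -> R) :
  (forall x, is_derive x (1 : R) f (df x)) -> continuous f.
Proof.
move=> H x; apply: differentiable_continuous; apply/derivable1_diffP.
by case: (H x).
Qed.

Definition gauss (x : R) : R := expR (- (x ^+ 2 / 2)).

Lemma is_derive_gauss (x : R) : is_derive x (1 : R) gauss (- x * gauss x).
Proof.
have H : is_derive x (1 : R) (fun y : R => - (y ^+ 2 / 2)) (- x).
  have := is_derive_sqr x => H.
  apply: is_derive_eq; rewrite /GRing.scale/=; by field.
have := @is_derive1_comp R expR (fun y => - (y ^+ 2 / 2)) x _ _ (is_derive_expR _) H.
by rewrite mulrC.
Qed.

(** If the solution were positive, compare it with phi = (a^2 - x^2)^2 through the
    weighted Wronskian B = exp(-x^2/2)(h' phi - h phi'), which is 0 at both ends: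
    by Rolle its derivative vanishes somewhere in ]0, a[, but for l = 5 / a^2 and
    h > 0 it is negative there. *)
Lemma herm_not_pos (a l : R) : 0 < a -> l = 5 / a ^+ 2 ->
  ~ (forall x, 0 <= x <= a -> 0 < herm l x).
Proof.
move=> a0 lE H.
have l0 : 0 <= l by rewrite lE divr_ge0// sqr_ge0.
pose phi (x : R) := (a ^+ 2 - x ^+ 2) ^+ 2.
pose phi1 (x : R) := - 4 * x * (a ^+ 2 - x ^+ 2).
pose B x := gauss x * (herm1 l x * phi x - herm l x * phi1 x).
pose D x := - gauss x * herm l x *
  (l * phi x + (12 * x ^+ 2 - 4 * a ^+ 2) - x * phi1 x).
have HB (x : R) : is_derive x (1 : R) B (D x).
  have Hg := is_derive_gauss x; have Hh := is_derive_herm x l0.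
  have Hh1 := is_derive_herm1 x l0; have Hs := is_derive_sqr x.
  have Ht : is_derive x (1 : R) (fun y => a ^+ 2 - y ^+ 2) (- (2 * x)).
    by apply: is_derive_eq; rewrite /GRing.scale/=; ring.
  have Hp : is_derive x (1 : R) phi (phi1 x).
    have := @is_derive1_comp R _ (fun y => a ^+ 2 - y ^+ 2) x _ _
      (is_derive_sqr (a ^+ 2 - x ^+ 2)) Ht.
    by move=> K; apply: (is_derive_eq K); rewrite /phi1; ring.
  have Hp1 : is_derive x (1 : R) phi1 (12 * x ^+ 2 - 4 * a ^+ 2).
    by rewrite /phi1; apply: is_derive_eq; rewrite /GRing.scale/=; ring.
  rewrite /B; apply: is_derive_eq; rewrite /GRing.scale/= /D.
  by ring.
have cB := continuous_is_derive HB.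
have [||x xa [_ D0]] := @Rolle R B 0 a a0 (fun x _ => ltac:(by case: (HB x))).
- by apply: continuous_subspaceT.
- by rewrite /B /herm1 /phi1 /phi; ring.
move: D0; case: (HB x) => _ ->.
move: xa; rewrite in_itv/= => /andP[x0 xa].
suff : 0 < - D x by move=> + E; rewrite E oppr0 ltxx.
rewrite /D -mulNr -mulNr opprK mulr_gt0//.
  by rewrite mulr_gt0 ?expR_gt0// H// !ltW.
rewrite /phi /phi1 lE; set t := a ^+ 2 - x ^+ 2.
have t0 : 0 < t by rewrite /t subr_gt0 ltrXn2r// ?nnegrE ltW.
have a2 : 0 < a ^+ 2 by rewrite exprn_gt0.
rewrite (_ : _ - _ = (5 * t ^+ 2 - 12 * t * a ^+ 2 + 8 * a ^+ 2 * a ^+ 2) / a ^+ 2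
   + 4 * x ^+ 2 * t); last by rewrite /t; field; rewrite gt_eqF.
have x2 : 0 <= x ^+ 2 by exact: sqr_ge0.
rewrite ltr_wpDr//; first by rewrite !mulr_ge0// ltW.
rewrite divr_gt0//.
(* Completing the square shows that the constant 5 is large enough. *)
rewrite (_ : _ + _ = 5 * (t - 6 / 5 * a ^+ 2) ^+ 2 + 4 / 5 * (a ^+ 2 * a ^+ 2)); last by field.
apply: ltr_wpDl; first by rewrite mulr_ge0 ?sqr_ge0.
by rewrite mulr_gt0 ?mulr_gt0//; lra.
Qed.

(** Uniqueness for the initial value problem at a zero: h^2 + h'^2 times
    exp((1 + l) x) is nondecreasing on [0, +oo[, and it is at least 1 at 0. *)
Lemma herm_double_zero (l x : R) : 0 <= l -> 0 <= x ->
  herm l x = 0 -> herm1 l x = 0 -> False.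
Proof.
move=> l0 x0 hx h1x.
pose F y := (herm l y * herm l y + herm1 l y * herm1 l y) * expR ((1 + l) * y).
pose D y := expR ((1 + l) * y) * ((1 + l) * (herm l y * herm l y + herm1 l y * herm1 l y) +
   2 * herm l y * herm1 l y + 2 * herm1 l y * (y * herm1 l y - l * herm l y)).
have HF (y : R) : is_derive y (1 : R) F (D y).
  have Hh := is_derive_herm y l0; have Hh1 := is_derive_herm1 y l0.
  have Ht : is_derive y (1 : R) (fun y => (1 + l) * y) (1 + l).
    by apply: is_derive_eq; rewrite [_%:A]mulr1.
  have He := @is_derive1_comp R expR (fun y => (1 + l) * y) y _ _ (is_derive_expR _) Ht.
  rewrite /F; apply: (is_derive_eq (is_deriveM _ He)); rewrite /GRing.scale/= /D.
  by ring.
have cF := continuous_is_derive HF.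
have : F 0 <= F x.
  apply: (@ger0_derive1_ndecr R F 0 x) => //.
  - move=> y; rewrite in_itv/= => /andP[y0 _]; rewrite derive1E.
    case: (HF y) => _ ->; rewrite /D mulr_ge0 ?expR_ge0//.
    move: (herm l y) (herm1 l y) => u v.
    (* The derivative is nonnegative as a sum of squares. *)
    rewrite (_ : _ + _ = l * (u - v) ^+ 2 + (u + v) ^+ 2 + 2 * y * v ^+ 2); last by ring.
    apply: addr_ge0; last by rewrite mulr_ge0 ?sqr_ge0// mulr_ge0// ltW.
    by apply: addr_ge0; [exact: mulr_ge0 l0 (sqr_ge0 _)|exact: sqr_ge0].
  - by apply: continuous_subspaceT => z; exact: cF.
rewrite /F hx h1x /herm expr0n/= kummer0 !mul0r addr0 mul0r mulr0 expR0 mulr1.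
have : 0 <= herm1 l 0 * herm1 l 0 by rewrite -expr2 sqr_ge0.
by lra.
Qed.

(** Take the supremum l of the parameters in [0, 5 / a^2] for which the solution is
    nonnegative on [0, a].  By Lipschitz dependence the solution for l is still
    nonnegative, and it is not positive, else l could be increased; so its minimum
    is 0.  A zero inside ]0, a[ would be a minimum, hence a double zero, which is
    excluded. *)
Lemma exists_dirichlet_eigenvalue (a : R) : 0 < a ->
  exists l, [/\ 0 <= l, herm l a = 0 & forall x, 0 <= x < a -> 0 < herm l x].
Proof.
move=> a0; pose L : R := 5 / a ^+ 2.
have L0 : 0 < L by rewrite divr_gt0// exprn_gt0.
(* Nonnegativity, unlike positivity, passes to the supremum. *)
pose A := [set l : R | 0 <= l <= L /\ forall x, 0 <= x <= a -> 0 <= herm l x].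
pose K := expR (2 * (1 + L) * a ^+ 2); have K0 : 0 < K by exact: expR_gt0.
have A0 : A 0 by split; [rewrite lexx ltW|move=> x _; rewrite /herm kummer_l0].
have supA : has_sup A by split; [exists 0|exists L => l [/andP[]]].
pose l := sup A.
have l0L : 0 <= l <= L.
  apply/andP; split; first exact: (sup_upper_bound supA A0).
  by apply: sup_le_ub; [exists 0|move=> y [/andP[]]].
have [l0 lL] := andP l0L.
have lip (l' x : R) : 0 <= l' <= L -> 0 <= x <= a -> `|herm l x - herm l' x| <= `|l - l'| * K.
  move=> hl' /andP[x0 xa]; apply: herm_lip => //; by rewrite ger0_norm.
have hge (x : R) : 0 <= x <= a -> 0 <= herm l x.
  move=> xa; rewrite leNgt; apply/negP => hneg.
  (* If the solution for l were negative at x, then so would be that for a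
     parameter close to l in the set A. *)
  have e0 : 0 < - herm l x / K by rewrite divr_gt0// oppr_gt0.
  have [l' Al' ll'] := sup_adherent e0 supA.
  have l'l : l' <= l by exact: (sup_upper_bound supA Al').
  have := lip l' x Al'.1 xa; rewrite (ger0_norm (_ : 0 <= l - l')); last by rewrite subr_ge0.
  have : (l - l') * K < - herm l x by rewrite -ltr_pdivlMr//; move: ll'; rewrite -/l; lra.
  have := Al'.2 x xa.
  by rewrite ler_norml => h1 h2 /andP[h3 h4]; lra.
have ch : {within `[0, a], continuous (herm l)}.
  by apply: continuous_subspaceT; exact: continuous_is_derive (fun x => is_derive_herm x l0).
have [x0 x0a hx0] := EVT_min (ltW a0) ch.
have hx00 : herm l x0 = 0.
  apply/eqP; apply: contraT => hn0.
  have m0 : 0 < herm l x0 by rewrite lt_neqAle eq_sym hn0 hge// -in_itv.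
  have hpos (x : R) : 0 <= x <= a -> herm l x0 <= herm l x by move=> xa; apply: hx0; rewrite in_itv.
  have lneL : l < L.
    rewrite lt_neqAle lL andbT; apply/eqP => lE.
    by apply: (herm_not_pos a0 lE) => x xa; exact: lt_le_trans (hpos _ xa).
  (* A larger parameter in A, contradicting the choice of l. *)
  pose l' := Num.min L (l + herm l x0 / K).
  have ll' : l < l' by rewrite lt_min lneL ltrDl divr_gt0.
  have l'0L : 0 <= l' <= L by rewrite (le_trans l0 (ltW ll'))/= ge_min lexx.
  have Al' : A l'.
    split=> // x xa; have := lip l' x l'0L xa.
    have : (l' - l) * K <= herm l x0.
      by rewrite -ler_pdivlMr// lerBlDl ge_min lexx orbT.
    rewrite (distrC l l') (ger0_norm (_ : 0 <= l' - l)) ?subr_ge0 ?(ltW ll')//.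
    have := hpos x xa.
    by rewrite ler_norml => h1 h2 /andP[h3 h4]; lra.
  by have := sup_upper_bound supA Al'; rewrite leNgt ll'.
have x00 : x0 != 0.
  by apply/eqP => x0E; move: hx00; rewrite x0E /herm expr0n/= kummer0 => /eqP; rewrite oner_eq0.
move: (x0a); rewrite in_itv/= => /andP[x0ge x0le].
have x0gt : 0 < x0 by rewrite lt_neqAle eq_sym x00.
have nozero (x : R) : 0 < x < a -> herm l x != 0.
  move=> /andP[xgt xlt]; apply/eqP => hx.
  apply: (herm_double_zero l0 (ltW xgt) hx).
  have [_ <-] := is_derive_herm x l0.
  have dh t : t \in `]0, a[ -> derivable (herm l) t 1.
    by move=> _; case: (is_derive_herm t l0).
  have [|t|_ //] := @derive1_at_min R (herm l) 0 a x (ltW a0) dh.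
    by rewrite in_itv/= xgt.
  by rewrite in_itv/= => /andP[t0 ta]; rewrite hx hge// !ltW.
have x0E : x0 = a.
  apply/eqP; rewrite eq_le x0le leNgt/=; apply/negP => x0lt.
  by have := nozero x0; rewrite x0gt x0lt hx00 eqxx => /(_ isT).
exists l; split=> //; first by rewrite -x0E.
move=> x /andP[xge xlt].
have [->|xn0] := eqVneq x 0; first by rewrite /herm expr0n/= kummer0.
rewrite lt_neqAle eq_sym nozero//= ?hge ?xge ?ltW// xlt andbT.
by rewrite lt_neqAle eq_sym xn0.
Qed.

End DirichletGroundState.

(** * The ground state *)

Section GroundState.
Context {R : realType}.
Notation leb := (@lebesgue_measure R).

Definition w : R -> R := normal_pdf 0 1.

Lemma wE x : w x = normal_peak 1 * gauss x.
Proof.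
by rewrite /w normal_pdfE ?oner_eq0// /normal_fun subr0 expr1n /gauss mulNr.
Qed.

Lemma w_gt0 x : 0 < w x.
Proof. by rewrite wE mulr_gt0 ?expR_gt0 ?normal_peak_gt0 ?oner_eq0. Qed.

Lemma w_ge0 x : 0 <= w x. Proof. exact: ltW (w_gt0 x). Qed.

Lemma wN x : w (- x) = w x. Proof. by rewrite !wE /gauss sqrrN. Qed.

Lemma is_derive_w (x : R) : is_derive x (1 : R) w (- x * w x).
Proof.
have -> : w = fun x => normal_peak 1 * gauss x by apply/funext => y; exact: wE.
have := is_derive_gauss x => H.
by apply: is_derive_eq; rewrite /GRing.scale/=; ring.
Qed.

Lemma continuous_w : continuous w.
Proof. exact: continuous_is_derive is_derive_w. Qed.

Lemma measurable_w (D : set (measurableTypeR R)) : measurable_fun D w.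
Proof. by apply: measurable_funTS; exact: measurable_normal_pdf. Qed.

(** The density is bounded below on bounded sets, so that local integrability is
    the same for gamma1 and for Lebesgue measure. *)
Lemma w_lower (q x : R) : `|x| <= q -> w q <= w x.
Proof.
move=> xq; rewrite !wE ler_wpM2l ?normal_peak_ge0// ler_expR lerN2 ler_wpM2r//.
by rewrite -[leLHS]real_normK ?num_real// lerXn2r ?nnegrE// (le_trans _ xq).
Qed.

(** The set ]s, a[, for a possibly infinite a. *)
Definition right_tail (a : \bar R) (s : R) : set R := [set x | s < x /\ (x%:E < a)%E].

(** The first Neumann eigenfunction v, in integrated form.  The field [gs_tail] is
    (w h)' = - mu v w together with w h -> 0 at a; stating it as a tail integral
    treats finite and infinite a alike and is what the Tonelli argument of
    [hardy_ineq] consumes.  For finite a, h and v extend to the whole line, while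
    positivity and boundedness hold on the interval. *)
Record ground_state (a : \bar R) (mu : R) (h v : R -> R) : Prop := GroundState {
  gs_mu : 0 < mu;
  gs_der : forall x, is_derive x (1 : R) v (h x);
  gs_cont : continuous h;
  gs_odd : forall x, v (- x) = - v x;
  gs_even : forall x, h (- x) = h x;
  gs_pos : forall x, oitv (- a) a x -> 0 < h x;
  gs_bdd : exists M, forall x, oitv (- a) a x -> h x <= M;
  gs_tail : forall s, 0 <= s -> (s%:E < a)%E ->
    (\int[leb]_(x in right_tail a s) (v x * w x)%:E = (w s * h s / mu)%:E)%E }.

Lemma cvg_w_infty : w x @[x --> +oo] --> 0.
Proof.
apply: (@squeeze_cvgr _ _ _ _ (fun=> 0) (fun x => normal_peak 1 * expR (- x))).
- near=> x; rewrite w_ge0/= wE ler_wpM2l ?normal_peak_ge0// ler_expR lerN2.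
  have : 2 <= x by near: x; exact: nbhs_pinfty_ge.
  by nra.
- exact: cvg_cst.
- rewrite -[X in _ --> X](mulr0 (normal_peak 1)); apply: cvgM; first exact: cvg_cst.
  exact: cvgr_expR.
Unshelve. all: by end_near. Qed.

Lemma ground_state_infty : ground_state +oo%E 1 (fun=> 1) id.
Proof.
split=> //.
- by move=> x; exact: is_derive_id.
- by move=> x; exact: cvg_cst.
- by exists 1.
- move=> s s0 _.
  have -> : right_tail +oo%E s = `]s, +oo[%classic.
    by apply/seteqP; split=> x /=; rewrite /right_tail/= in_itv/= andbT;
      [case|rewrite ltry].
  rewrite mulr1 divr1.
  have mvw : measurable_fun `]s, +oo[ (EFin \o (fun x : R => x * w x)).
    apply/measurable_EFinP; apply: measurable_funM; first exact: measurable_id.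
    exact: measurable_w.
  rewrite integral_itv_obnd_cbnd//.
  have D (x : R) : is_derive x (1 : R) (fun x => - w x) (x * w x).
    have := is_derive_w x => H.
    by apply: is_derive_eq; rewrite mulNr opprK.
  rewrite (@ge0_continuous_FTC2y _ _ (fun x => - w x) s 0).
  + by rewrite sub0e -EFinN opprK.
  + by move=> x sx; rewrite mulr_ge0 ?w_ge0// (le_trans s0).
  + apply: continuous_subspaceT => x.
    by apply: cvgM; [exact: cvg_id|exact: continuous_w].
  + by rewrite -oppr0; apply: cvgN; exact: cvg_w_infty.
  + by move=> x _; case: (D x).
  + by apply: cvgN; apply: cvg_at_right_filter; exact: continuous_w.
  + by move=> x _; rewrite derive1E; case: (D x).
Qed.

(** Differentiating v = (x h - h') / (1 + l) and using the equation of h gives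
    v' = h, and differentiating w h gives - (1 + l) v w. *)
Lemma ground_state_fin (a : R) : 0 < a -> exists mu h v, ground_state a%:E mu h v.
Proof.
move=> a0; have [l [l0 hka hkpos]] := exists_dirichlet_eigenvalue a0.
have mu0 : 0 < 1 + l by lra.
(* The odd function whose derivative is the Dirichlet solution. *)
pose v x := (x * herm l x - herm1 l x) / (1 + l).
have Dv (x : R) : is_derive x (1 : R) v (herm l x).
  have := is_derive_herm x l0; have := is_derive_herm1 x l0 => H1 H2.
  rewrite /v; apply: is_derive_eq; rewrite /GRing.scale/=.
  by field; rewrite gt_eqF.
have hkN x : herm l (- x) = herm l x by rewrite /herm sqrrN.
have hk_cont : continuous (herm l).
  exact: continuous_is_derive (fun x => is_derive_herm x l0).
have vN x : v (- x) = - v x.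
  by rewrite /v hkN /herm1 sqrrN; field; rewrite gt_eqF.
have inI x : oitv (- a%:E) a%:E x -> - a < x < a.
  by rewrite /oitv/= !lte_fin.
exists (1 + l), (herm l), v; split=> //.
- move=> x /inI /andP[x1 x2]; have [x0|x0] := leP 0 x.
    by apply: hkpos; rewrite x0.
  by rewrite -hkN; apply: hkpos; rewrite oppr_ge0 ltW//= ltrNl.
- have ch : {within `[- a, a], continuous (herm l)} by apply: continuous_subspaceT.
  have [|c _ hc] := EVT_max _ ch; first lra.
  exists (herm l c) => x /inI /andP[x1 x2]; apply: hc.
  by rewrite in_itv/= !ltW.
- move=> s s0; rewrite lte_fin => sa.
  have -> : right_tail a%:E s = `]s, a[%classic.
    by apply/seteqP; split=> x /=; rewrite /right_tail/= in_itv/= lte_fin => /andP.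
  have cvw : continuous (fun x => v x * w x).
    move=> x; apply: cvgM; last exact: continuous_w.
    exact: (continuous_is_derive Dv).
  have mvw D : measurable_fun D (EFin \o (fun x : R => v x * w x)).
    by apply/measurable_EFinP; apply: measurable_funTS; exact: continuous_measurable_fun.
  rewrite integral_itv_obnd_cbnd// integral_itv_bndo_bndc//.
  pose F x := - (w x * herm l x) / (1 + l).
  have D (x : R) : is_derive x (1 : R) F (v x * w x).
    have := is_derive_herm x l0; have := is_derive_w x => H1 H2.
    rewrite /F; apply: is_derive_eq; rewrite /GRing.scale/= /v.
    by field; rewrite gt_eqF.
  have cF := continuous_is_derive D.
  rewrite (@continuous_FTC2 _ _ F s a sa).
  + by rewrite -EFinB /F hka mulr0 oppr0 mul0r sub0r mulNr opprK.
  + by apply: continuous_subspaceT.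
  + split; first by move=> x _; case: (D x).
      by apply: cvg_at_right_filter; exact: cF.
    by apply: cvg_at_left_filter; exact: cF.
  + by move=> x _; rewrite derive1E; case: (D x).
Qed.

Lemma exists_ground_state (a : \bar R) : (0 < a)%E ->
  exists mu h v, ground_state a mu h v.
Proof.
case: a => [a| |//]; first by rewrite lte_fin; exact: ground_state_fin.
by move=> _; exists 1, (fun=> 1), id; exact: ground_state_infty.
Qed.

End GroundState.

(** * The weighted Hardy inequality *)

Section HardyInequality.
Context {R : realType}.
Notation leb := (@lebesgue_measure R).

Lemma measurable_right_tail (a : \bar R) (s : R) :
  measurable (right_tail a s : set (measurableTypeR R)).
Proof.
case: a => [a| |].
- have -> : right_tail a%:E s = `]s, a[%classic.
    by apply/seteqP; split=> x /=; rewrite /right_tail/= in_itv/= lte_fin => /andP.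
  exact: measurable_itv.
- have -> : right_tail +oo%E s = `]s, +oo[%classic.
    by apply/seteqP; split=> x /=; rewrite /right_tail/= in_itv/= andbT;
      [case|rewrite ltry].
  exact: measurable_itv.
- rewrite (_ : right_tail _ _ = set0)//.
  by apply/seteqP; split=> x //= -[].
Qed.

Lemma measurable_inv : measurable_fun (setT : set (measurableTypeR R)) (@GRing.inv R).
Proof.
have -> : (setT : set (measurableTypeR R)) = [set 0] `|` ~` [set 0].
  by rewrite setUv.
have m0 : measurable ([set 0] : set (measurableTypeR R)) by exact: measurable_set1.
apply/measurable_funU => //; first exact: measurableC.
split; first exact: measurable_fun_set1.
apply: open_continuous_measurable_fun.
  by rewrite openC; exact: closed_eq.
by move=> x; rewrite inE => /= /eqP x0; exact: inv_continuous.
Qed.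

Lemma triangle_slice (A B : R -> R) (x : R) :
  measurable_fun (setT : set (measurableTypeR R)) B ->
  (forall x, 0 <= A x) -> (forall x, 0 <= B x) ->
  ((A x)%:E * \int[leb]_(t in `]-oo, x[) (B t)%:E =
   \int[leb]_t (A x * B t * \1_lower_triangle (x, t))%:E)%E.
Proof.
move=> mB A0 B0; rewrite -ge0_integralZl//; last 3 first.
- by apply: measurable_funTS; apply/measurable_EFinP.
- by move=> t _; rewrite lee_fin.
- by rewrite lee_fin.
rewrite integral_mkcond; apply: eq_integral => t _.
rewrite patchE mem_setE in_itv/= lower_triangleE/=.
by case: ltP; rewrite ?mulr1 ?mulr0// EFinM.
Qed.

(** Both sides integrate A(x) B(t) over the triangle t < x; measurability of the
    inner integral comes with it. *)
Lemma tonelli_triangle (A B : R -> R) :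
  measurable_fun (setT : set (measurableTypeR R)) A ->
  measurable_fun (setT : set (measurableTypeR R)) B ->
  (forall x, 0 <= A x) -> (forall x, 0 <= B x) ->
  measurable_fun (setT : set (measurableTypeR R))
    (fun x => (A x)%:E * \int[leb]_(t in `]-oo, x[) (B t)%:E)%E /\
  (\int[leb]_x ((A x)%:E * \int[leb]_(t in `]-oo, x[) (B t)%:E) =
   \int[leb]_t ((B t)%:E * \int[leb]_(x in `]t, +oo[) (A x)%:E))%E.
Proof.
move=> mA mB A0 B0.
pose F (z : measurableTypeR R * measurableTypeR R) : \bar R :=
  (A z.1 * B z.2 * \1_lower_triangle z)%:E.
have mF : measurable_fun setT F.
  apply/measurable_EFinP; apply: measurable_funM.
    by apply: measurable_funM; apply: measurableT_comp.
  exact: measurable_indic measurable_lower_triangle.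
have F0 z : (0 <= F z)%E by rewrite lee_fin !mulr_ge0// indicE.
have mAE (D : set (measurableTypeR R)) : measurable_fun D (EFin \o A).
  by apply: measurable_funTS; apply/measurable_EFinP.
have mBE (D : set (measurableTypeR R)) : measurable_fun D (EFin \o B).
  by apply: measurable_funTS; apply/measurable_EFinP.
have E : (fun x => (A x)%:E * \int[leb]_(t in `]-oo, x[) (B t)%:E)%E =
    (fun x => \int[leb]_t F (x, t))%E.
  by apply/funext => x; exact: triangle_slice.
split; first by rewrite E; exact: (measurable_fun_fubini_tonelli_F F mF F0).
rewrite E (@fubini_tonelli _ _ _ _ _ leb leb F mF F0).
apply: eq_integral => t _; rewrite -ge0_integralZl//; last 2 first.
- by move=> x _; rewrite lee_fin.
- by rewrite lee_fin.
rewrite [RHS]integral_mkcond; apply: eq_integral => x _.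
rewrite patchE mem_setE in_itv/= /F lower_triangleE/= andbT.
by case: ltP => _; rewrite ?mulr1 ?mulr0// EFinM muleC.
Qed.

Variables (a : \bar R) (mu : R) (h v : R -> R).
Hypothesis gs : ground_state a mu h v.

Let I := right_tail a 0.

Lemma gs_posI x : 0 <= x -> (x%:E < a)%E -> 0 < h x.
Proof.
move=> x0 xa; apply: (gs_pos gs); rewrite /oitv/= xa andbT.
apply: (@lt_le_trans _ _ 0%E); last by rewrite lee_fin.
by rewrite oppe_lt0; apply: le_lt_trans xa; rewrite lee_fin.
Qed.

Lemma gs_v0 : v 0 = 0.
Proof. by have := gs_odd gs 0; rewrite oppr0 => h0; lra. Qed.

Lemma gs_v_cont : continuous v.
Proof. exact: continuous_is_derive (gs_der gs). Qed.

Lemma gs_integral_h (x : R) : 0 <= x -> (\int[leb]_(t in `]0%R, x[) (h t)%:E = (v x)%:E)%E.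
Proof.
rewrite le_eqVlt => /orP[/eqP <-|x0].
  by rewrite set_itvoo0 integral_set0 gs_v0.
have mh (D : set (measurableTypeR R)) : measurable_fun D (fun t => (h t)%:E).
  apply/measurable_EFinP; apply: measurable_funTS.
  apply: continuous_measurable_fun; exact: (gs_cont gs).
rewrite -(@integral_itv_bndoo R 0 x _ true false); last exact: mh.
rewrite (@continuous_FTC2 _ _ v 0 x x0).
- by rewrite gs_v0 sube0.
- by apply: continuous_subspaceT; exact: (gs_cont gs).
- split; first by move=> y _; case: (gs_der gs y).
    by apply: cvg_at_right_filter; exact: gs_v_cont.
  by apply: cvg_at_left_filter; exact: gs_v_cont.
- by move=> y _; rewrite derive1E; case: (gs_der gs y).
Qed.

Lemma gs_v_ge0 x : 0 <= x -> (x%:E < a)%E -> 0 <= v x.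
Proof.
move=> x0 xa; rewrite -lee_fin -gs_integral_h//; apply: integral_ge0 => t /=.
rewrite in_itv/= lee_fin => /andP[t0 tx]; apply/ltW/gs_posI; first exact: ltW.
by apply: lt_trans xa; rewrite lte_fin.
Qed.

Lemma gs_v_gt0 x : 0 < x -> (x%:E < a)%E -> 0 < v x.
Proof.
move=> x0 xa; have [|c] := @MVT R v h 0 x x0 (fun t _ => gs_der gs t).
  by apply: continuous_subspaceT; exact: gs_v_cont.
rewrite in_itv/= gs_v0 !subr0 => /andP[c0 cx] ->.
rewrite mulr_gt0//; apply: gs_posI; first exact: ltW.
by apply: lt_trans xa; rewrite lte_fin.
Qed.

Lemma measurable_h (D : set (measurableTypeR R)) : measurable_fun D h.
Proof.
by apply: measurable_funTS; apply: continuous_measurable_fun; exact: (gs_cont gs).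
Qed.

Lemma measurable_v (D : set (measurableTypeR R)) : measurable_fun D v.
Proof.
by apply: measurable_funTS; apply: continuous_measurable_fun; exact: gs_v_cont.
Qed.

Lemma measurable_hV (D : set (measurableTypeR R)) : measurable_fun D (fun t => (h t)^-1).
Proof. by apply: measurable_funTS; apply: measurableT_comp; [exact: measurable_inv|exact: measurable_h]. Qed.

(** Cauchy-Schwarz with weight h, in the form 2 c |g| <= g^2 / h + c^2 h with the
    optimal constant c = y / v(x); this form also makes sense when the integral of
    g^2 / h is infinite. *)
Lemma hardy_pointwise (g : R -> R) (x y : R) :
  measurable_fun (setT : set (measurableTypeR R)) g ->
  0 < x -> (x%:E < a)%E -> 0 <= y ->
  (y%:E <= \int[leb]_(t in `]0%R, x[) `|g t|%:E)%E ->
  ((y ^+ 2)%:E <= (v x)%:E * \int[leb]_(t in `]0%R, x[) (g t ^+ 2 / h t)%:E)%E.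
Proof.
move=> mg x0 xa y0 H; have v0 := gs_v_gt0 x0 xa.
(* The constant that optimises the quadratic bound below. *)
set c := y / v x; have c0 : 0 <= c by rewrite divr_ge0// ltW.
have tI t : `]0, x[%classic t -> 0 < h t.
  rewrite /= in_itv/= => /andP[t0 tx]; apply: gs_posI; first exact: ltW.
  by apply: lt_trans xa; rewrite lte_fin.
have mg' (D : set (measurableTypeR R)) : measurable_fun D g.
  exact: measurable_funTS.
have m1 : measurable_fun `]0, x[ (EFin \o (fun t => g t ^+ 2 / h t)).
  apply/measurable_EFinP; apply: measurable_funM; last exact: measurable_hV.
  by apply: measurable_funX; exact: mg'.
have m2 : measurable_fun `]0, x[ (EFin \o (fun t => c ^+ 2 * h t)).
  by apply/measurable_EFinP; apply: measurable_funM => //; exact: measurable_h.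
have m4 : measurable_fun `]0, x[ (fun t => (h t)%:E).
  by apply/measurable_EFinP; exact: measurable_h.
have m3 : measurable_fun `]0, x[ (EFin \o (fun t => `|g t|)).
  by apply/measurable_EFinP; apply: measurableT_comp => //; exact: mg'.
set J := (\int[leb]_(t in `]0%R, x[) (g t ^+ 2 / h t)%:E)%E.
have K : ((2 * c * y)%:E <= J + (c ^+ 2 * v x)%:E)%E.
  apply: (@le_trans _ _ ((2 * c)%:E * \int[leb]_(t in `]0%R, x[) `|g t|%:E)%E).
    by rewrite EFinM lee_wpmul2l// lee_fin mulr_ge0.
  rewrite (EFinM (c ^+ 2) (v x)) -gs_integral_h; last exact: ltW.
  have g0 t : `]0, x[%classic t -> (0 <= (EFin \o (fun t => `|g t|)%R) t)%E.
    by move=> _; rewrite lee_fin.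
  rewrite -(ge0_integralZl_EFin leb _ g0 m3)//; last by rewrite mulr_ge0.
  have h0 t : `]0, x[%classic t -> (0 <= (h t)%:E)%E.
    by move=> /tI/ltW; rewrite lee_fin.
  rewrite -(ge0_integralZl_EFin leb _ h0 m4)//; last exact: sqr_ge0.
  have m5 : measurable_fun `]0, x[ (fun t => (c ^+ 2)%:E * (h t)%:E)%E.
    exact: measurable_funeM.
  have p1 t : `]0, x[%classic t -> (0 <= (g t ^+ 2 / h t)%:E)%E.
    by move=> /tI/ltW t0; rewrite lee_fin divr_ge0// sqr_ge0.
  have p5 t : `]0, x[%classic t -> (0 <= (c ^+ 2)%:E * (h t)%:E)%E.
    by move=> /tI/ltW t0; rewrite -EFinM lee_fin mulr_ge0// sqr_ge0.
  rewrite -(ge0_integralD leb _ p1 m1 p5 m5)//.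
  apply: ge0_le_integral => //.
  - by move=> t _; rewrite lee_fin mulr_ge0// mulr_ge0.
  - exact: measurable_funeM.
  - exact: emeasurable_funD.
  - move=> t /tI t0; rewrite -!EFinM -EFinD lee_fin.
    rewrite -subr_ge0 (_ : _ - _ = (`|g t| - c * h t) ^+ 2 / h t).
      by rewrite divr_ge0 ?sqr_ge0// ltW.
    have -> : g t ^+ 2 = `|g t| ^+ 2 by rewrite real_normK ?num_real.
    by field; rewrite gt_eqF.
have K2 : ((y ^+ 2 / v x)%:E <= J)%E.
  move: K; rewrite /c; case: J => [r|_|]; [|exact: leey|by rewrite addNye leeNy_eq].
  rewrite -EFinD !lee_fin => K.
  rewrite (_ : _ / _ = 2 * (y / v x) * y - (y / v x) ^+ 2 * v x); first lra.
  by field; rewrite gt_eqF.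
apply: (@le_trans _ _ ((v x)%:E * (y ^+ 2 / v x)%:E)%E).
  by rewrite -EFinM lee_fin mulrCA divff ?mulr1// gt_eqF.
by rewrite lee_wpmul2l// lee_fin ltW.
Qed.

(** Insert [hardy_pointwise], exchange the integrals over t < x, and evaluate the
    inner integral of v w over ]t, a[ with [gs_tail]: the factor w(t) h(t) / mu
    cancels the weight 1 / h(t). *)
Lemma hardy_ineq (k g : R -> R) :
  measurable_fun (setT : set (measurableTypeR R)) k ->
  measurable_fun (setT : set (measurableTypeR R)) g ->
  {ae leb, forall x, 0 < x -> (x%:E < a)%E ->
    (`|k x|%:E <= \int[leb]_(t in `]0%R, x[) `|g t|%:E)%E} ->
  (mu%:E * \int[leb]_(x in I) (k x ^+ 2 * w x)%:E <=
   \int[leb]_(x in I) (g x ^+ 2 * w x)%:E)%E.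
Proof.
move=> mk mg H.
have mI : measurable (I : set (measurableTypeR R)) := measurable_right_tail a 0.
have mi : measurable_fun setT (\1_I : measurableTypeR R -> R) := measurable_indic mI.
have mw := @measurable_w R setT.
pose A x := v x * w x * \1_I x.
pose B t := g t ^+ 2 / h t * \1_I t.
have II x : I x -> 0 < x /\ (x%:E < a)%E by [].
have mA : measurable_fun (setT : set (measurableTypeR R)) A.
  by apply: measurable_funM => //; apply: measurable_funM => //; exact: measurable_v.
have mB : measurable_fun (setT : set (measurableTypeR R)) B.
  apply: measurable_funM => //; apply: measurable_funM; last exact: measurable_hV.
  exact: measurable_funX mg.
have A0 x : 0 <= A x.
  rewrite /A indicE; case: (boolP (x \in I)) => [|_]; last by rewrite mulr0.
  by rewrite inE => /II[x0 xa]; rewrite mulr1 mulr_ge0 ?w_ge0// gs_v_ge0// ltW.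
have B0 x : 0 <= B x.
  rewrite /B indicE; case: (boolP (x \in I)) => [|_]; last by rewrite mulr0.
  by rewrite inE => /II[x0 xa]; rewrite mulr1 divr_ge0 ?sqr_ge0// ltW// gs_posI// ltW.
have [mT T] := tonelli_triangle mA mB A0 B0.
have mkw (u : R -> R) : measurable_fun (setT : set (measurableTypeR R)) u ->
    measurable_fun (setT : set (measurableTypeR R)) (fun x => (u x ^+ 2 * w x)%:E).
  move=> mu'; apply/measurable_EFinP; apply: measurable_funM => //.
  by apply: measurable_funX.
have S1 : (\int[leb]_(x in I) (k x ^+ 2 * w x)%:E <=
    \int[leb]_x ((A x)%:E * \int[leb]_(t in `]-oo, x[) (B t)%:E))%E.
  rewrite integral_mkcond; apply: ae_ge0_le_integral => //.
  - by move=> x _; rewrite patchE; case: ifP => // _; rewrite lee_fin mulr_ge0 ?sqr_ge0 ?w_ge0.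
  - by apply/(measurable_restrictT _ _).1 => //; apply: measurable_funTS; exact: mkw.
  - by move=> x _; rewrite mule_ge0 ?lee_fin//; apply: integral_ge0 => t _; rewrite lee_fin.
  apply: (ae_mono _ H) => x Hx _; rewrite patchE; case: ifPn => [|_]; last first.
    by rewrite mule_ge0 ?lee_fin//; apply: integral_ge0 => t _; rewrite lee_fin.
  move=> xI; have [x0 xa] := II x (set_mem xI).
  have -> : (\int[leb]_(t in `]-oo, x[) (B t)%:E =
             \int[leb]_(t in `]0%R, x[) (g t ^+ 2 / h t)%:E)%E.
    rewrite integral_mkcond [RHS]integral_mkcond; apply: eq_integral => t _.
    rewrite !patchE !mem_setE !in_itv/= /B indicE.
    have [tx|] := ltP t x; last by rewrite andbF.
    rewrite andbT; case: ltP => t0.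
      by rewrite mem_set ?mulr1//; split=> //; apply: lt_trans xa; rewrite lte_fin.
    by rewrite memNset ?mulr0// => -[]; rewrite ltNge t0.
  rewrite /A indicE xI mulr1 [k x ^+ 2 * _]mulrC [v x * _]mulrC.
  rewrite (EFinM (w x) (v x)) (EFinM (w x) (k x ^+ 2)) -muleA.
  rewrite lee_wpmul2l//; first by rewrite lee_fin w_ge0.
  rewrite -[k x ^+ 2]real_normK ?num_real//; apply: hardy_pointwise => //.
  exact: Hx.
have S2 : (\int[leb]_t ((B t)%:E * \int[leb]_(x in `]t, +oo[) (A x)%:E) =
    (mu^-1)%:E * \int[leb]_(x in I) (g x ^+ 2 * w x)%:E)%E.
  rewrite -ge0_integralZl//; last 3 first.
  - by apply: measurable_funTS; exact: mkw.
  - by move=> t _; rewrite lee_fin mulr_ge0 ?sqr_ge0 ?w_ge0.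
  - by rewrite lee_fin invr_ge0 ltW// (gs_mu gs).
  rewrite [RHS]integral_mkcond; apply: eq_integral => t _; rewrite patchE.
  case: ifPn => tI; last by rewrite /B indicE (negbTE tI) mulr0 mul0e.
  have [t0 ta] := II t (set_mem tI).
  have -> : (\int[leb]_(x in `]t, +oo[) (A x)%:E =
      \int[leb]_(x in right_tail a t) (v x * w x)%:E)%E.
    rewrite integral_mkcond [RHS]integral_mkcond; apply: eq_integral => x _.
    rewrite !patchE !mem_setE !in_itv/= andbT /A indicE.
    have [tx|tx] := ltP t x; last first.
      by rewrite memNset// /right_tail/= => -[]; rewrite ltNge tx.
    have [xa|xa] := ltP (x%:E) a.
      by rewrite !mem_set ?mulr1//; split=> //; apply: lt_trans tx.
    by rewrite !memNset ?mulr0// => -[_]; rewrite ltNge xa.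
  rewrite (gs_tail gs (ltW t0) ta) -!EFinM /B indicE tI mulr1.
  have ht := gs_posI (ltW t0) ta; have mu0 := gs_mu gs.
  by congr EFin; field; rewrite !gt_eqF.
have mu0 := gs_mu gs; move: S1; rewrite T S2 => S.
apply: le_trans (lee_wpmul2l _ S) _; first by rewrite lee_fin ltW.
by rewrite muleA -EFinM divff ?gt_eqF// mul1e.
Qed.

End HardyInequality.

(** * Gaussian against Lebesgue measure *)

Section GaussianMeasures.
Context {R : realType}.
Notation leb := (@lebesgue_measure R).
Notation g1 := (@gamma1 R).
Notation g2 := (@gamma2 R).
Notation mR := (measurableTypeR R).

Lemma gamma1_dominates : g1 `<< leb.
Proof. exact: normal_prob_dominates. Qed.

Lemma measurable_wE (D : set mR) : measurable_fun D (fun x => (w x)%:E).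
Proof. by apply/measurable_EFinP; exact: measurable_w. Qed.

(** The Radon-Nikodym derivative of gamma1 is almost everywhere its density. *)
Lemma ge0_integral_gamma1 (D : set mR) (f : mR -> \bar R) :
  measurable D -> measurable_fun D f -> (forall x, D x -> (0 <= f x)%E) ->
  (\int[g1]_(x in D) f x = \int[leb]_(x in D) (f x * (w x)%:E))%E.
Proof.
move=> mD mf f0.
pose F := f \_ D.
have mF : measurable_fun setT F by apply/(measurable_restrictT _ _).1.
have F0 x : (0 <= F x)%E.
  by rewrite /F patchE; case: ifPn => // /set_mem; exact: f0.
have E1 : ae_eq leb setT (Radon_Nikodym_SigmaFinite.f g1 leb) (fun x => (w x)%:E).
  apply: integral_ae_eq => //.
  - exact: Radon_Nikodym_SigmaFinite.f_integrable gamma1_dominates.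
  - exact: measurable_wE.
  - move=> A _ mA; rewrite -Radon_Nikodym_SigmaFinite.f_integral//.
    exact: gamma1_dominates.
rewrite integral_mkcond -/F.
rewrite -(Radon_Nikodym_SigmaFinite.change_of_variables gamma1_dominates F0 measurableT mF).
rewrite [RHS]integral_mkcond.
transitivity (\int[leb]_x (F x * (w x)%:E))%E.
  apply: ae_eq_integral => //.
  - apply: emeasurable_funM => //.
    exact: measurable_int (Radon_Nikodym_SigmaFinite.f_integrable gamma1_dominates).
  - by apply: emeasurable_funM => //; exact: measurable_wE.
  - exact: ae_eqe_mul2l.
apply: eq_integral => x _; rewrite /F !patchE; case: ifP => // _.
by rewrite mul0e.
Qed.

Lemma integrable_gamma1 (D : set mR) (f : R -> R) :
  measurable D -> measurable_fun (D : set mR) f ->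
  g1.-integrable D (EFin \o f) <-> leb.-integrable D (EFin \o (fun x => f x * w x)).
Proof.
move=> mD mf.
have mfE : measurable_fun D (EFin \o f) by apply/measurable_EFinP.
have mfw : measurable_fun D (EFin \o (fun x => f x * w x)).
  by apply/measurable_EFinP; apply: measurable_funM => //; exact: measurable_w.
have E : (\int[g1]_(x in D) `|(EFin \o f) x| =
          \int[leb]_(x in D) `|(f x * w x)%R%:E|)%E.
  rewrite ge0_integral_gamma1//; last exact: measurableT_comp.
  apply: eq_integral => x _; rewrite /= normrM EFinM.
  by rewrite (ger0_norm (w_ge0 x)).
by split=> /integrableP[_ h]; apply/integrableP; split=> //; move: h; rewrite E.
Qed.

Lemma Rintegral_gamma1 (D : set mR) (f : R -> R) : measurable D ->
  g1.-integrable D (EFin \o f) ->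
  \int[g1]_(x in D) f x = \int[leb]_(x in D) (f x * w x).
Proof.
move=> mD fi; have mf : measurable_fun D f.
  by apply/measurable_EFinP; exact: measurable_int fi.
have mfE : measurable_fun D (EFin \o f) by apply/measurable_EFinP.
rewrite /Rintegral; congr fine.
rewrite integralE [RHS]integralE; congr (_ - _)%E.
- rewrite ge0_integral_gamma1//; last exact: measurable_funepos.
  apply: eq_integral => x _; rewrite !funeposE /= EFinM.
  by rewrite maxe_pMl ?mul0e// lee_fin w_ge0.
- rewrite ge0_integral_gamma1//; last exact: measurable_funeneg.
  apply: eq_integral => x _; rewrite !funenegE.
  have e : (- (EFin \o (fun x => f x * w x)%R) x = (- (EFin \o f) x) * (w x)%:E)%E.
    by rewrite /= -EFinM mulNr.
  by rewrite e maxe_pMl ?mul0e// lee_fin w_ge0.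
Qed.

(** The density is positive. *)
Lemma gamma1_null (A : set mR) : measurable A -> g1 A = 0%E -> leb A = 0%E.
Proof.
move=> mA A0.
have : (\int[leb]_(x in A) `|(w x)%:E| = 0)%E.
  rewrite -[RHS]A0 /gamma1 /normal_prob; apply: eq_integral => x _.
  by rewrite gee0_abs// lee_fin w_ge0.
move=> /(ae_eq_integral_abs leb mA (@measurable_wE A)) [N [mN N0 AN]].
apply/eqP; rewrite -measure_le0 -N0; apply: le_measure; rewrite ?inE//.
by move=> x Ax; apply: AN => /= /(_ Ax) /eqP; rewrite eqe gt_eqF// w_gt0.
Qed.

Lemma ae_gamma1 (P : R -> Prop) :
  {ae g1, forall x, P x} -> {ae leb, forall x, P x}.
Proof.
by move=> [N [mN N0 PN]]; exists N; split=> //; exact: gamma1_null.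
Qed.

Lemma ae_gamma1_leb (P : R -> Prop) :
  {ae leb, forall x, P x} -> {ae g1, forall x, P x}.
Proof.
move=> [N [mN N0 PN]]; exists N; split=> //.
exact: ((null_content_dominatesP _ _).1 gamma1_dominates N mN N0).
Qed.

Lemma measurable_section1 (f : R * R -> R) (y : R) :
  measurable_fun (setT : set (mR * mR)) f ->
  measurable_fun (setT : set mR) (fun x => f (x, y)).
Proof. by move=> mf; apply: measurableT_comp => //; exact: measurable_pair2. Qed.

(** Almost every section of a null set is null. *)
Lemma ae_sections2 (m1 m2 : {sigma_finite_measure set mR -> \bar R}) (P : R * R -> Prop) :
  {ae (m1 \x m2)%E, forall z, P z} ->
  {ae m2, forall y, {ae m1, forall x, P (x, y)}}.
Proof.
move=> [N [mN N0 PN]].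
have H : (\int[m2]_y `|m1 (ysection N y)| = 0)%E.
  rewrite -[RHS]N0 -[in RHS](setIT N) -integral_indic//.
  have mind : measurable_fun setT (EFin \o (\1_N : mR * mR -> R)).
    by apply/measurable_EFinP; exact: measurable_indic.
  rewrite (fubini_tonelli2 (EFin \o (\1_N : mR * mR -> R)))//; last first.
    by move=> z; rewrite lee_fin.
  by rewrite indic_fubini_tonelli_GE//; apply: eq_integral => y _; rewrite gee0_abs.
have mphi : measurable_fun setT (fun y => m1 (ysection N y)).
  exact: measurable_fun_ysection.
move/(ae_eq_integral_abs m2 measurableT mphi): H.
apply: filterS => y /= /(_ I) Ny.
exists (ysection N y); split=> //; first exact: measurable_ysection.
by move=> x Px; rewrite /ysection/= inE; exact: PN.
Qed.

Lemma ge0_integral_gamma2 (f : R * R -> \bar R) :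
  measurable_fun (setT : set (mR * mR)) f -> (forall z, 0 <= f z)%E ->
  (\int[g2]_z f z = \int[leb]_y ((w y)%:E * \int[leb]_x (f (x, y) * (w x)%:E)))%E.
Proof.
move=> mf f0; transitivity (\int[g1]_y fubini_G g1 f y)%E; first exact: (@fubini_tonelli2 _ _ mR mR R g1 g1 f mf f0).
rewrite (@ge0_integral_gamma1 setT (fubini_G g1 f) measurableT).
- apply: eq_integral => y _; rewrite muleC; congr (_ * _)%E.
  rewrite /fubini_G ge0_integral_gamma1//.
  by apply: measurableT_comp => //; exact: measurable_pair2.
- exact: (@measurable_fun_fubini_tonelli_G _ _ mR mR R g1 f mf f0).
- by move=> y _; rewrite /fubini_G; apply: integral_ge0 => x _; exact: f0.
Qed.

End GaussianMeasures.

(** * Reflections and symmetric intervals *)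

Section Reflection.
Context {R : realType}.
Notation leb := (@lebesgue_measure R).
Notation mR := (measurableTypeR R).

Lemma ae_opp (P : R -> Prop) :
  {ae leb, forall x, P x} -> {ae leb, forall x, P (- x)}.
Proof.
move=> [N [mN N0 PN]].
exists ((-%R : R -> mR) @^-1` N); split.
- by rewrite -[X in measurable X]setTI; exact: oppr_measurable.
- by rewrite -[RHS]N0 -[RHS]lebesgue_measureN.
- by move=> x Px; apply: PN.
Qed.

Lemma measurable_oitv (a b : \bar R) : measurable (oitv a b : set mR).
Proof.
have -> : oitv a b = EFin @^-1` [set` Interval (BRight a) (BLeft b)].
  by apply/seteqP; split=> x /=; rewrite in_itv.
rewrite -[X in measurable X]setTI; apply: EFin_measurable => //.
exact: emeasurable_itv.
Qed.

Lemma oitvP (a : \bar R) (x : R) : oitv (- a) a x <-> (`|x|%:E < a)%E.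
Proof.
rewrite /oitv/=; have [x0|x0] := ger0P x.
  split=> [/andP[_ ->] //|xa]; rewrite xa andbT lteNl.
  by apply: le_lt_trans xa; rewrite -EFinN lee_fin; lra.
split=> [/andP[+ _]|xa]; first by rewrite lteNl EFinN.
rewrite lteNl -EFinN xa/=.
by apply: lt_trans xa; rewrite lte_fin; lra.
Qed.

Lemma oitv_sym (a : \bar R) (x : R) : oitv (- a) a (- x) <-> oitv (- a) a x.
Proof. by split=> /oitvP H; apply/oitvP; move: H; rewrite normrN. Qed.

Lemma right_tailP (a : \bar R) (x : R) : right_tail a 0 x <-> 0 < x /\ oitv (- a) a x.
Proof.
split=> [[x0 xa]|[x0 /oitvP]]; last by rewrite gtr0_norm.
by split=> //; apply/oitvP; rewrite gtr0_norm.
Qed.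

(** Substitute -x for x on the negative half. *)
Lemma even_split (a : \bar R) (F : R -> \bar R) :
  measurable_fun (setT : set mR) F -> (forall x, 0 <= F x)%E ->
  (\int[leb]_(x in oitv (- a) a) F x =
   \int[leb]_(x in right_tail a 0) F x + \int[leb]_(x in right_tail a 0) F (- x)%R)%E.
Proof.
move=> mF F0; pose G := F \_ (oitv (- a) a).
have mI := measurable_oitv (- a) a.
have mG : measurable_fun (setT : set mR) G.
  by apply/(measurable_restrictT _ _).1 => //; exact: measurable_funTS.
have G0 x : (0 <= G x)%E by rewrite /G patchE; case: ifP.
have mGN : measurable_fun (setT : set mR) (fun x => G (- x)%R).
  by apply: measurableT_comp => //; exact: oppr_measurable.
rewrite integral_mkcond -/G.
rewrite -(setUv `]0%R, +oo[%classic) ge0_integral_setU//=; last 3 first.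
- exact: measurableC.
- by rewrite setUv.
- exact/disj_setPCl.
congr (_ + _)%E.
  rewrite integral_mkcond [RHS]integral_mkcond; apply: eq_integral => x _.
  rewrite !patchE mem_setE in_itv/= andbT /G patchE.
  have [x0|x0] := ltP 0 x.
    have [xI|xI] := boolP (x \in oitv (- a) a).
      by rewrite mem_set//; apply/right_tailP; split=> //; exact: set_mem.
    by rewrite memNset// => /right_tailP[_ /mem_set]; rewrite (negbTE xI).
  by rewrite memNset// => /right_tailP[]; rewrite ltNge x0.
rewrite setCitvr; transitivity (\int[leb]_(x in `[0%R, +oo[) G (- x)%R)%E.
  rewrite (ge0_integration_by_substitution0 mGN)//.
  by apply: eq_integral => x _; rewrite opprK.
rewrite -integral_itv_obnd_cbnd; last exact: measurable_funTS.
rewrite integral_mkcond [RHS]integral_mkcond; apply: eq_integral => x _.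
rewrite !patchE mem_setE in_itv/= andbT /G patchE.
have [x0|x0] := ltP 0 x.
  have [xI|xI] := boolP (- x \in oitv (- a) a).
    rewrite mem_set//; apply/right_tailP; split=> //; apply/oitv_sym; exact: set_mem.
  by rewrite memNset// => /right_tailP[_ /oitv_sym/mem_set]; rewrite (negbTE xI).
by rewrite memNset// => /right_tailP[]; rewrite ltNge x0.
Qed.

Lemma ae_exists (c d : R) (P : R -> Prop) : c < d ->
  {ae leb, forall x, P x} -> exists2 x, c < x < d & P x.
Proof.
move=> cd [N [mN N0 PN]]; apply: contrapT => H.
have S : `]c, d[ `<=` N.
  move=> x /=; rewrite in_itv/= => cxd; apply: PN => /= Px.
  by apply: H; exists x.
have : (leb `]c, d[ <= leb N)%E by apply: le_measure; rewrite ?inE.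
by rewrite N0 [X in (X <= _)%E]lebesgue_measure_itv/= lte_fin cd -EFinD lee_fin leNgt subr_gt0 cd.
Qed.

(** Lets statements about compact subintervals be transferred to ]-a, a[ without
    distinguishing finite and infinite a. *)
Lemma exhaustion (a : \bar R) : (0 < a)%E -> exists q : nat -> R,
  [/\ forall n, 0 < q n /\ ((q n)%:E < a)%E, forall n, q 0%N <= q n &
      forall x, (x%:E < a)%E -> exists n, x < q n].
Proof.
case: a => [a| |//]; last first.
  move=> _; exists (fun n => n.+1%:R); split.
  - by move=> n; rewrite ltr0n ltry.
  - by move=> n; rewrite ler_nat.
  - move=> x _; exists (Num.truncn `|x|).
    by apply: le_lt_trans (ler_norm x) _; rewrite truncnS_gt.
rewrite lte_fin => a0; exists (fun n => a - a / n.+2%:R); split.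
- move=> n; rewrite lte_fin; split; last by rewrite gtrBl divr_gt0.
  by rewrite subr_gt0 ltr_pdivrMr// ltr_pMr// ltr1n.
- by move=> n; rewrite lerB// ler_pM2l// lef_pV2 ?posrE// ler_nat.
- move=> x; rewrite lte_fin => xa; have ax : 0 < a - x by rewrite subr_gt0.
  exists (Num.truncn (a / (a - x))).
  rewrite ltrBrDr -ltrBrDl ltr_pdivrMr// mulrC -ltr_pdivrMr//.
  by apply: lt_le_trans (truncnS_gt _) _; rewrite ler_nat.
Qed.

End Reflection.

(** * Signed primitives based at 0 *)

Section WeakRepresentation.
Context {R : realType}.
Notation leb := (@lebesgue_measure R).
Notation mR := (measurableTypeR R).

(** On a compact interval |f| <= 1 + f^2 w / (min of w). *)
Lemma sq_integrable (q : R) (f : R -> R) :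
  measurable_fun (`[- q, q] : set mR) f ->
  leb.-integrable `[- q, q] (EFin \o (fun x => f x ^+ 2 * w x)) ->
  leb.-integrable `[- q, q] (EFin \o f).
Proof.
move=> mf fi; have wq := w_gt0 q.
apply: (@le_integrable _ mR R leb `[- q, q] (measurable_itv _) (EFin \o f)
  (EFin \o (fun x => 1 + (w q)^-1 * (f x ^+ 2 * w x)))).
- by apply/measurable_EFinP.
- move=> x /=; rewrite in_itv/= -ler_norml => xq; rewrite lee_fin.
  rewrite [leRHS]ger0_norm; last first.
    by rewrite addr_ge0// mulr_ge0 ?invr_ge0 ?(ltW wq)// mulr_ge0 ?sqr_ge0 ?w_ge0.
  have h : `|f x| ^+ 2 <= (w q)^-1 * (f x ^+ 2 * w x).
    rewrite real_normK ?num_real// mulrCA ler_peMr ?sqr_ge0//.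
    by rewrite ler_pdivlMl// mulr1 w_lower.
  by have := normr_ge0 (f x); move: (`|f x|) h => u h u0; nra.
- rewrite (_ : EFin \o _ = (EFin \o (fun=> 1%R)) \+ (EFin \o (fun x => (w q)^-1 * (f x ^+ 2 * w x)%R)%R))%E//.
  apply: integrableD => //.
    apply: continuous_compact_integrable; first exact: segment_compact.
    by apply: continuous_subspaceT => x; exact: cvg_cst.
  under [X in _.-integrable _ X]eq_fun do rewrite /= EFinM.
  exact: integrableZl.
Qed.

(** The integral of g from 0 to x, with sign, so that a primitive on a symmetric
    interval has the same form on both halves. *)
Definition prim0 (g : R -> R) (x : R) : R :=
  if 0 <= x then \int[leb]_(t in `]0, x]) g t else - \int[leb]_(t in `]x, 0]) g t.

Lemma prim_prim0 (q : R) (g : R -> R) (x : R) : 0 < q -> - q <= x <= q ->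
  leb.-integrable `[- q, q] (EFin \o g) ->
  prim (- q) g x - prim (- q) g 0 = prim0 g x.
Proof.
move=> q0 /andP[qx xq] gi; rewrite /prim /prim0.
have sub (y : R) : y <= q -> leb.-integrable `[- q, y] (EFin \o g).
  move=> yq; apply: integrableS gi => //.
  by apply: subset_itvl; rewrite bnd_simp.
have [x0|x0] := leP 0 x.
  rewrite (@Rintegral_itvB _ _ (BLeft (- q)) (BRight x) 0)//; first exact: sub.
  by rewrite bnd_simp; lra.
rewrite -opprB (@Rintegral_itvB _ _ (BLeft (- q)) (BRight 0) x)//; last first.
  by rewrite bnd_simp ltW.
by apply: sub; lra.
Qed.

Lemma prim0_bound (q : R) (g : R -> R) (x : R) : 0 < x -> x <= q ->
  leb.-integrable `[- q, q] (EFin \o g) ->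
  (`|prim0 g x|%:E <= \int[leb]_(t in `]0%R, x[) `|g t|%:E)%E.
Proof.
move=> x0 xq gi; rewrite /prim0 (ltW x0).
have gi' : leb.-integrable `]0, x] (EFin \o g).
  by apply: integrableS gi => //; apply: subset_itv; rewrite bnd_simp//; lra.
rewrite EFin_normr_Rintegral//.
apply: le_trans (le_abse_integral leb (measurable_itv _) (measurable_int _ gi')) _.
rewrite -(@integral_itv_bndoo R 0 x _ false false)//.
apply/measurable_EFinP; apply: measurableT_comp => //; apply/measurable_EFinP.
apply: measurable_funS (measurable_int _ gi') => //.
by apply: subset_itvl; rewrite bnd_simp.
Qed.

Lemma ge0_integral_opp (F : R -> \bar R) : measurable_fun (setT : set mR) F ->
  (forall x, 0 <= F x)%E -> (\int[leb]_x F (- x)%R = \int[leb]_x F x)%E.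
Proof.
move=> mF F0; have mo : measurable_fun (setT : set mR) (-%R : mR -> mR).
  exact: oppr_measurable.
transitivity (\int[pushforward leb (-%R : mR -> mR)]_x F x)%E.
  by rewrite (ge0_integral_pushforward mo leb)//=; exact: measurable_funTS.
by apply: eq_measure_integral => A mA _; exact: lebesgue_measureN.
Qed.

Lemma integral_opp (F : R -> \bar R) : measurable_fun (setT : set mR) F ->
  (\int[leb]_x F (- x)%R = \int[leb]_x F x)%E.
Proof.
move=> mF; rewrite integralE [RHS]integralE; congr (_ - _)%E.
- rewrite -[RHS]ge0_integral_opp//; last exact: measurable_funepos.
  by apply: eq_integral => x _; rewrite !funeposE.
- rewrite -[RHS]ge0_integral_opp//; last exact: measurable_funeneg.
  by apply: eq_integral => x _; rewrite !funenegE.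
Qed.

Lemma patch_opp (b1 b2 : bool) (c d : R) (f : R -> R) :
  (fun x => f (- x)) \_ [set` Interval (BSide b1 c) (BSide b2 d)] =
  (fun x => (f \_ [set` Interval (BSide (~~ b2) (- d)) (BSide (~~ b1) (- c))]) (- x)).
Proof.
apply/funext => x; rewrite !patchE !mem_setE !itv_boundlr /=.
by case: b1; case: b2; rewrite !bnd_simp ?lerN2 ?ltrN2 andbC.
Qed.

Lemma integrable_opp (q : R) (g : R -> R) :
  leb.-integrable `[- q, q] (EFin \o g) ->
  leb.-integrable `[- q, q] (EFin \o (fun t => g (- t))).
Proof.
move=> gi; have := integrable_patch (measurable_itv _) gi => /integrableP[mgp gpi].
have mgp' : measurable_fun (setT : set mR) (g \_ `[- q, q]) by apply/measurable_EFinP.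
have mo : measurable_fun (setT : set mR) (-%R : mR -> mR).
  exact: oppr_measurable.
apply/(@integrable_mkcond _ mR R leb `[- q, q] _ (measurable_itv _)).
rewrite restrict_EFin patch_opp/= opprK; apply/integrableP; split.
  by apply/measurable_EFinP; apply: (measurableT_comp mgp').
rewrite (@ge0_integral_opp (fun x => `|((g \_ `[- q, q]) x)%:E|%E))//.
by apply: measurableT_comp => //; apply/measurable_EFinP.
Qed.

Lemma prim0_opp (q : R) (g : R -> R) (x : R) : 0 < x -> x <= q ->
  leb.-integrable `[- q, q] (EFin \o g) ->
  prim0 g (- x) = - prim0 (fun t => g (- t)) x.
Proof.
move=> x0 xq gi; rewrite /prim0 (ltW x0) leNgt oppr_lt0 x0/=; congr (- _).
have i1 : leb.-integrable `]- x, 0] (EFin \o g).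
  by apply: integrableS gi => //; apply: subset_itv; rewrite bnd_simp//; lra.
have i2 : leb.-integrable `]- x, 0[ (EFin \o g).
  by apply: integrableS gi => //; apply: subset_itv; rewrite bnd_simp//; lra.
have i3 : leb.-integrable `[- x, 0[ (EFin \o g).
  by apply: integrableS gi => //; apply: subset_itv; rewrite bnd_simp//; lra.
rewrite -Rintegral_itv_bndo_bndc// (Rintegral_itv_obnd_cbnd i2).
rewrite [RHS]Rintegral_mkcond patch_opp oppr0/= [LHS]Rintegral_mkcond.
rewrite /Rintegral; congr fine; rewrite -integral_opp//.
by have /integrableP[] := integrable_patch (measurable_itv _) i3.
Qed.

(** [weak_deriv_primitive] on ]-q, q[, with the constant moved to 0.  The
    hypothesis mentions only the countable family of test functions, which is what
    survives on almost every line in two dimensions. *)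
Lemma weak_deriv_prim0 (q : R) (z g : R -> R) N : 0 < q ->
  mass (- q) q q N != 0 ->
  leb.-integrable `[- q, q] (EFin \o z) -> leb.-integrable `[- q, q] (EFin \o g) ->
  (forall r n, - q < ratr r < q ->
    \int[leb]_(x in `]- q, q[) (z x * bal_bump (- q) q N r n x) =
    - \int[leb]_(x in `]- q, q[) (g x * prim (- q) (bal_bump (- q) q N r n) x)) ->
  exists C, {ae leb, forall x, - q < x < q -> z x = C + prim0 g x}.
Proof.
move=> q0 mN zi gi H; have qq : - q < q by lra.
have [C HC] := weak_deriv_primitive qq mN zi gi H.
exists (C + prim (- q) g 0).
apply: (ae_mono _ HC) => x + xq; rewrite in_itv/= => ->//.
rewrite -(@prim_prim0 q)//; last by move/andP: xq => [? ?]; rewrite !ltW.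
by rewrite addrACA subrr addr0.
Qed.

End WeakRepresentation.

(** * The one-dimensional Poincare inequality *)

Section OneDimension.
Context {R : realType}.
Notation leb := (@lebesgue_measure R).
Notation mR := (measurableTypeR R).
Notation g1 := (@gamma1 R).

Lemma sub_oitv (a : \bar R) (q : R) : (q%:E < a)%E -> `[- q, q] `<=` oitv (- a) a.
Proof.
move=> qa x /=; rewrite in_itv/= => /andP[x1 x2]; apply/oitvP.
by apply: le_lt_trans qa; rewrite lee_fin ler_norml x1.
Qed.

Lemma L2_gamma1_sqw (D : set mR) (f : R -> R) : measurable D -> L2 g1 D f ->
  leb.-integrable D (EFin \o (fun x => f x ^+ 2 * w x)).
Proof.
move=> mD [mf fi]; apply/(integrable_gamma1 _ _).1 => //.
exact: measurable_funX.
Qed.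

Lemma L2_gamma1_integrable (a : \bar R) (f : R -> R) (q : R) : (q%:E < a)%E ->
  L2 g1 (oitv (- a) a) f -> leb.-integrable `[- q, q] (EFin \o f).
Proof.
move=> qa fL; have mI := measurable_oitv (- a) a; have [mf _] := fL.
apply: sq_integrable.
  by apply: measurable_funS mf => //; exact: sub_oitv.
apply: integrableS (L2_gamma1_sqw mI fL) => //; exact: sub_oitv.
Qed.

Lemma derive_of (f : R -> R) (x d : R) : is_derive x (1 : R) f d -> 'D_1 f x = d.
Proof. by case. Qed.

(** The constants obtained on an exhausting sequence of intervals agree, since
    all of them are read off at one point of the smallest interval. *)
Lemma weak_deriv1_prim0 (a : \bar R) (z g : R -> R) : (0 < a)%E ->
  H1_dim1 (oitv (- a) a) z g ->
  exists C, {ae leb, forall x, oitv (- a) a x -> z x = C + prim0 g x}.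
Proof.
move=> a0 [zL gL zg].
have [q [q0a q0n qx]] := exhaustion a0.
have H n : exists C, {ae leb, forall x, - q n < x < q n -> z x = C + prim0 g x}.
  have [qn0 qna] := q0a n; have qq : - q n < q n by lra.
  have [N mN] := mass_neq0 qq.
  apply: (@weak_deriv_prim0 _ _ _ _ N) => //.
  - exact: (L2_gamma1_integrable qna zL).
  - exact: (L2_gamma1_integrable qna gL).
  move=> r m rq; set t := bal_bump _ _ _ _ _.
  have tt : test_function `]- q n, q n[ t by exact: bal_bump_test.
  have t0 : \int[leb]_(x in `]- q n, q n[) t x = 0 by exact: integral_bal_bump.
  have tp := prim_test qq tt t0.
  have sub : `]- q n, q n[ `<=` oitv (- a) a.
    by apply: subset_trans (sub_oitv qna); exact: subset_itv_oo_cc.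
  have tp' : test_function (oitv (- a) a) (prim (- q n) t).
    by case: tp => ? ? S; split=> //; exact: subset_trans S sub.
  have := zg _ tp'.
  have out f (x : R) : test_function `]- q n, q n[ f -> ~ `]- q n, q n[%classic x -> f x = 0.
    by move=> tf nx; have [] := test_out_dom (1 : R) tf nx.
  rewrite (_ : (fun x => z x * _) = fun x => z x * t x); last first.
    by apply/funext => x; congr (_ * _); apply: derive_of; exact: (is_derive_prim qq tt t0).
  rewrite -(@Rintegral_sub_set _ _ _ leb (oitv (- a) a) `]- q n, q n[ (fun x => z x * t x))//.
    rewrite -(@Rintegral_sub_set _ _ _ leb (oitv (- a) a) `]- q n, q n[
      (fun x => g x * prim (- q n) t x))//.
    by move=> x _ nx; rewrite /= (out _ _ tp nx) mulr0.
  by move=> x _ nx; rewrite /= (out _ _ tt nx) mulr0.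
have [Cn HC] := choice H.
have HA := ae_foralln HC.
have [q00 q0a0] := q0a 0%N.
have [x0 /andP[x01 x02] Hx0] := ae_exists q00 HA.
(* A point x0 of the smallest interval at which all the representations hold
   fixes the common constant. *)
exists (z x0 - prim0 g x0).
apply: (ae_mono _ HA) => x Hx /oitvP /qx[n]; rewrite ltr_norml => xn.
rewrite (Hx n)// (Hx0 n) ?addrK//.
by have := q0n n => h; apply/andP; split; lra.
Qed.

Variables (a : \bar R) (mu : R) (h v : R -> R).
Hypothesis a0 : (0 < a)%E.
Hypothesis gs : ground_state a mu h v.
Let I := oitv (- a) a.

(** The Hardy inequality on each half of the interval, the left one after
    reflection. *)
Lemma poincare1D (z g : R -> R) (C : R) :
  measurable_fun (I : set mR) z -> measurable_fun (I : set mR) g ->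
  (forall q, (q%:E < a)%E -> leb.-integrable `[- q, q] (EFin \o g)) ->
  {ae leb, forall x, I x -> z x = C + prim0 g x} ->
  (mu%:E * \int[leb]_(x in I) ((z x - C) ^+ 2 * w x)%:E <=
   \int[leb]_(x in I) (g x ^+ 2 * w x)%:E)%E.
Proof.
move=> mz mg gi H; have mI : measurable (I : set mR) := measurable_oitv (- a) a.
pose k := (fun x => z x - C) \_ I; pose G := g \_ I.
have mk : measurable_fun (setT : set mR) k.
  by apply/(measurable_restrictT _ _).1 => //; exact: measurable_funB.
have mG : measurable_fun (setT : set mR) G by apply/(measurable_restrictT _ _).1.
have mopp : measurable_fun (setT : set mR) (-%R : mR -> mR) by exact: oppr_measurable.
have mkw (u : R -> R) : measurable_fun (setT : set mR) u ->
    measurable_fun (setT : set mR) (fun x => (u x ^+ 2 * w x)%:E).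
  move=> mu'; apply/measurable_EFinP; apply: measurable_funM; last exact: measurable_w.
  by apply: measurable_funX.
have EI (u : R -> R) : measurable_fun (setT : set mR) (u \_ I) -> (\int[leb]_(x in I) (u x ^+ 2 * w x)%:E =
    \int[leb]_(x in right_tail a 0) ((u \_ I) x ^+ 2 * w x)%:E +
    \int[leb]_(x in right_tail a 0) ((u \_ I) (- x)%R ^+ 2 * w x)%:E)%E.
  move=> mu'.
  transitivity (\int[leb]_(x in right_tail a 0) ((u \_ I) x ^+ 2 * w x)%:E +
    \int[leb]_(x in right_tail a 0) ((u \_ I) (- x)%R ^+ 2 * w (- x)%R)%:E)%E; last first.
    by congr (_ + _)%E; apply: eq_integral => x _; rewrite wN.
  rewrite -(@even_split R a (fun x => ((u \_ I) x ^+ 2 * w x)%:E)); last 2 first.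
  - exact: mkw.
  - by move=> x; rewrite lee_fin mulr_ge0 ?sqr_ge0 ?w_ge0.
  by apply: eq_integral => x xI; rewrite patchE xI.
rewrite (EI (fun x => z x - C) mk) (EI g mG) -/k -/G.
rewrite ge0_muleDr; last 2 first.
- by apply: integral_ge0 => x _; rewrite lee_fin mulr_ge0 ?sqr_ge0 ?w_ge0.
- by apply: integral_ge0 => x _; rewrite lee_fin mulr_ge0 ?sqr_ge0 ?w_ge0.
have HR (x : R) : (I x -> z x = C + prim0 g x) -> 0 < x -> (x%:E < a)%E ->
    (`|k x|%:E <= \int[leb]_(t in `]0%R, x[) `|G t|%:E)%E.
  move=> Hx x0 xa; have Ix : I x by apply/oitvP; rewrite gtr0_norm.
  rewrite /k patchE mem_set// Hx// addrC addKr.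
  apply: le_trans (prim0_bound x0 (lexx x) (gi x xa)) _.
  rewrite le_eqVlt; apply/orP; left; apply/eqP; apply: eq_integral => t.
  rewrite inE/= in_itv/= => /andP[t0 tx]; rewrite /G patchE mem_set//.
  by apply/oitvP; rewrite gtr0_norm//; apply: lt_trans xa; rewrite lte_fin.
have HL (x : R) : (I (- x) -> z (- x) = C + prim0 g (- x)) -> 0 < x -> (x%:E < a)%E ->
    (`|k (- x)|%:E <= \int[leb]_(t in `]0%R, x[) `|G (- t)|%:E)%E.
  move=> Hx x0 xa; have Ix : I (- x) by apply/oitvP; rewrite normrN gtr0_norm.
  rewrite /k patchE mem_set// Hx// addrC addKr.
  rewrite (prim0_opp x0 (lexx x) (gi x xa)) normrN.
  apply: le_trans (prim0_bound x0 (lexx x) (integrable_opp (gi x xa))) _.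
  rewrite le_eqVlt; apply/orP; left; apply/eqP; apply: eq_integral => t.
  rewrite inE/= in_itv/= => /andP[t0 tx]; rewrite /G patchE mem_set//.
  by apply/oitvP; rewrite normrN gtr0_norm//; apply: lt_trans xa; rewrite lte_fin.
apply: leeD.
- apply: (hardy_ineq gs mk mG).
  by apply: (ae_mono _ H) => x; exact: HR.
- apply: (hardy_ineq gs (k := fun x => k (- x)) (g := fun x => G (- x))).
  + exact: (measurableT_comp mk).
  + exact: (measurableT_comp mG).
  by apply: (ae_mono _ (ae_opp H)) => x; exact: HL.
Qed.

End OneDimension.

Section LowerBound1D.
Context {R : realType}.
Notation leb := (@lebesgue_measure R).
Notation mR := (measurableTypeR R).
Notation g1 := (@gamma1 R).

Lemma L2_gamma1_fine (D : set mR) (f : R -> R) : measurable D -> L2 g1 D f ->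
  (\int[leb]_(x in D) (f x ^+ 2 * w x)%:E)%E = (\int[g1]_(x in D) (f x ^+ 2))%:E.
Proof.
move=> mD fL; have [mf fi] := fL.
have mf2 : measurable_fun D (fun x => (f x ^+ 2)%:E).
  by apply/measurable_EFinP; exact: measurable_funX.
rewrite /Rintegral ge0_integral_gamma1// ?fineK//; last first.
  by move=> x _; rewrite lee_fin sqr_ge0.
have := L2_gamma1_sqw mD fL.
move=> /(integrable_fin_num mD); under eq_integral do rewrite /= EFinM.
by [].
Qed.

Variables (a : \bar R) (mu : R) (h v : R -> R).
Hypothesis a0 : (0 < a)%E.
Hypothesis gs : ground_state a mu h v.
Let I := oitv (- a) a.

Lemma gamma1_cst_integrable (D : set mR) (c : R) : measurable D -> g1.-integrable D (EFin \o (fun=> c)).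
Proof. by move=> mD; apply: finite_measure_integrable_cst. Qed.

Lemma L2_integrable (D : set mR) (f : R -> R) : measurable D -> L2 g1 D f ->
  g1.-integrable D (EFin \o f).
Proof.
move=> mD [mf fi].
apply: (@le_integrable _ mR R g1 D mD (EFin \o f) (EFin \o (fun x => 1 + f x ^+ 2))).
- by apply/measurable_EFinP.
- move=> x _; rewrite lee_fin [leRHS]ger0_norm; last by rewrite addr_ge0// sqr_ge0.
  rewrite -[f x ^+ 2]real_normK ?num_real//.
  by have := normr_ge0 (f x); move: (`|f x|) => u u0; nra.
- rewrite (_ : EFin \o _ = (EFin \o (fun=> 1%R)) \+ (fun x => (f x ^+ 2)%:E))%E//.
  by apply: integrableD => //; exact: gamma1_cst_integrable.
Qed.

(** A function of mean 0 has its smallest distance to constants at 0, so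
    replacing z by z - C in the Poincare inequality only helps. *)
Lemma mu1_lower_bound : (mu%:E <= mu1 (- a) a)%E.
Proof.
apply: le_ereal_inf_tmp => _ [z [g [zH zn0 z0 ->]]].
have mI : measurable (I : set mR) := measurable_oitv (- a) a.
have [zL gL _] := zH; have [mz zi] := zL; have [mg gi] := gL.
have [C HC] := weak_deriv1_prim0 a0 zH.
have P := poincare1D gs mz mg (fun q qa => L2_gamma1_integrable qa gL) HC.
have zi1 := L2_integrable mI zL.
have ci (c : R) := gamma1_cst_integrable c mI.
have zCL : L2 g1 I (fun x => z x - C).
  split; first exact: measurable_funB.
  rewrite (_ : (fun x => _) = (fun x => (z x ^+ 2)%:E) \+ (fun x => ((- 2 * C) * z x + C ^+ 2)%R%:E))%E.
    apply: integrableD => //.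
    rewrite (_ : (fun x => _) = (fun x => (- 2 * C)%R%:E * (z x)%:E) \+ (EFin \o (fun=> C ^+ 2)%R))%E.
      by apply: integrableD => //; exact: integrableZl.
    by apply/funext => x; rewrite /= -EFinM -EFinD.
  by apply/funext => x; rewrite /= -EFinD; congr EFin; ring.
rewrite (L2_gamma1_fine mI zCL) (L2_gamma1_fine mI gL) -EFinM lee_fin in P.
set Z := \int[g1]_(x in _) (z x ^+ 2).
have ZC : Z <= \int[g1]_(x in I) ((z x - C) ^+ 2).
  have -> : \int[g1]_(x in I) ((z x - C) ^+ 2) = Z + C ^+ 2 * fine (g1 I).
    transitivity (\int[g1]_(x in I) (z x ^+ 2 + ((- 2 * C) * z x + C ^+ 2))).
      by apply: eq_Rintegral => x _; ring.
    have i2 : g1.-integrable I (EFin \o (fun x => - 2 * C * z x)).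
      by under [X in _.-integrable _ X]eq_fun do rewrite /= EFinM; exact: integrableZl.
    rewrite RintegralD//; last first.
      rewrite (_ : EFin \o _ = (EFin \o (fun x => - 2 * C * z x)%R) \+ (EFin \o (fun=> C ^+ 2)%R))%E//.
      exact: integrableD.
    by rewrite RintegralD// RintegralZl// z0 mulr0 add0r Rintegral_cst.
  by rewrite lerDl mulr_ge0 ?sqr_ge0// fine_ge0.
have Z0 : 0 < Z := Rintegral_sq_gt0 mI zi zn0.
have mu0 := gs_mu gs.
rewrite lee_fin ler_pdivlMr//; apply: le_trans P.
by rewrite ler_pM2l.
Qed.

End LowerBound1D.

(** * The ground state as an eigenfunction *)

Section GroundStateIdentity.
Context {R : realType}.
Notation leb := (@lebesgue_measure R).
Notation mR := (measurableTypeR R).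
Notation g1 := (@gamma1 R).

Lemma integrableT_opp (G : R -> R) : leb.-integrable setT (EFin \o G) ->
  leb.-integrable setT (EFin \o (fun x => G (- x))).
Proof.
move=> /integrableP[mG Gi].
have mo : measurable_fun (setT : set mR) (-%R : mR -> mR) by exact: oppr_measurable.
have mG' : measurable_fun (setT : set mR) G by apply/measurable_EFinP.
apply/integrableP; split; first by apply/measurable_EFinP; apply: (measurableT_comp mG').
rewrite (@ge0_integral_opp _ (fun x => `|(G x)%:E|%E))//.
exact: measurableT_comp.
Qed.

Lemma Rintegral_oppT (G : R -> R) : leb.-integrable setT (EFin \o G) ->
  \int[leb]_x G (- x) = \int[leb]_x G x.
Proof.
move=> /integrableP[mG Gi].
by rewrite /Rintegral -[in RHS](integral_opp mG).
Qed.

Lemma Rintegral_even_split (a : \bar R) (F : R -> R) :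
  leb.-integrable (oitv (- a) a) (EFin \o F) ->
  \int[leb]_(x in oitv (- a) a) F x = \int[leb]_(x in right_tail a 0) (F x + F (- x)).
Proof.
move=> Fi; have mI := measurable_oitv (- a) a.
pose G := F \_ (oitv (- a) a).
have Gi : leb.-integrable setT (EFin \o G) by exact: integrable_patch.
have GNi := integrableT_opp Gi.
have GiD (D : set mR) : measurable D -> leb.-integrable D (EFin \o G).
  by move=> mD; exact: integrableS Gi.
have GNiD (D : set mR) : measurable D -> leb.-integrable D (EFin \o (fun x => G (- x))).
  by move=> mD; exact: integrableS GNi.
have mRT := measurable_right_tail a 0.
transitivity (\int[leb]_(x in right_tail a 0) (G x + G (- x))); last first.
  apply: eq_Rintegral => x; rewrite inE => /right_tailP[x0 Ix].
  by rewrite /G !patchE !mem_set//; apply/oitv_sym.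
rewrite RintegralD//; [|exact: GiD|exact: GNiD].
rewrite Rintegral_mkcond -/G.
rewrite -(setUv `]0, +oo[%classic) Rintegral_setU//=; last 3 first.
- exact: measurableC.
- by rewrite setUv.
- exact/disj_setPCl.
congr (_ + _).
  rewrite Rintegral_mkcond [RHS]Rintegral_mkcond; apply: eq_Rintegral => x _.
  rewrite !patchE mem_setE in_itv/= andbT /G patchE.
  have [x0|x0] := ltP 0 x.
    have [xI|xI] := boolP (x \in oitv (- a) a).
      by rewrite mem_set//; apply/right_tailP; split=> //; exact: set_mem.
    by rewrite memNset// => /right_tailP[_ /mem_set]; rewrite (negbTE xI).
  by rewrite memNset// => /right_tailP[]; rewrite ltNge x0.
rewrite setCitvr -Rintegral_itv_bndo_bndc ?GiD// Rintegral_mkcond.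
rewrite -Rintegral_oppT; last by apply: integrable_patch => //; exact: GiD.
rewrite [RHS]Rintegral_mkcond; apply: eq_Rintegral => x _.
rewrite !patchE mem_setE in_itv/= oppr_lt0 /G patchE.
have [x0|x0] := ltP 0 x.
  have [xI|xI] := boolP (- x \in oitv (- a) a).
    rewrite mem_set//; apply/right_tailP; split=> //; apply/oitv_sym; exact: set_mem.
  by rewrite memNset// => /right_tailP[_ /oitv_sym/mem_set]; rewrite (negbTE xI).
by rewrite memNset// => /right_tailP[]; rewrite ltNge x0.
Qed.

(** The product v f vanishes at the ends of a large interval. *)
Lemma ibp_compact (v h f df : R -> R) (r : R) :
  (forall x, is_derive x (1 : R) v (h x)) -> continuous h ->
  (forall x, is_derive x (1 : R) f (df x)) -> continuous df ->
  0 < r -> (forall x, r < `|x| -> f x = 0 /\ df x = 0) ->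
  \int[leb]_x (v x * df x) = - \int[leb]_x (h x * f x).
Proof.
move=> Dv ch Df cdf r0 fr; have cv := continuous_is_derive Dv; have cf := continuous_is_derive Df.
pose s := r + 1; have ss : - s < s by rewrite /s; lra.
have cint (k : R -> R) : continuous k -> leb.-integrable `[- s, s] (EFin \o k).
  move=> ck; apply: continuous_compact_integrable; first exact: segment_compact.
  exact: continuous_subspaceT.
have out (x : R) : ~ `[- s, s]%classic x -> f x = 0 /\ df x = 0.
  move=> xs; apply: fr; rewrite ltNge; apply: contra_notN xs => xr.
  by rewrite /= in_itv/= -ler_norml (le_trans xr)// lerDl.
have c1 : continuous (fun x => v x * df x).
  by move=> x; apply: cvgM; [exact: cv|exact: cdf].
have c2 : continuous (fun x => h x * f x).
  by move=> x; apply: cvgM; [exact: ch|exact: cf].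
rewrite -(@Rintegral_sub_set _ _ _ leb setT `[- s, s])//; last first.
  by move=> x _ /out[_ ->]; rewrite mulr0.
rewrite -(@Rintegral_sub_set _ _ _ leb setT `[- s, s] (fun x => h x * f x))//; last first.
  by move=> x _ /out[-> _]; rewrite mulr0.
apply/eqP; rewrite -addr_eq0 -RintegralD//; [|exact: cint|exact: cint].
pose F x := v x * f x.
have DF (x : R) : is_derive x (1 : R) F (v x * df x + h x * f x).
  have Hv := Dv x; have Hf := Df x.
  by rewrite /F; apply: is_derive_eq; rewrite /GRing.scale/=; ring.
have cF := continuous_is_derive DF.
rewrite /Rintegral (@continuous_FTC2 _ _ F (- s) s ss).
- rewrite /F; have [-> _] : f s = 0 /\ df s = 0.
    by apply: fr; rewrite ger0_norm /s; lra.
  have [-> _] : f (- s) = 0 /\ df (- s) = 0.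
    by apply: fr; rewrite normrN ger0_norm /s; lra.
  by rewrite !mulr0 subee.
- apply: continuous_subspaceT => x; apply: cvgD; [exact: c1|exact: c2].
- split; first by move=> y _; case: (DF y).
    by apply: cvg_at_right_filter; exact: cF.
  by apply: cvg_at_left_filter; exact: cF.
- by move=> y _; rewrite derive1E; case: (DF y).
Qed.

End GroundStateIdentity.

Section GroundStateDuality.
Context {R : realType}.
Notation leb := (@lebesgue_measure R).
Notation mR := (measurableTypeR R).
Notation g1 := (@gamma1 R).
Variables (a : \bar R) (mu : R) (h v : R -> R).
Hypothesis a0 : (0 < a)%E.
Hypothesis gs : ground_state a mu h v.
Let I := oitv (- a) a.
Let RT := right_tail a 0.
Let mI : measurable (I : set mR) := measurable_oitv (- a) a.
Let mRT : measurable (RT : set mR) := measurable_right_tail a 0.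

Lemma w_integrable (D : set mR) : measurable D -> leb.-integrable D (EFin \o w).
Proof. by move=> mD; apply: (integrableS measurableT) => //; exact: integrable_normal_pdf. Qed.

Lemma sqw_ge0 (x y : R) : 0 <= x ^+ 2 * w y.
Proof. exact: mulr_ge0 (sqr_ge0 x) (w_ge0 y). Qed.

Lemma gs_h_sqw : leb.-integrable I (EFin \o (fun x => h x ^+ 2 * w x)).
Proof.
have [M hM] := gs_bdd gs.
apply: (@le_integrable _ mR R leb I mI _ (EFin \o (fun x => M ^+ 2 * w x))).
- apply/measurable_EFinP; apply: measurable_funM; last exact: measurable_w.
  apply: measurable_funX; exact: (measurable_h gs).
- move=> x Ix; rewrite lee_fin !(ger0_norm (sqw_ge0 _ _)).
  rewrite ler_wpM2r ?w_ge0//; have h0 := ltW (gs_pos gs Ix).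
  by rewrite lerXn2r ?nnegrE ?hM// (le_trans h0)// hM.
- exact: (integrableZl mI (M ^+ 2) (w_integrable mI)).
Qed.

Lemma RT_sub : RT `<=` I.
Proof. by move=> x /right_tailP[]. Qed.

(** Square integrability of v is itself an instance of the Hardy inequality,
    since v is the integral of the bounded function h. *)
Lemma gs_v_sqw : leb.-integrable I (EFin \o (fun x => v x ^+ 2 * w x)).
Proof.
have mvw (D : set mR) : measurable_fun D (fun x => (v x ^+ 2 * w x)%:E).
  apply/measurable_EFinP; apply: measurable_funM; last exact: measurable_w.
  apply: measurable_funX; exact: (measurable_v gs).
have vw0 x : (0 <= (v x ^+ 2 * w x)%:E)%E by rewrite lee_fin sqw_ge0.
apply/integrableP; split; first exact: mvw.
under eq_integral do rewrite (gee0_abs (vw0 _)).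
rewrite (@even_split R a (fun x => (v x ^+ 2 * w x)%:E) (mvw setT) vw0).
have -> : (\int[leb]_(x in right_tail a 0) (v (- x)%R ^+ 2 * w (- x)%R)%:E =
    \int[leb]_(x in right_tail a 0) (v x ^+ 2 * w x)%:E)%E.
  by apply: eq_integral => x _; rewrite (gs_odd gs) sqrrN wN.
have S := hardy_ineq gs (@measurable_v _ _ _ _ _ gs setT) (@measurable_h _ _ _ _ _ gs setT).
have {S} := S _.
move=> /(_ _)/wrap[].
  apply: aeW => x x0 xa; rewrite ger0_norm; last exact: (gs_v_ge0 gs (ltW x0) xa).
  rewrite -(gs_integral_h gs (ltW x0)); apply: ge0_le_integral => //.
  - move=> t /=; rewrite in_itv/= lee_fin => /andP[t0 tx].
    by rewrite ltW// (gs_posI gs) ?ltW//; apply: lt_trans xa; rewrite lte_fin.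
  - by apply/measurable_EFinP; exact: (measurable_h gs).
  - by apply/measurable_EFinP; apply: measurableT_comp => //; exact: (measurable_h gs).
  - by move=> t _; rewrite lee_fin ler_norm.
move=> S; have fin : (\int[leb]_(x in RT) (h x ^+ 2 * w x)%:E < +oo)%E.
  have /(integrableS mI mRT RT_sub)/integrableP[_] := gs_h_sqw.
  by under eq_integral do rewrite gee0_abs ?lee_fin ?sqw_ge0//.
have : (mu%:E * \int[leb]_(x in RT) (v x ^+ 2 * w x)%:E < +oo)%E by exact: le_lt_trans fin.
have mu0 := gs_mu gs.
have i0 : (0 <= \int[leb]_(x in RT) (v x ^+ 2 * w x)%:E)%E by exact: integral_ge0.
move=> H; rewrite -/RT.
have : (\int[leb]_(x in RT) (v x ^+ 2 * w x)%:E < +oo)%E.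
  rewrite ltey; apply/eqP => E.
  by move: H; rewrite E gt0_muley ?lte_fin// ltxx.
by move=> K; rewrite lte_add_pinfty.
Qed.

Lemma sqw_integrableM (D : set mR) (f g : R -> R) : measurable D ->
  measurable_fun D f -> measurable_fun D g ->
  leb.-integrable D (EFin \o (fun x => f x ^+ 2 * w x)) ->
  leb.-integrable D (EFin \o (fun x => g x ^+ 2 * w x)) ->
  leb.-integrable D (EFin \o (fun x => f x * g x * w x)).
Proof.
move=> mD mf mg fi gi.
have L (k : R -> R) : measurable_fun D k ->
    leb.-integrable D (EFin \o (fun x => k x ^+ 2 * w x)) -> L2 g1 D k.
  by move=> mk ki; split=> //; apply: (integrable_gamma1 mD (measurable_funX 2 mk)).2.
exact: (integrable_gamma1 mD (measurable_funM mf mg)).1 (L2_mul mD (L f mf fi) (L g mg gi)).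
Qed.

Lemma prim0_diff (g : R -> R) (x : R) : 0 < x -> leb.-integrable `[- x, x] (EFin \o g) ->
  prim0 g x - prim0 g (- x) = \int[leb]_(t in `]0, x[) (g t + g (- t)).
Proof.
move=> x0 gi; rewrite (prim0_opp x0 (lexx x) gi) opprK /prim0 (ltW x0).
have sub (k : R -> R) : leb.-integrable `[- x, x] (EFin \o k) ->
    leb.-integrable `]0, x[ (EFin \o k).
  by move=> ki; apply: integrableS ki => //; apply: subset_itv; rewrite bnd_simp//; lra.
have i1 := sub _ gi; have i2 := sub _ (integrable_opp gi).
by rewrite -!Rintegral_itv_bndo_bndc// RintegralD.
Qed.

Lemma integrable_RT (F : R -> R) : leb.-integrable I (EFin \o F) ->
  leb.-integrable RT (EFin \o F) /\ leb.-integrable RT (EFin \o (fun x => F (- x))).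
Proof.
move=> Fi; split; first exact: (integrableS mI mRT RT_sub Fi).
have := integrableT_opp (integrable_patch mI Fi).
move=> /(integrableS measurableT mRT (@subsetT _ _)).
apply: eq_integrable => // x /set_mem/right_tailP[x0 Ix].
by rewrite /= patchE mem_set//; apply/oitv_sym.
Qed.

(** The weak form of the ground state equation, tested with an arbitrary function
    phi of weak derivative psi.  The tail identity turns w h into an integral of
    v w, and exchanging the integrals over t < x turns psi into an increment of
    phi.  Since h is even and v is odd, the integrals fold onto the right half and
    only phi(x) - phi(-x) enters. *)
Lemma gs_duality (phi psi : R -> R) :
  measurable_fun (I : set mR) phi -> measurable_fun (I : set mR) psi ->
  leb.-integrable I (EFin \o (fun x => phi x ^+ 2 * w x)) ->
  leb.-integrable I (EFin \o (fun x => psi x ^+ 2 * w x)) ->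
  {ae leb, forall x, 0 < x -> (x%:E < a)%E ->
     phi x - phi (- x) = \int[leb]_(t in `]0, x[) (psi t + psi (- t))} ->
  \int[leb]_(x in I) (h x * psi x * w x) = mu * \int[leb]_(x in I) (v x * phi x * w x).
Proof.
move=> mphi mpsi phii psii H.
have mh D := @measurable_h _ _ _ _ _ gs D; have mv D := @measurable_v _ _ _ _ _ gs D.
have hpi := sqw_integrableM mI (mh _) mpsi gs_h_sqw psii.
have vpi := sqw_integrableM mI (mv _) mphi gs_v_sqw phii.
rewrite (Rintegral_even_split hpi) (Rintegral_even_split vpi) -/RT.
pose Psi t := psi t + psi (- t).
pose phiT := phi \_ I; pose psiT := psi \_ I.
have mphiT : measurable_fun (setT : set mR) phiT by apply/(measurable_restrictT _ _).1.
have mpsiT : measurable_fun (setT : set mR) psiT by apply/(measurable_restrictT _ _).1.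
have mo : measurable_fun (setT : set mR) (-%R : mR -> mR) by exact: oppr_measurable.
have inI (x : R) : RT x -> I x /\ I (- x).
  by move=> /right_tailP[_ Ix]; split=> //; apply/oitv_sym.
pose A x := v x * w x * \1_RT x.
pose B t := (psiT t + psiT (- t)) * \1_RT t.
have BE t : RT t -> B t = Psi t.
  move=> Rt; have [It INt] := inI t Rt.
  by rewrite /B indicE mem_set// mulr1 /psiT !patchE !mem_set.
have AE t : RT t -> A t = v t * w t by move=> Rt; rewrite /A indicE mem_set// mulr1.
have A0' t : ~ RT t -> A t = 0 by move=> Rt; rewrite /A indicE memNset// mulr0.
have B0' t : ~ RT t -> B t = 0 by move=> Rt; rewrite /B indicE memNset// mulr0.
have mind : measurable_fun (setT : set mR) (\1_RT : mR -> R) := measurable_indic mRT.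
have mA : measurable_fun (setT : set mR) A.
  by apply: measurable_funM => //; apply: measurable_funM; [exact: mv|exact: measurable_w].
have mB : measurable_fun (setT : set mR) B.
  apply: measurable_funM => //; apply: measurable_funD => //.
  exact: (measurableT_comp mpsiT).
have Age0 t : 0 <= A t.
  have [Rt|Rt] := pselect (RT t); last by rewrite A0'.
  rewrite AE// mulr_ge0 ?w_ge0//; case: Rt => t0 ta.
  exact: (gs_v_ge0 gs (ltW t0) ta).
have mu0 := gs_mu gs.
have tailE t : RT t -> (\int[leb]_(x in `]t, +oo[) (A x)%:E = (w t * h t / mu)%:E)%E.
  move=> [t0 ta]; rewrite -(gs_tail gs (ltW t0) ta).
  rewrite integral_mkcond [RHS]integral_mkcond; apply: eq_integral => x _.
  rewrite !patchE !mem_setE !in_itv/= andbT.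
  have [tx|tx] := ltP t x; last first.
    by rewrite memNset// /right_tail/= => -[]; rewrite ltNge tx.
  have [xa|xa] := ltP (x%:E) a.
    by rewrite !mem_set ?AE//; split=> //; apply: lt_trans tx.
  by rewrite !memNset ?A0'// => -[_]; rewrite ltNge xa.
(* Both sides of the claim are mu times an iterated integral of F. *)
pose F (z : mR * mR) := A z.1 * B z.2 * \1_(@lower_triangle R) z.
have mF : measurable_fun (setT : set (mR * mR)) F.
  apply: measurable_funM; last exact: measurable_indic (@measurable_lower_triangle R).
  by apply: measurable_funM; apply: measurableT_comp.
have hPsi : leb.-integrable RT (EFin \o (fun t => h t * Psi t * w t)).
  have [i1 i2] := integrable_RT hpi.
  rewrite (_ : EFin \o _ = (EFin \o (fun x => h x * psi x * w x)%R) \+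
    (EFin \o (fun x => h (- x) * psi (- x) * w (- x))%R))%E; first exact: integrableD.
  by apply/funext => t; rewrite /= -EFinD (gs_even gs) wN /Psi; congr EFin; ring.
have FI : (leb \x leb)%E.-integrable setT (EFin \o F).
  apply/integrable12ltyP; first by apply/measurable_EFinP.
  have mB' : measurable_fun (setT : set mR) (fun t => `|B t|).
    exact: measurableT_comp.
  have [_ T] := tonelli_triangle mA mB' Age0 (fun t => normr_ge0 (B t)).
  rewrite (_ : integral _ _ _ = \int[leb]_x ((A x)%:E * \int[leb]_(t in `]-oo, x[) (`|B t|)%:E))%E; last first.
    apply: eq_integral => x _; rewrite (triangle_slice x mB' Age0 (fun t => normr_ge0 (B t))).
    apply: eq_integral => t _; rewrite /F /= (normrM (A x * B t)) (normrM (A x)) (ger0_norm (Age0 x)).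
    by rewrite [X in _ * X]ger0_norm// indicE.
  rewrite T.
  have /integrableP[_] := integrableZl mRT mu^-1 hPsi.
  apply: le_lt_trans; rewrite [leRHS]integral_mkcond le_eqVlt; apply/orP; left; apply/eqP.
  apply: eq_integral => t _; rewrite patchE; case: ifPn => [/set_mem Rt|/negP nRt].
    rewrite (tailE t Rt) (BE t Rt) -EFinM /=; congr EFin.
    have h0 : 0 < h t by apply: (gs_pos gs); exact: (inI t Rt).1.
    rewrite !normrM (ger0_norm (w_ge0 t)) (gtr0_norm h0) normfV (gtr0_norm mu0).
    by ring.
  by rewrite B0' ?normr0 ?mul0e// => Rt; apply: nRt; exact: mem_set.
have F0A x t : ~ RT x -> F (x, t) = 0 by move=> nR; rewrite /F/= A0'// !mul0r.
have F0B x t : ~ RT t -> F (x, t) = 0 by move=> nR; rewrite /F/= B0'// mulr0 mul0r.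
have iPsi x : RT x -> leb.-integrable `]0, x[ (EFin \o Psi).
  move=> [x0 xa]; have i1 : leb.-integrable `[- x, x] (EFin \o psi).
    apply: sq_integrable; first by apply: measurable_funS mpsi => //; exact: sub_oitv.
    by apply: (integrableS mI _ (sub_oitv xa) psii).
  have S : `]0, x[ `<=` `[- x, x] by apply: subset_itv; rewrite bnd_simp//; lra.
  rewrite (_ : EFin \o _ = (EFin \o psi) \+ (EFin \o (fun t => psi (- t)%R)))%E//.
  apply: integrableD => //; first exact: integrableS i1.
  exact: integrableS (integrable_opp i1).
have patchB x : RT x -> B \_ `]-oo, x[ = Psi \_ `]0, x[.
  move=> [x0 xa]; apply/funext => t; rewrite !patchE !mem_setE !in_itv/=.
  have [tx|] := ltP t x; last by rewrite andbF.
  rewrite andbT; case: ltP => t0.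
    by rewrite BE//; split=> //; apply: lt_trans xa; rewrite lte_fin.
  by rewrite B0'// => -[]; rewrite ltNge t0.
have slice1 x : A x * \int[leb]_(t in `]-oo, x[) B t = \int[leb]_t F (x, t).
  have [Rx|nRx] := pselect (RT x); last first.
    rewrite A0'// mul0r -[LHS](Rintegral_set0 leb (fun=> 0)) Rintegral_mkcond.
    by apply: eq_Rintegral => t _; rewrite F0A// patchE; case: ifP.
  rewrite -RintegralZl//; last first.
    have := integrable_patch (measurable_itv _) (iPsi x Rx).
    rewrite -(patchB x Rx) -restrict_EFin.
    exact: (@integrable_mkcond _ mR R leb `]-oo, x[ (EFin \o B) (measurable_itv _)).2.
  rewrite Rintegral_mkcond; apply: eq_Rintegral => t _.
  rewrite patchE mem_setE in_itv/= /F lower_triangleE/=.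
  by case: ltP; rewrite ?mulr1 ?mulr0.
have slice2 t : RT t -> \int[leb]_x F (x, t) = B t * (w t * h t / mu).
  move=> Rt; have At : leb.-integrable `]t, +oo[ (EFin \o A).
    apply/integrableP; split; first by apply/measurable_EFinP; apply: measurable_funTS.
    under eq_integral do rewrite gee0_abs ?lee_fin//.
    by rewrite tailE// ltry.
  transitivity (B t * \int[leb]_(x in `]t, +oo[) A x); last first.
    by rewrite /Rintegral tailE.
  rewrite -RintegralZl// [RHS]Rintegral_mkcond; apply: eq_Rintegral => x _.
  rewrite patchE mem_setE in_itv/= andbT /F lower_triangleE/=.
  by case: ltP => _; rewrite ?mulr1 ?mulr0// mulrC.
have [FI1 E1] := integrable_Rintegral1 FI.
have [_ E2] := integrable_Rintegral2 FI.
transitivity (mu * \int[leb]_t \int[leb]_x F (x, t)).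
  rewrite (_ : \int[leb]_t _ = \int[leb]_(t in RT) (mu^-1 * (h t * Psi t * w t))); last first.
    rewrite [RHS]Rintegral_mkcond; apply: eq_Rintegral => t _; rewrite patchE.
    case: ifPn => [/set_mem Rt|/negP nRt].
      by rewrite slice2// BE//; ring.
    rewrite -[RHS](Rintegral_set0 leb (fun=> 0)) [RHS]Rintegral_mkcond.
    apply: eq_Rintegral => x _; rewrite F0B ?patchE; first by case: ifP.
    by move=> Rt; apply: nRt; exact: mem_set.
  rewrite RintegralZl// mulrA divff ?gt_eqF// mul1r.
  by apply: eq_Rintegral => t _; rewrite (gs_even gs) wN /Psi; ring.
congr (_ * _); rewrite E2 -E1.
rewrite [RHS]Rintegral_mkcond /Rintegral; congr fine.
apply: ae_eq_integral => //.
- exact: measurable_int FI1.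
- have [j1 j2] := integrable_RT vpi.
  have : leb.-integrable RT (EFin \o (fun x => v x * phi x * w x + v (- x) * phi (- x) * w (- x))).
    rewrite (_ : EFin \o _ = (EFin \o (fun x => v x * phi x * w x)%R) \+
      (EFin \o (fun x => v (- x) * phi (- x) * w (- x))%R))%E//.
    exact: integrableD.
  by move=> /(integrable_patch mRT)/measurable_int.
apply: (@filterS _ _ (ae_filter_ringOfSetsType leb) _ _ _ H).
have K (x : R) : (0 < x -> (x%:E < a)%E ->
    phi x - phi (- x) = \int[leb]_(t in `]0, x[) (psi t + psi (- t))) -> setT x ->
  (\int[leb]_t F (x, t))%:E =
   (((fun x => v x * phi x * w x + v (- x) * phi (- x) * w (- x)) \_ RT) x)%:E; last by move=> x; exact: (K x).
move=> Hx _; congr EFin; rewrite -slice1 patchE.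
case: ifPn => [/set_mem Rx|/negP nRx]; last first.
  by rewrite A0' ?mul0r// => Rx; apply: nRx; exact: mem_set.
have [x0 xa] := Rx.
rewrite AE// Rintegral_mkcond patchB// -Rintegral_mkcond -(Hx x0 xa).
by rewrite (gs_odd gs) wN; ring.
Qed.

End GroundStateDuality.

(** * The value of mu1 *)

Section MuOne.
Context {R : realType}.
Notation leb := (@lebesgue_measure R).
Notation mR := (measurableTypeR R).
Notation g1 := (@gamma1 R).
Variables (a : \bar R) (mu : R) (h v : R -> R).
Hypothesis a0 : (0 < a)%E.
Hypothesis gs : ground_state a mu h v.
Let I := oitv (- a) a.
Let mI : measurable (I : set mR) := measurable_oitv (- a) a.

Lemma gs_L2_v : L2 g1 I v.
Proof.
have mv : measurable_fun (I : set mR) v by exact: (measurable_v gs).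
split=> //; apply: ((integrable_gamma1 mI (measurable_funX 2 mv)).2 _).
exact: (gs_v_sqw gs).
Qed.

Lemma gs_L2_h : L2 g1 I h.
Proof.
have mh : measurable_fun (I : set mR) h by exact: (measurable_h gs).
split=> //; apply: ((integrable_gamma1 mI (measurable_funX 2 mh)).2 _).
exact: (gs_h_sqw gs).
Qed.

Lemma gs_weak_deriv1 : weak_deriv1 I v h.
Proof.
move=> phi tp; have [r r0 Hr] := test_bounded tp.
have out x : setT x -> ~ I x -> v x * 'D_1 phi x = 0.
  by move=> _ nI; have [_ ->] := test_out_dom (1 : R) tp nI; rewrite mulr0.
have out2 x : setT x -> ~ I x -> h x * phi x = 0.
  by move=> _ nI; have [-> _] := test_out_dom (1 : R) tp nI; rewrite mulr0.
rewrite (@Rintegral_sub_set _ _ _ leb setT I _ (@subsetT _ _) out).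
rewrite (@Rintegral_sub_set _ _ _ leb setT I _ (@subsetT _ _) out2).
apply: (@ibp_compact _ _ _ _ _ r) => //.
- exact: (gs_der gs).
- exact: (gs_cont gs).
- by move=> x; exact: (test_is_derive _ tp).
- exact: (test_continuous_derive tp).
- by move=> x rx; exact: Hr.
Qed.

Lemma gs_not_ae0 : ~ {ae g1, forall x, I x -> v x = 0}.
Proof.
move=> /ae_gamma1 H; have [q [q0a _ _]] := exhaustion a0.
have [q0 qa] := q0a 0%N.
have [x /andP[x0 xq] /(_ _)/wrap[]] := ae_exists q0 H.
  by apply: (sub_oitv qa); rewrite /= in_itv/=; apply/andP; split; lra.
by move=> vx; have := gs_v_gt0 gs x0 (lt_trans (_ : (x%:E < (q 0%N)%:E)%E) qa); rewrite vx ltxx lte_fin => /(_ xq).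
Qed.

(** [gs_duality] with phi = v. *)
Lemma gs_energy :
  \int[leb]_(x in I) (h x * h x * w x) = mu * \int[leb]_(x in I) (v x * v x * w x).
Proof.
apply: (gs_duality gs).
- exact: (measurable_v gs).
- exact: (measurable_h gs).
- exact: (gs_v_sqw gs).
- exact: (gs_h_sqw gs).
apply: aeW => x x0 xa; rewrite (gs_odd gs) opprK.
transitivity (\int[leb]_(t in `]0, x[) (2 * h t)); last first.
  by apply: eq_Rintegral => t _; rewrite (gs_even gs); ring.
have hc : leb.-integrable `[0, x] (EFin \o h).
  apply: continuous_compact_integrable; first exact: segment_compact.
  by apply: continuous_subspaceT; exact: (gs_cont gs).
have hi : leb.-integrable `]0, x[ (EFin \o h).
  by apply: integrableS hc => //; exact: subset_itv_oo_cc.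
rewrite RintegralZl//.
rewrite [X in _ * X](_ : _ = v x); first by ring.
by rewrite /Rintegral (gs_integral_h gs (ltW x0)).
Qed.

Lemma mu1_upper_bound : (mu1 (- a) a <= mu%:E)%E.
Proof.
apply: ereal_inf_lbound; exists v, h; split.
- by split; [exact: gs_L2_v|exact: gs_L2_h|exact: gs_weak_deriv1].
- exact: gs_not_ae0.
- rewrite Rintegral_gamma1//; last exact: (L2_integrable mI gs_L2_v).
  rewrite Rintegral_even_split; last first.
    have mv : measurable_fun (I : set mR) v by exact: (measurable_v gs).
    exact: ((integrable_gamma1 mI mv).1 (L2_integrable mI gs_L2_v)).
  under eq_Rintegral do rewrite (gs_odd gs) wN mulNr subrr.
  by rewrite Rintegral_cst ?mul0r//; exact: measurable_right_tail.
have [_ vi] := gs_L2_v; have [_ hi] := gs_L2_h.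
have v0 := Rintegral_sq_gt0 mI vi gs_not_ae0.
have -> : \int[g1]_(x in I) (h x ^+ 2) = mu * \int[g1]_(x in I) (v x ^+ 2).
  rewrite !Rintegral_gamma1//.
  by have := gs_energy; under eq_Rintegral do rewrite -expr2;
    under [in X in _ = _ * X]eq_Rintegral do rewrite -expr2.
by rewrite -mulrA divff ?mulr1// gt_eqF.
Qed.

Lemma mu1_eq : mu1 (- a) a = mu%:E.
Proof.
by apply/eqP; rewrite eq_le mu1_upper_bound (mu1_lower_bound a0 gs).
Qed.

End MuOne.

(** * Horizontal slices of a weak derivative on a box *)

Section BoxRepresentation.
Context {R : realType}.
Notation leb := (@lebesgue_measure R).
Notation mR := (measurableTypeR R).
Notation leb2' := (leb \x leb)%E.

(** Countably many null sets, indexed by the parameters of the bumps. *)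
Lemma ae_countable (Q : rat -> nat -> R -> Prop) :
  (forall r n, {ae leb, forall x, Q r n x}) -> {ae leb, forall x, forall r n, Q r n x}.
Proof.
move=> H.
have : {ae leb, forall x, forall m : nat, if unpickle m is Some (r, n) then Q r n x else True}.
  apply: ae_foralln => m; case: unpickle => [[r n]|]; first exact: H.
  by apply: aeW.
apply: (@filterS _ _ (ae_filter_ringOfSetsType leb)) => x Hx r n.
by have := Hx (pickle (r, n)); rewrite pickleK.
Qed.

Variables (q c d : R) (u g : R * R -> R).
Hypotheses (q0 : 0 < q) (cd : c < d).
Hypothesis ui : leb2'.-integrable setT (EFin \o (u : mR * mR -> R)).
Hypothesis gi : leb2'.-integrable setT (EFin \o (g : mR * mR -> R)).
Hypothesis weak : forall psi dpsi be : R -> R,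
  test_function `]- q, q[ psi -> test_function `]c, d[ be ->
  (forall x, is_derive x (1 : R) psi (dpsi x)) ->
  \int[leb2']_(z in (setT : set (mR * mR))) (u z * (dpsi z.1 * be z.2)) =
  - \int[leb2']_(z in (setT : set (mR * mR))) (g z * (psi z.1 * be z.2)).

Lemma continuous_bounded (f : R -> R) (r : R) : continuous f -> 0 < r ->
  (forall x, r < `|x| -> f x = 0) -> exists M, forall x, `|f x| <= M.
Proof.
move=> cf r0 fr.
have rr : - r <= r by lra.
have cn : {within `[- r, r], continuous (fun x => `|f x|)}.
  by apply: continuous_subspaceT => x; apply: cvg_norm; exact: cf.
have [x0 _ hx0] := EVT_max rr cn.
exists `|f x0| => x; have [xr|xr] := leP `|x| r.
  by apply: hx0; rewrite in_itv/= -ler_norml.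
by rewrite fr// normr0.
Qed.

Lemma test_sup (D : set R) (f : R -> R) : test_function D f -> exists M, forall x, `|f x| <= M.
Proof.
move=> tf; have [r r0 Hr] := test_bounded tf.
apply: (@continuous_bounded f r) => //.
  by case: tf => /(_ 0%N)[cf _] _ _ x; exact: cf.
by move=> x /(Hr x 0)[].
Qed.

Lemma measurable_test (D : set R) (f : R -> R) (A : set mR) : measurable A -> test_function D f ->
  measurable_fun A f.
Proof. by move=> mA [/(_ 0%N) cf _ _]; exact: measurable_Ck. Qed.

Lemma integrable_mul1 (f : mR * mR -> R) (k : R -> R) (D : set R) :
  leb2'.-integrable setT (EFin \o f) -> test_function D k ->
  leb2'.-integrable setT (EFin \o (fun z => f z * k z.1)).
Proof.
move=> fi tk; have [M kM] := test_sup tk.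
apply: (@integrable_mulb _ _ _ _ _ _ (fun z : mR * mR => k z.1) M) => //.
by apply: measurableT_comp => //; exact: (measurable_test _ tk).
Qed.

Lemma integrable_mul2 (f : mR * mR -> R) (k : R -> R) (D : set R) :
  leb2'.-integrable setT (EFin \o f) -> test_function D k ->
  leb2'.-integrable setT (EFin \o (fun z => f z * k z.2)).
Proof.
move=> fi tk; have [M kM] := test_sup tk.
apply: (@integrable_mulb _ _ _ _ _ _ (fun z : mR * mR => k z.2) M) => //.
by apply: measurableT_comp => //; exact: (measurable_test _ tk).
Qed.

(** Test with psi(x) beta(y): for fixed psi, the fundamental lemma in y removes
    beta. *)
Lemma ae_weak_section (psi dpsi : R -> R) (D : set R) :
  test_function `]- q, q[ psi -> test_function D dpsi ->
  (forall x, is_derive x (1 : R) psi (dpsi x)) ->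
  {ae leb, forall y, c < y < d ->
    \int[leb]_x (u (x, y) * dpsi x + g (x, y) * psi x) = 0}.
Proof.
move=> tp tdp dp.
pose G (z : mR * mR) := u z * dpsi z.1 + g z * psi z.1.
have i1 := integrable_mul1 ui tdp; have i2 := integrable_mul1 gi tp.
have iG : leb2'.-integrable setT (EFin \o G).
  rewrite (_ : EFin \o _ = (EFin \o (fun z => u z * dpsi z.1)%R) \+
     (EFin \o (fun z => g z * psi z.1)%R))%E//.
  exact: integrableD.
pose W y := \int[leb]_x G (x, y).
have [iW _] := integrable_Rintegral2 iG.
have H : {ae leb, forall y, y \in `]c, d[ -> W y = 0}.
  apply: ae0_bump => //; first exact: integrableS iW.
  move=> r n /andP[cr rd].
  have tb : test_function `]c, d[ (bump c (ratr r) n).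
    by apply: bump_test => //; apply: subset_itvl; rewrite bnd_simp ltW.
  set be := bump _ _ _ in tb *.
  rewrite (@Rintegral_sub_set _ _ _ leb setT)//; last first.
    move=> y _ ny; rewrite /be bump_out ?mulr0//; apply/negP => /andP[cy yr].
    by apply: ny; rewrite /= in_itv/= cy (lt_trans yr).
  have iGb := integrable_mul2 iG tb.
  have [iGb2 E] := integrable_Rintegral2 iGb.
  transitivity (\int[leb]_y \int[leb]_x (G (x, y) * be y)).
    apply: Rintegral_ae_eq => //.
      have [M bM] := test_sup tb.
      have mb : measurable_fun (setT : set mR) be by exact: (measurable_test _ tb).
      exact: (@integrable_mulb _ mR R leb setT W be M measurableT iW mb (fun x _ => bM x)).
    have H0 := ae_integrable2 iG.
    by apply: (ae_mono _ H0) => y iy; rewrite /W -RintegralZr.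
  rewrite E.
  transitivity (\int[leb2']_(z in setT) (u z * (dpsi z.1 * be z.2) + g z * (psi z.1 * be z.2))).
    by apply: eq_Rintegral => z _; rewrite /G; ring.
  rewrite RintegralD//.
  - by rewrite (weak tp tb dp) addNr.
  - have := integrable_mul2 i1 tb; apply: eq_integrable => // z _.
    by rewrite /= mulrA.
  - have := integrable_mul2 i2 tb; apply: eq_integrable => // z _.
    by rewrite /= mulrA.
by apply: (ae_mono _ H) => y + cyd; rewrite in_itv/=; exact.
Qed.

(** Only countably many psi are needed to identify the section as a primitive,
    so one null set of lines serves for all of them. *)
Lemma box_prim0 : {ae leb, forall y, c < y < d ->
  leb.-integrable `[- q, q] (EFin \o (fun x => g (x, y))) /\
  exists C, {ae leb, forall x, - q < x < q -> u (x, y) = C + prim0 (fun t => g (t, y)) x}}.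
Proof.
have qq : - q < q by rewrite (lt_trans _ q0)// oppr_lt0.
have [N mN] := mass_neq0 qq.
have tt r n : - q < ratr r < q -> test_function `]- q, q[ (bal_bump (- q) q N r n).
  by move=> rq; exact: bal_bump_test.
have H : {ae leb, forall y, forall r n, - q < ratr r < q -> c < y < d ->
   \int[leb]_x (u (x, y) * bal_bump (- q) q N r n x + g (x, y) * prim (- q) (bal_bump (- q) q N r n) x) = 0}.
  apply: ae_countable => r n.
  have [rq|nrq] := boolP (- q < ratr r < q); last by apply: aeW.
  have t := tt r n rq; have t0 := integral_bal_bump (- q) q N r n.
  have := ae_weak_section (prim_test qq t t0) t (is_derive_prim qq t t0).
  by apply: (@filterS _ _ (ae_filter_ringOfSetsType leb)) => y Hy _.
have H1 := ae_integrable2 ui; have H2 := ae_integrable2 gi.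
have H12 : {ae leb, forall y, leb.-integrable setT (EFin \o (fun x => u (x, y))) /\
    leb.-integrable setT (EFin \o (fun x => g (x, y)))}.
  by apply: (ae_mono2 _ H1 H2) => y.
apply: (ae_mono2 _ H H12) => y Hy [uy gy] cyd.
have gy' : leb.-integrable `[- q, q] (EFin \o (fun x => g (x, y))).
  exact: integrableS gy.
split=> //.
apply: (@weak_deriv_prim0 _ q (fun x => u (x, y)) (fun x => g (x, y)) N q0 mN) => //.
  exact: integrableS uy.
move=> r n rq; have t := tt r n rq; have t0 := integral_bal_bump (- q) q N r n.
have tp := prim_test qq t t0.
have out f (x : R) : test_function `]- q, q[ f -> ~ `]- q, q[%classic x -> f x = 0.
  by move=> tf nx; have [] := test_out_dom (1 : R) tf nx.
rewrite (@Rintegral_sub_set _ _ _ leb setT)//; last first.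
  by move=> x _ nx; rewrite /= (out _ _ t nx) mulr0.
rewrite (@Rintegral_sub_set _ _ _ leb setT _ (fun x => g (x, y) * _))//; last first.
  by move=> x _ nx; rewrite /= (out _ _ tp nx) mulr0.
apply/eqP; rewrite -addr_eq0 -RintegralD//.
- by rewrite Hy.
- have [M tM] := test_sup t.
  by apply: (@integrable_mulb _ _ _ _ _ _ _ M) => //; exact: (measurable_test _ t).
- have [M tM] := test_sup tp.
  by apply: (@integrable_mulb _ _ _ _ _ _ _ M) => //; exact: (measurable_test _ tp).
Qed.

End BoxRepresentation.

(** * Domains below the graph of an even nonincreasing function *)

Section Hypograph.
Context {R : realType}.
Notation leb := (@lebesgue_measure R).
Notation mR := (measurableTypeR R).
Notation leb2' := (leb \x leb)%E.

(** The support of the product is contained in the product of the supports. *)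
Lemma tensor_test (psi be : R -> R) (A B : set R) (D : set (R * R)) :
  A `*` B `<=` D -> test_function A psi -> test_function B be ->
  test_function D (fun z => psi z.1 * be z.2).
Proof.
move=> S [Cp Kp Sp] [Cb Kb Sb].
set P := closure _ in Kp Sp; set Q := closure _ in Kb Sb.
have cPQ : closed (P `*` Q).
  rewrite (_ : P `*` Q = fst @^-1` P `&` snd @^-1` Q); last by [].
  by apply: closedI; apply: preimage_closed => //;
    first [exact: closed_closure|by move=> ? ?; exact: cvg_fst|by move=> ? ?; exact: cvg_snd].
have sub : closure [set z : R * R | psi z.1 * be z.2 != 0] `<=` P `*` Q.
  rewrite closureE => z; apply; split=> // -[x y] /=; rewrite mulf_eq0 negb_or => /andP[px by'].
  by split; exact: subset_closure.
split.
- move=> k; apply: Ck_mul; apply: Ck_comp => //; [exact: Ck_fst|exact: Ck_snd].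
- apply: subclosed_compact sub; [exact: closed_closure|exact: compact_setX].
- by move=> z /sub [Pz Qz]; apply: S; split; [exact: Sp|exact: Sb].
Qed.

Lemma tensor_derive (psi dpsi be : R -> R) (z : R * R) :
  (forall x : R, is_derive x (1 : R) psi (dpsi x)) -> derivable be z.2 1 ->
  'D_((1 : R), (0 : R)) (fun z : R * R => psi z.1 * be z.2) z = dpsi z.1 * be z.2.
Proof.
move=> dp /derivableP db.
have d1 : is_derive z ((1 : R), (0 : R)) (fun z : R * R => psi z.1) (dpsi z.1 * 1).
  apply: (@is_derive_chain _ _ psi fst) => //; apply/is_derive_line.
  rewrite [X in is_derive _ _ X _](_ : _ = (fun t : R => t + z.1)).
    by apply: is_derive_eq; rewrite addr0.
  by apply/funext => t /=; rewrite [_%:A]mulr1.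
have d2 : is_derive z ((1 : R), (0 : R)) (fun z : R * R => be z.2) ('D_1 be z.2 * 0).
  apply: (@is_derive_chain _ _ be snd) => //; apply/is_derive_line.
  rewrite [X in is_derive _ _ X _](_ : _ = (fun t : R => z.2)).
    exact: is_derive_cst.
  by apply/funext => t /=; rewrite scaler0 add0r.
have := is_deriveM d1 d2; rewrite mulr0 mulr1 scaler0 add0r.
by case=> _ ->; rewrite /GRing.scale/= mulrC.
Qed.

Lemma ge0_integral_gamma2_leb2 (f : R * R -> \bar R) :
  measurable_fun (setT : set (mR * mR)) f -> (forall z, 0 <= f z)%E ->
  (\int[@gamma2 R]_z f z = \int[leb2']_z (f z * (w z.1 * w z.2)%:E))%E.
Proof.
move=> mf f0; rewrite ge0_integral_gamma2//.
have mw1 : measurable_fun (setT : set (mR * mR)) (fun z => (w z.1 * w z.2)%:E).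
  by apply/measurable_EFinP; apply: measurable_funM; apply: measurableT_comp => //; exact: measurable_w.
rewrite (@fubini_tonelli2 _ _ mR mR R leb leb (fun z => f z * (w z.1 * w z.2)%:E)%E)//.
- apply: eq_integral => y _; rewrite /fubini_G.
  have m1 : measurable_fun (setT : set mR) (fun x => f (x, y)).
    by apply: measurableT_comp => //; exact: measurable_pair2.
  have m2 : measurable_fun (setT : set mR) (fun x => f (x, y) * (w x)%:E)%E.
    by apply: emeasurable_funM => //; exact: measurable_wE.
  have wy : (0 <= (w y)%:E)%E by rewrite lee_fin w_ge0.
  rewrite -(@ge0_integralZl _ mR R leb setT measurableT (fun x => f (x, y) * (w x)%:E)%E m2)//.
    by apply: eq_integral => x _; rewrite /= EFinM [RHS]muleA [RHS]muleC.
  by move=> x _; rewrite mule_ge0// lee_fin w_ge0.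
- exact: emeasurable_funM.
- by move=> z; rewrite mule_ge0// lee_fin mulr_ge0// w_ge0.
Qed.

(** Transfers L^2(gamma2) to Lebesgue measure, in which weak derivatives are
    defined. *)
Lemma integrable_gamma2_leb2 (f : R * R -> R) :
  (@gamma2 R).-integrable setT (EFin \o (f : mR * mR -> R)) ->
  leb2'.-integrable setT (EFin \o (fun z : mR * mR => f z * (w z.1 * w z.2))).
Proof.
move=> /integrableP[/measurable_EFinP mf fi]; apply/integrableP; split.
  apply/measurable_EFinP; apply: measurable_funM => //.
  by apply: measurable_funM; apply: measurableT_comp => //; exact: measurable_w.
move: fi; rewrite ge0_integral_gamma2_leb2//; last first.
  by apply/measurable_EFinP; exact: measurableT_comp.
apply: le_lt_trans; rewrite le_eqVlt; apply/orP; left; apply/eqP.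
apply: eq_integral => z _.
by rewrite /= normrM EFinM (ger0_norm (mulr_ge0 (w_ge0 _) (w_ge0 _))).
Qed.

Variables (a : \bar R) (p : R -> R).
Let I := oitv (- a) a.
Hypothesis pc : forall x, I x -> {for x, continuous p}.
Hypothesis pe : forall x, I x -> p (- x) = p x.
Hypothesis pm : forall x y, 0 <= x -> x <= y -> I y -> p y <= p x.

Definition hypograph : set (R * R) := [set z | I z.1 /\ z.2 < p z.1].

Lemma p_norm (x : R) : I x -> p `|x| = p x.
Proof. by move=> Ix; case: ger0P => // _; rewrite pe. Qed.

(** p does not increase away from the axis. *)
Lemma box_sub_hypograph (q x y : R) : (q%:E < a)%E -> `|x| < q -> y < p q ->
  hypograph (x, y).
Proof.
move=> qa xq yp; have q0 : 0 < q by rewrite (le_lt_trans _ xq).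
have Iq : I q by apply/oitvP; rewrite gtr0_norm.
have Ix : I x by apply/oitvP; rewrite (lt_trans _ qa)// lte_fin.
by split=> //=; rewrite (lt_le_trans yp)// -(p_norm Ix) pm// ltW.
Qed.

(** By continuity of p a slightly wider box still contains the point; rational
    half-widths make the union of boxes countable. *)
Lemma hypograph_box (x y : R) : (0 < a)%E -> hypograph (x, y) ->
  exists r : rat, [/\ 0 < ratr r :> R, ((ratr r)%:E < a)%E, `|x| < ratr r & y < p (ratr r)].
Proof.
move=> a0 [/= Ix yp].
have [q [q0a _ qe]] := exhaustion a0; have [n xn] := qe `|x| ((oitvP a x).1 Ix).
have Inx : I `|x| by apply/oitvP; rewrite normr_id; exact/oitvP.
have /(pc Inx)/nbhs_ballP[e /= e0 He] : nbhs (p `|x|) [set t | y < t].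
  by rewrite p_norm//; exact: lt_nbhsr.
have lt : `|x| < Num.min (`|x| + e) (q n) by rewrite lt_min xn ltrDl e0.
have [r] := rat_in_itvoo lt; rewrite in_itv/= lt_min => /and3P[xr re rq].
exists r; split=> //.
- by rewrite (le_lt_trans _ xr).
- by rewrite (lt_trans _ (q0a n).2)// lte_fin.
- by apply: He; rewrite /ball/= distrC ger0_norm ?subr_ge0 ?ltrBlDl// ltW.
Qed.

Lemma measurable_hypograph : (0 < a)%E -> measurable (hypograph : set (mR * mR)).
Proof.
move=> a0; pose F (r : rat) : set (mR * mR) :=
  if (0 < ratr r :> R) && ((ratr r)%:E < a)%E then
  (`]- ratr r, ratr r[%classic : set mR) `*` (`]-oo, p (ratr r)[%classic : set mR) else set0.
rewrite (_ : hypograph = \bigcup_r F r).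
  apply: bigcupT_measurable_rat => r; rewrite /F; case: ifP => // _.
  by apply: measurableX; exact: measurable_itv.
apply/seteqP; split=> [[x y] /(hypograph_box a0)[r [r0 ra xr yr]]|[x y] [r _]].
  by exists r => //; rewrite /F r0 ra; split; rewrite /= in_itv/= -?ltr_norml.
rewrite /F; case: ifP => // /andP[r0 ra] [/=]; rewrite !in_itv/= -ltr_norml.
exact: box_sub_hypograph.
Qed.

End Hypograph.

(** * Horizontal slices of a weak derivative on a hypograph *)

Section HorizontalDifference.
Context {R : realType}.
Notation leb := (@lebesgue_measure R).
Notation mR := (measurableTypeR R).
Notation leb2' := (leb \x leb)%E.

Definition open_box (q c d : R) : set (mR * mR) := `]- q, q[%classic `*` `]c, d[%classic.

Lemma measurable_open_box q c d : measurable (open_box q c d).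
Proof. by apply: measurableX; exact: measurable_itv. Qed.

Lemma open_boxP q c d (x y : R) : open_box q c d (x, y) <-> `|x| < q /\ c < y < d.
Proof. by rewrite /open_box/setX/= !in_itv/= ltr_norml. Qed.

(** On a bounded box the Gaussian density is bounded below. *)
Lemma L2_gamma2_box (D : set (mR * mR)) (f : R * R -> R) (q c d : R) : measurable D ->
  L2 (@gamma2 R) D f -> open_box q c d `<=` D ->
  leb2'.-integrable setT (EFin \o ((f : mR * mR -> R) \_ (open_box q c d))).
Proof.
move=> mD [mf fi] S; set B := open_box q c d.
pose F := (fun z : mR * mR => f z ^+ 2) \_ D.
have iF : leb2'.-integrable setT (EFin \o (fun z => F z * (w z.1 * w z.2))).
  by apply: integrable_gamma2_leb2; exact: integrable_restrict.
(* On the box the product density is at least w q * w M. *)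
pose M := Num.max `|c| `|d|; pose K := (w q * w M)^-1.
have K0 : 0 < w q * w M by rewrite mulr_gt0// w_gt0.
pose H := fun z : mR * mR => \1_(`]- q, q[%classic : set R) z.1 * \1_(`]c, d[%classic : set R) z.2 : R.
have iH : leb2'.-integrable setT (EFin \o H).
  by apply: integrable_tensor; exact: integrable_indic_itv.
apply: (@le_integrable _ (mR * mR)%type R leb2' setT measurableT _
   (EFin \o (fun z => H z + K * (F z * (w z.1 * w z.2))))).
- apply/measurable_EFinP/(measurable_restrictT _ _).1; first exact: measurable_open_box.
  exact: measurable_funS mf.
- move=> [x y] _; rewrite lee_fin patchE; case: ifPn => [|_]; last by rewrite normr0.
  rewrite inE => Bz; have [xq yc] := (open_boxP q c d x y).1 Bz.
  have -> : H (x, y) = 1.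
    by case: Bz => /= Bx By; rewrite /H/= !indicE !mem_set// mulr1.
  have -> : F (x, y) = f (x, y) ^+ 2 by rewrite /F patchE mem_set//; exact: S.
  rewrite /= [leRHS]ger0_norm; last first.
    by rewrite addr_ge0// mulr_ge0 ?invr_ge0 ?(ltW K0)// mulr_ge0 ?sqr_ge0// mulr_ge0// w_ge0.
  apply: (@le_trans _ _ (1 + f (x, y) ^+ 2)).
    by have := sqr_ge0 (`|f (x, y)| - 1); rewrite sqrrB real_normK ?num_real// => h; nra.
  rewrite lerD2l ler_pdivlMl// mulrC ler_wpM2l ?sqr_ge0// ler_pM ?w_ge0//.
    by rewrite w_lower// ltW.
  apply: w_lower; rewrite /M le_max; case/andP: yc => cy yd.
  have [y0|y0] := leP 0 y.
    by apply/orP; right; rewrite ger0_norm// (le_trans (ltW yd))// ler_norm.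
  by apply/orP; left; rewrite ltr0_norm// ltr0_norm ?lerN2 ?(ltW cy)// (lt_trans cy).
- rewrite (_ : EFin \o _ = (EFin \o H) \+ (fun z => K%:E * (F z * (w z.1 * w z.2))%:E))%E//.
  by apply: integrableD => //; exact: integrableZl.
Qed.

Variables (a : \bar R) (p : R -> R).
Let I := oitv (- a) a.
Let Om := hypograph a p.
Hypothesis a0 : (0 < a)%E.
Hypothesis pc : forall x, I x -> {for x, continuous p}.
Hypothesis pe : forall x, I x -> p (- x) = p x.
Hypothesis pm : forall x y, 0 <= x -> x <= y -> I y -> p y <= p x.

Let mOm : measurable (Om : set (mR * mR)) := measurable_hypograph pc pe pm a0.

Lemma open_box_sub (q c : R) : (q%:E < a)%E -> open_box q c (p q) `<=` Om.
Proof.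
move=> qa [x y] /open_boxP[xq /andP[_ yp]].
exact: (box_sub_hypograph pe pm qa).
Qed.

Variables (u g : R * R -> R).
Hypothesis L2u : L2 (@gamma2 R) Om u.
Hypothesis L2g : L2 (@gamma2 R) Om g.
Hypothesis wd : weak_deriv2 Om (1, 0) u g.

(** The functions psi(x) beta(y) supported in the box are test functions of the
    whole domain. *)
Lemma box_weak (q c : R) : 0 < q -> (q%:E < a)%E -> c < p q -> let B := open_box q c (p q) in
  forall psi dpsi be : R -> R,
  test_function `]- q, q[ psi -> test_function `]c, p q[ be ->
  (forall x, is_derive x (1 : R) psi (dpsi x)) ->
  \int[leb2']_(z in (setT : set (mR * mR))) ((u \_ B) z * (dpsi z.1 * be z.2)) =
  - \int[leb2']_(z in (setT : set (mR * mR))) ((g \_ B) z * (psi z.1 * be z.2)).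
Proof.
move=> q0 qa cp B; have BOm : B `<=` Om := open_box_sub qa.
move=> psi dpsi be tp tb dp.
have tphi : test_function Om (fun z => psi z.1 * be z.2).
  by apply: (tensor_test _ tp tb); exact: BOm.
have := wd tphi.
have out (A : set R) (f : R -> R) (x : R) : test_function A f -> ~ A x -> f x = 0.
  by move=> tf nA; have [] := test_out_dom (1 : R) tf nA.
have dout (x : R) : ~ (`]- q, q[%classic x) -> dpsi x = 0.
  by move=> nx; have [_] := test_out_dom (1 : R) tp nx; have [_ ->] := dp x.
have E (f k : R * R -> R) : (forall z, ~ B z -> k z = 0) ->
   \int[leb2']_(z in Om) (f z * k z) =
   \int[leb2']_(z in (setT : set (mR * mR))) ((f \_ B) z * k z).
  move=> kB; rewrite -(@Rintegral_sub_set _ _ _ leb2' Om B)//; last first.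
    by move=> z _ nB; rewrite kB// mulr0.
  rewrite -(@Rintegral_sub_set _ _ _ leb2' setT B)//; last first.
    by move=> z _ nB; rewrite kB// mulr0.
  by apply: eq_Rintegral => z zB; rewrite patchE zB.
have nB (z : R * R) : ~ B z -> ~ `]- q, q[%classic z.1 \/ ~ `]c, p q[%classic z.2.
  by move=> nz; apply/not_andP => -[z1 z2]; exact: nz.
under eq_Rintegral => z _.
  rewrite (tensor_derive dp); last by case: tb => /(_ 1%N)[_ [+ _]] _ _; apply.
  over.
rewrite (E u (fun z => dpsi z.1 * be z.2)); last first.
  by move=> z /nB[/dout ->|/(out _ _ _ tb) ->]; rewrite ?mul0r ?mulr0.
rewrite (E g (fun z => psi z.1 * be z.2))//.
by move=> z /nB[/(out _ _ _ tp) ->|/(out _ _ _ tb) ->]; rewrite ?mul0r ?mulr0.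
Qed.

Lemma box_difference (q c : R) : 0 < q -> (q%:E < a)%E -> c < p q ->
  {ae leb, forall y, c < y < p q ->
  leb.-integrable `[- q, q] (EFin \o (fun x => (g \_ (open_box q c (p q))) (x, y))) /\
  exists C, {ae leb, forall x, - q < x < q ->
    u (x, y) = C + prim0 (fun t => (g \_ (open_box q c (p q))) (t, y)) x}}.
Proof.
move=> q0 qa cp; set B := open_box q c (p q).
have mB : measurable B := measurable_open_box q c (p q).
have BOm : B `<=` Om := open_box_sub qa.
have ui := L2_gamma2_box mOm L2u BOm.
have gi := L2_gamma2_box mOm L2g BOm.
have H := @box_prim0 R q c (p q) (u \_ B) (g \_ B) q0 cp ui gi.
have {}H := H (box_weak q0 qa cp).
apply: (ae_mono _ H) => y + cy => /(_ cy)[gy [C HC]]; split=> //; exists C.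
  apply: (ae_mono _ HC) => x + xq => /(_ xq) <-; rewrite patchE mem_set//.
Qed.

(** Every point of the domain lies in one of countably many boxes, on which
    [box_difference] applies.  Only the difference of the values at x and -x is
    kept, in which the constant C of the box cancels. *)
Lemma horizontal_difference :
  {ae leb, forall y, {ae leb, forall x, 0 < x -> Om (x, y) ->
   leb.-integrable `[- x, x] (EFin \o (fun t => g (t, y))) /\
   u (x, y) - u (- x, y) = \int[leb]_(t in `]0, x[) (g (t, y) + g (- t, y))}}.
Proof.
have H : {ae leb, forall y, forall (r : rat) (n : nat), 0 < ratr r :> R -> ((ratr r)%:E < a)%E ->
    - n%:R < p (ratr r) -> - n%:R < y < p (ratr r) ->
   leb.-integrable `[- ratr r, ratr r] (EFin \o (fun x => (g \_ (open_box (ratr r) (- n%:R) (p (ratr r)))) (x, y))) /\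
   exists C, {ae leb, forall x, - ratr r < x < ratr r ->
    u (x, y) = C + prim0 (fun t => (g \_ (open_box (ratr r) (- n%:R) (p (ratr r)))) (t, y)) x}}.
  apply: ae_countable => r n.
  have [r0|r0] := pselect (0 < ratr r :> R); last by apply: aeW.
  have [ra|ra] := pselect ((ratr r)%:E < a)%E; last by apply: aeW.
  have [np|np] := pselect (- n%:R < p (ratr r)); last by apply: aeW.
  have := box_difference r0 ra np.
  by apply: (@filterS _ _ (ae_filter_ringOfSetsType leb)) => y Hy _ _ _.
apply: (ae_mono _ H) => y Hy {H}.
have H : {ae leb, forall x, forall (r : rat) (n : nat), 0 < ratr r :> R -> ((ratr r)%:E < a)%E ->
    - n%:R < y < p (ratr r) -> 0 < x < ratr r ->
   leb.-integrable `[- x, x] (EFin \o (fun t => g (t, y))) /\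
   u (x, y) - u (- x, y) = \int[leb]_(t in `]0, x[) (g (t, y) + g (- t, y))}.
  apply: ae_countable => r n.
  have [r0|r0] := pselect (0 < ratr r :> R); last by apply: aeW.
  have [ra|ra] := pselect ((ratr r)%:E < a)%E; last by apply: aeW.
  have [/andP[ny yp]|ny] := pselect (- n%:R < y < p (ratr r)); last by apply: aeW.
  have [|gi [C HC]] := Hy r n r0 ra (lt_trans ny yp); first by rewrite ny.
  set q := ratr r in r0 ra yp gi HC *; set B := open_box _ _ _ in gi HC.
  have HC' := ae_opp HC.
  apply: (ae_mono2 _ HC HC') => x h1 h2 _ _ _ /andP[x0 xq].
  have Bt t : `|t| <= x -> (g \_ B) (t, y) = g (t, y).
    move=> tx; rewrite patchE mem_set//; apply: (open_boxP _ _ _ _ _).2; rewrite (le_lt_trans tx xq).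
    by split=> //; apply/andP.
  have gx : leb.-integrable `[- x, x] (EFin \o (fun t => (g \_ B) (t, y))).
    by apply: integrableS gi => //; apply: subset_itv; rewrite bnd_simp; lra.
  split.
    apply: eq_integrable gx => // t; rewrite inE/= in_itv/= -ler_norml => tx.
    by rewrite /= Bt.
  rewrite h1 ?h2; [|lra|lra].
  rewrite opprD addrACA subrr add0r prim0_diff//.
  apply: eq_Rintegral => t; rewrite inE/= in_itv/= => /andP[t0 tx].
  by rewrite !Bt// ?normrN gtr0_norm// ltW.
apply: (ae_mono _ H) => x Hx x0 /(hypograph_box pc pe a0)[r [r0 ra xr yp]].
apply: (Hx r (Num.truncn `|y|).+1) => //; last first.
  by rewrite x0 (le_lt_trans (ler_norm x)).
rewrite yp andbT ltrNl (le_lt_trans (ler_norm _))// normrN.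
exact: truncnS_gt.
Qed.

End HorizontalDifference.

(** * The Poincare inequality for odd functions on a hypograph *)

Section OddPoincare.
Context {R : realType}.
Notation leb := (@lebesgue_measure R).
Notation mR := (measurableTypeR R).
Notation g1 := (@gamma1 R).
Notation g2 := (@gamma2 R).
Variables (a : \bar R) (mu : R) (h v : R -> R).
Hypothesis a0 : (0 < a)%E.
Hypothesis gs : ground_state a mu h v.
Let I := oitv (- a) a.
Let RT := right_tail a 0.
Let mI : measurable (I : set mR) := measurable_oitv (- a) a.
Let mRT : measurable (RT : set mR) := measurable_right_tail a 0.

(** The Hardy inequality for k with the even function s = (|g(t)| + |g(-t)|) / 2,
    followed by s^2 <= (g(t)^2 + g(-t)^2) / 2. *)
Lemma odd_poincare (k g : R -> R) :
  measurable_fun (setT : set mR) k -> measurable_fun (setT : set mR) g ->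
  {ae leb, forall x, I x -> k (- x) = - k x} ->
  {ae leb, forall x, 0 < x -> (x%:E < a)%E ->
    (`|k x|%:E <= \int[leb]_(t in `]0%R, x[) ((`|g t| + `|g (- t)|) / 2)%:E)%E} ->
  (mu%:E * \int[leb]_(x in I) (k x ^+ 2 * w x)%:E <=
   \int[leb]_(x in I) (g x ^+ 2 * w x)%:E)%E.
Proof.
move=> mk mg ok H.
have msqr (f : R -> R) : measurable_fun (setT : set mR) f ->
    measurable_fun (setT : set mR) (fun x => f x ^+ 2 * w x).
  move=> mf; apply: measurable_funM; last exact: measurable_w.
  exact: measurable_funX.
have msq (f : R -> R) : measurable_fun (setT : set mR) f ->
    measurable_fun (setT : set mR) (fun x => (f x ^+ 2 * w x)%:E).
  by move=> mf; apply/measurable_EFinP; exact: msqr.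
have mopp (f : R -> R) : measurable_fun (setT : set mR) f ->
    measurable_fun (setT : set mR) (fun x => f (- x)).
  by move=> mf; apply: measurableT_comp => //; exact: oppr_measurable.
have pos (f : R -> R) x : (0 <= (f x ^+ 2 * w x)%:E)%E by rewrite lee_fin sqw_ge0.
rewrite (even_split a (msq _ mk) (pos k)) (even_split a (msq _ mg) (pos g)) -/RT.
pose s t := (`|g t| + `|g (- t)|) / 2.
have ms : measurable_fun (setT : set mR) s.
  by apply: measurable_funM => //; apply: measurable_funD; apply: measurableT_comp => //; exact: mopp.
have s0 t : 0 <= s t by rewrite divr_ge0// addr_ge0.
have -> : (\int[leb]_(x in RT) (k (- x)%R ^+ 2 * w (- x)%R)%:E =
           \int[leb]_(x in RT) (k x ^+ 2 * w x)%:E)%E.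
  apply: ae_eq_integral => //.
  - by apply: measurable_funTS; apply/measurable_EFinP; exact: (mopp _ (msqr _ mk)).
  - by apply: measurable_funTS; exact: msq.
  by apply: (ae_mono _ ok) => x + /right_tailP[_ Ix] => ->//; rewrite sqrrN wN.
have S : (mu%:E * \int[leb]_(x in RT) (k x ^+ 2 * w x)%:E <=
   \int[leb]_(x in RT) (s x ^+ 2 * w x)%:E)%E.
  apply: (hardy_ineq gs mk ms).
  apply: (ae_mono _ H) => x + x0 xa => /(_ x0 xa) /le_trans; apply.
  by rewrite le_eqVlt; apply/orP; left; apply/eqP; apply: eq_integral => t _; rewrite (ger0_norm (s0 t)).
have nn : (0 <= \int[leb]_(x in RT) (k x ^+ 2 * w x)%:E)%E.
  by apply: integral_ge0 => x _; exact: pos.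
rewrite ge0_muleDr//; apply: (le_trans (leeD S S)).
have p2 x : (0 <= (s x ^+ 2 * w x)%:E)%E by exact: pos.
have m2 (f : R -> R) : measurable_fun (setT : set mR) f -> measurable_fun RT (fun x => (f x ^+ 2 * w x)%:E).
  by move=> mf; apply: measurable_funTS; exact: msq.
have m3 : measurable_fun (RT : set mR) (fun x => (g (- x) ^+ 2 * w (- x))%:E).
  by apply: measurable_funTS; apply/measurable_EFinP; exact: (mopp _ (msqr _ mg)).
rewrite -(@ge0_integralD _ mR R leb RT mRT)//; [|exact: m2|exact: m2].
rewrite -(@ge0_integralD _ mR R leb RT mRT)//; [|exact: m2].
apply: ge0_le_integral => //.
- by move=> x _; rewrite adde_ge0.
- by apply: emeasurable_funD; exact: m2.
- by apply: emeasurable_funD => //; exact: m2.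
move=> x _; rewrite -!EFinD lee_fin wN -!mulrDl ler_wpM2r ?w_ge0// /s.
rewrite -(real_normK (num_real (g x))) -(real_normK (num_real (g (- x)))).
by have := sqr_ge0 (`|g x| - `|g (- x)|); nra.
Qed.

Variable p : R -> R.
Let Om := hypograph a p.
Hypothesis pc : forall x, I x -> {for x, continuous p}.
Hypothesis pe : forall x, I x -> p (- x) = p x.
Hypothesis pm : forall x y, 0 <= x -> x <= y -> I y -> p y <= p x.
Let mOm : measurable (Om : set (mR * mR)) := measurable_hypograph pc pe pm a0.

Lemma hypograph_mono (x y t : R) : Om (x, y) -> `|t| <= `|x| -> Om (t, y).
Proof.
move=> /(hypograph_box pc pe a0)[r [r0 ra xr yp]] tx.
exact: (box_sub_hypograph pe pm ra (le_lt_trans tx xr) yp).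
Qed.

(** [odd_poincare] on almost every line, integrated in y.  The functions are
    extended by 0, so that all lines refer to the same interval ]-a, a[ even where
    the section of the domain is shorter. *)
Lemma odd_poincare_hypograph (u g : R * R -> R) :
  L2 g2 Om u -> L2 g2 Om g -> weak_deriv2 Om (1, 0) u g ->
  {ae g2, forall z, Om z -> u (- z.1, z.2) = - u z} ->
  (mu%:E * \int[g2]_(z in Om) (u z ^+ 2)%:E <= \int[g2]_(z in Om) (g z ^+ 2)%:E)%E.
Proof.
move=> L2u L2g wd odd.
pose U := (u : mR * mR -> R) \_ Om; pose G := (g : mR * mR -> R) \_ Om.
have mU : measurable_fun (setT : set (mR * mR)) U by apply/(measurable_restrictT _ _).1 => //; case: L2u.
have mG : measurable_fun (setT : set (mR * mR)) G by apply/(measurable_restrictT _ _).1 => //; case: L2g.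
have m2 (F : mR * mR -> R) : measurable_fun (setT : set (mR * mR)) F -> measurable_fun (setT : set (mR * mR)) (fun z => (F z ^+ 2)%:E).
  by move=> mF; apply/measurable_EFinP; exact: measurable_funX.
have sq0 (F : mR * mR -> R) z : (0 <= (F z ^+ 2)%:E)%E by rewrite lee_fin sqr_ge0.
have E (f : R * R -> R) : (\int[g2]_(z in Om) (f z ^+ 2)%:E =
    \int[g2]_z (((f : mR * mR -> R) \_ Om) z ^+ 2)%:E)%E.
  rewrite integral_mkcond; apply: eq_integral => z _; rewrite !patchE.
  by case: ifP => //; rewrite expr0n.
have E1 (f : R * R -> R) y : let F := (f : mR * mR -> R) \_ Om in
   (\int[leb]_x ((F (x, y) ^+ 2)%:E * (w x)%:E) =
    \int[leb]_(x in I) (F (x, y) ^+ 2 * w x)%:E)%E.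
  move=> F; rewrite [RHS]integral_mkcond; apply: eq_integral => x _; rewrite patchE.
  case: ifPn => [//|]; rewrite notin_setE => nI.
  by rewrite /F patchE memNset ?expr0n ?mul0e// => -[].
rewrite !E !ge0_integral_gamma2//; [|exact: m2|exact: m2].
have mS (F : mR * mR -> R) : measurable_fun (setT : set (mR * mR)) F ->
    measurable_fun (setT : set mR) (fun y => (w y)%:E * \int[leb]_x ((F (x, y) ^+ 2)%:E * (w x)%:E))%E.
  move=> mF; apply: emeasurable_funM; first exact: measurable_wE.
  apply: (@measurable_fun_fubini_tonelli_G _ _ mR mR R leb (fun z => (F z ^+ 2)%:E * (w z.1)%:E)%E).
    apply: emeasurable_funM; first exact: m2.
    by apply/measurable_EFinP; apply: measurableT_comp => //; exact: measurable_w.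
  by move=> z; rewrite mule_ge0// lee_fin w_ge0.
have p1 (F : mR * mR -> R) y : (0 <= \int[leb]_x ((F (x, y) ^+ 2)%:E * (w x)%:E))%E.
  by apply: integral_ge0 => x _; rewrite mule_ge0// lee_fin w_ge0.
have p2 (F : mR * mR -> R) y : (0 <= (w y)%:E * \int[leb]_x ((F (x, y) ^+ 2)%:E * (w x)%:E))%E.
  by rewrite mule_ge0// lee_fin w_ge0.
have mu0 : (0 <= mu%:E)%E by rewrite lee_fin ltW// (gs_mu gs).
rewrite -(@ge0_integralZl _ mR R leb setT measurableT _ (mS U mU))//.
apply: ae_ge0_le_integral => //.
- by move=> y _; rewrite mule_ge0.
- by apply: emeasurable_funM => //; exact: mS.
- exact: mS.
have := ae_gamma1 (ae_sections2 odd).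
have := horizontal_difference a0 pc pe pm L2u L2g wd.
apply: (@filterS2 _ _ (ae_filter_ringOfSetsType leb)) => y Hy /ae_gamma1 oy _.
rewrite !E1 muleCA lee_pmul2l ?lte_fin ?w_gt0//.
have UE x : Om (x, y) -> U (x, y) = u (x, y) by move=> Ox; rewrite /U patchE mem_set.
have GE x : Om (x, y) -> G (x, y) = g (x, y) by move=> Ox; rewrite /G patchE mem_set.
have U0 x : ~ Om (x, y) -> U (x, y) = 0 by move=> Ox; rewrite /U patchE memNset.
have Om_opp x : Om (x, y) -> Om (- x, y) by move=> /hypograph_mono; apply; rewrite normrN.
apply: (odd_poincare (k := fun x => U (x, y)) (g := fun x => G (x, y))).
- exact: measurable_section1.
- exact: measurable_section1.
- apply: (ae_mono _ oy) => x Hx Ix; have [Ox|nO] := pselect (Om (x, y)).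
    by rewrite !UE ?Hx//; exact: Om_opp.
  by rewrite !U0 ?oppr0// => /Om_opp; rewrite opprK.
apply: (ae_mono2 _ Hy oy) => x Hx ox x0 xa; have [Ox|nO] := pselect (Om (x, y)); last first.
  rewrite U0// normr0; apply: integral_ge0 => t _.
  by rewrite lee_fin divr_ge0// addr_ge0.
have [gi D] := Hx x0 Ox.
have sub (k : R -> R) : leb.-integrable `[- x, x] (EFin \o k) ->
    leb.-integrable `]0, x[ (EFin \o k).
  by move=> ki; apply: integrableS ki => //; apply: subset_itv; rewrite bnd_simp//; lra.
have i1 := sub _ gi; have i2 := sub _ (integrable_opp gi).
have i3 : leb.-integrable `]0, x[ (EFin \o (fun t => g (t, y) + g (- t, y))).
  rewrite (_ : EFin \o _ = (EFin \o (fun t => g (t, y))%R) \+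
    (EFin \o (fun t => g (- t, y))%R))%E//.
  exact: integrableD.
have i4 : leb.-integrable `]0, x[ (EFin \o (fun t => (g (t, y) + g (- t, y)) / 2)).
  under [X in _.-integrable _ X]eq_fun do rewrite /= mulrC EFinM.
  exact: integrableZl.
have -> : U (x, y) = \int[leb]_(t in `]0, x[) ((g (t, y) + g (- t, y)) / 2).
  by rewrite UE// RintegralZr// -D ox// opprK; field.
rewrite /Rintegral -fine_abse ?integrable_fin_num// fineK; last first.
  by rewrite abse_fin_num; exact: integrable_fin_num.
apply: (le_trans (le_abse_integral _ _ _)) => //; first exact: measurable_int i4.
have mG1 : measurable_fun (setT : set mR) (fun t => G (t, y)) by exact: measurable_section1.
apply: ge0_le_integral => //.
- by apply: measurableT_comp => //; exact: measurable_int i4.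
- apply: measurable_funTS; apply/measurable_EFinP; apply: measurable_funM => //.
  have mG2 : measurable_fun (setT : set mR) (fun t => G (- t, y)).
    by apply: (measurableT_comp mG1); exact: oppr_measurable.
  by apply: measurable_funD; apply: measurableT_comp.
move=> t; rewrite /= in_itv/= => /andP[t0 tx].
have Ot : Om (t, y) by apply: (hypograph_mono Ox); rewrite !gtr0_norm// ltW.
rewrite lee_fin !GE//; last exact: Om_opp.
by rewrite normrM (ger0_norm (_ : 0 <= 2^-1))// ler_wpM2r// ler_normD.
Qed.

End OddPoincare.

(** * The lower bound for odd eigenvalues *)

Section LowerBound.
Context {R : realType}.
Notation leb := (@lebesgue_measure R).
Notation mR := (measurableTypeR R).
Notation g2 := (@gamma2 R).
Variable a : \bar R.
Let I := oitv (- a) a.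

(** For 0 <= x <= y the point x lies between -y and y, where p takes the same
    value. *)
Lemma concave_even_nonincreasing (p : R -> R) : convex_function I (fun x => - p x) ->
  (forall x, I x -> p (- x) = p x) ->
  forall x y, 0 <= x -> x <= y -> I y -> p y <= p x.
Proof.
move=> cx pe x y x0 xy Iy.
have [y0|y0] := eqVneq y 0.
  by move: xy; rewrite y0 => xy; rewrite (le_anti (_ : x <= 0 <= x)) ?xy// y0.
have yp : 0 < y by rewrite lt_neqAle eq_sym y0 (le_trans x0).
(* The weight for which t y + (1 - t) (-y) = x. *)
pose t := (1 + x / y) / 2.
have xy1 : x / y <= 1 by rewrite ler_pdivrMr ?mul1r.
have xy0 : 0 <= x / y by rewrite divr_ge0// ltW.
have t0 : 0 <= t by rewrite /t; lra.
have t1 : t <= 1 by rewrite /t; lra.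
have INy : I (- y) by apply/oitv_sym.
have := @cx (Itv01 t0 t1) y (- y); rewrite !inE => /(_ Iy INy) H.
have {}H : - p (t * y + (1 - t) * - y) <= t * - p y + (1 - t) * - p (- y) := H.
move: H; rewrite pe// (_ : t * y + (1 - t) * - y = x); last by rewrite /t; field.
by rewrite -mulrDl addrC subrK mul1r lerN2.
Qed.

Variables (mu : R) (h v : R -> R) (p : R -> R).
Hypothesis a0 : (0 < a)%E.
Hypothesis gs : ground_state a mu h v.
Hypothesis pc : forall x, I x -> {for x, continuous p}.
Hypothesis pe : forall x, I x -> p (- x) = p x.
Hypothesis pm : forall x y, 0 <= x -> x <= y -> I y -> p y <= p x.
Let Om := hypograph a p.
Let mOm : measurable (Om : set (mR * mR)) := measurable_hypograph pc pe pm a0.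

(** Test the eigenvalue equation with u itself and discard the y-derivative. *)
Lemma odd_eigenvalue_ge (lam : R) : odd_eigenvalue Om lam -> mu <= lam.
Proof.
move=> [u [[un0 [ux [uy [H eqn]]]] odd]].
have [L2u L2x L2y wx _] := H.
have S := odd_poincare_hypograph a0 gs pc pe pm L2u L2x wx odd.
have [mu_ ui] := L2u; have [mx xi] := L2x; have [my yi] := L2y.
have u0 := Rintegral_sq_gt0 mOm ui un0.
have E : \int[g2]_(z in Om) (ux z ^+ 2 + uy z ^+ 2) = lam * \int[g2]_(z in Om) (u z ^+ 2).
  exact: (eqn u ux uy H).
have fin (f : R * R -> R) : g2.-integrable Om (fun z => (f z ^+ 2)%:E) ->
    (\int[g2]_(z in Om) (f z ^+ 2)%:E = (\int[g2]_(z in Om) (f z ^+ 2))%:E)%E.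
  by move=> fi; rewrite /Rintegral fineK// integrable_fin_num.
move: S; rewrite !fin// -EFinM lee_fin => S.
rewrite -(ler_pM2r u0) -E (le_trans S)//.
rewrite RintegralD// lerDl; apply: Rintegral_ge0 => z _; exact: sqr_ge0.
Qed.

Lemma mu1odd_ge : (mu%:E <= mu1odd Om)%E.
Proof.
by apply: le_ereal_inf_tmp => _ [lam /odd_eigenvalue_ge ? <-]; rewrite lee_fin.
Qed.

End LowerBound.

(** * Continuous functions of two variables with compact support *)

Section ContinuousCompactSupport.
Context {R : realType}.
Notation leb := (@lebesgue_measure R).
Notation mR := (measurableTypeR R).
Notation leb2' := (leb \x leb)%E.

(** An open set of the plane is a countable union of boxes with rational centres. *)
Lemma open_measurable2 (U : set (R * R)) : open U -> measurable (U : set (mR * mR)).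
Proof.
move=> oU.
pose B (i : rat * rat * nat) : set (mR * mR) :=
  (ball (ratr i.1.1 : R) i.2.+1%:R^-1 : set mR) `*` (ball (ratr i.1.2 : R) i.2.+1%:R^-1 : set mR).
pose F i := if pselect (B i `<=` U) then B i else set0.
have -> : U = \bigcup_i F i.
  apply/seteqP; split=> [[x y] Uxy|z [i _]]; last first.
    by rewrite /F; case: pselect => // S; exact: S.
  have /nbhs_ballP[e /= e0 He] : nbhs (x, y) U by exact: open_nbhs_nbhs.
  have [n en] : exists n, n.+1%:R^-1 < e / 2.
    exists (Num.truncn (e / 2)^-1); rewrite invf_plt ?posrE ?divr_gt0//.
    exact: truncnS_gt.
  have n0 : 0 < n.+1%:R^-1 :> R by rewrite invr_gt0.
  have close (t : R) : exists q : rat, `|ratr q - t| < n.+1%:R^-1.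
    have lt : t - n.+1%:R^-1 < t + n.+1%:R^-1.
      by rewrite (@lt_trans _ _ t)// ?gtrBl ?ltrDl.
    have [q] := rat_in_itvoo lt.
    by rewrite in_itv/= => tq; exists q; rewrite ltr_distl.
  have [q qx] := close x; have [r ry] := close y.
  (* The box around the rational point (q, r) contains (x, y) and has diameter
     less than e. *)
  exists (q, r, n) => //; rewrite /F; case: pselect => [?|nS]; first by split; rewrite /ball/=.
  case: nS => -[s t] [/= qs rt]; apply: He; split; rewrite /ball/=.
    rewrite (le_lt_trans (ler_distD (ratr q) x s))// (splitr e) ltrD//.
      by rewrite distrC (lt_trans qx).
    exact: lt_trans en.
  rewrite (le_lt_trans (ler_distD (ratr r) y t))// (splitr e) ltrD//.
    by rewrite distrC (lt_trans ry).
  exact: lt_trans en.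
apply: countable_bigcupT_measurable => [|i]; first exact: countableP.
rewrite /F; case: pselect => ?; last exact: measurable0.
by apply: measurableX; exact: measurable_ball.
Qed.

Lemma continuous2_measurable (f : R * R -> R) : continuous f ->
  measurable_fun (setT : set (mR * mR)) f.
Proof.
move=> cf; apply: (measurability _ (RGenOpens.measurableE R)).
move=> _ [_ [u [v ->]] <-]; rewrite setTI; apply: open_measurable2.
by apply: open_comp => //; exact: interval_open.
Qed.

Lemma integrable_cont_compact (f : R * R -> R) (r : R) : continuous f ->
  (forall z, r < `|z| -> f z = 0) -> leb2'.-integrable setT (EFin \o (f : mR * mR -> R)).
Proof.
move=> cf fr; pose J : set R := `[- r, r]%classic; pose K := J `*` J.
have cK : compact K by apply: compact_setX; exact: segment_compact.
have [M [_ HM]] : bounded_set (f @` K).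
  by apply: compact_bounded; apply: continuous_compact => //; exact: continuous_subspaceT.
have KP z : K z <-> `|z| <= r.
  by case: z => x y; rewrite /K/J/=/setX/= !in_itv/= -!ler_norml /Num.norm/= ge_max; split=> [[-> ->]|/andP].
have fM z : `|f z| <= `|M| + 1.
  have [zr|rz] := leP `|z| r; last by rewrite fr// normr0 addr_ge0.
  apply: (HM (`|M| + 1)); first by rewrite (le_lt_trans (ler_norm M))// ltrDl.
  by exists z => //; exact/KP.
have iH : leb2'.-integrable setT (EFin \o (fun z : mR * mR => \1_J z.1 * \1_J z.2 : R)).
  by apply: integrable_tensor; exact: integrable_indic_itv.
have := @integrable_mulb _ (mR * mR)%type R leb2' setT _ f _ measurableT iH
   (continuous2_measurable cf) (fun z _ => fM z).
apply: eq_integrable => // -[x y] _ /=; congr EFin.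
have [Kz|nK] := pselect (K (x, y)).
  by case: Kz => /= Jx Jy; rewrite !indicE !mem_set// !mul1r.
by rewrite fr ?mulr0// ltNge; apply/negP => /KP.
Qed.

Lemma is_derive_section1 (phi : R * R -> R) (x y : R) :
  derivable phi (x, y) ((1 : R), (0 : R)) ->
  is_derive x (1 : R) (fun t => phi (t, y)) ('D_((1 : R), (0 : R)) phi (x, y)).
Proof.
move=> /derivableP /is_derive_line H; apply/is_derive_line.
rewrite (_ : (fun t => _) = (fun t : R => phi (t *: ((1 : R), (0 : R)) + (x, y))))//.
apply/funext => t; have -> : t *: ((1 : R), (0 : R)) + (x, y) = (t *: (1 : R) + x, t *: (0 : R) + y) by [].
by rewrite scaler0 add0r.
Qed.

Lemma is_derive_section2 (phi : R * R -> R) (x y : R) :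
  derivable phi (x, y) ((0 : R), (1 : R)) ->
  is_derive y (1 : R) (fun t => phi (x, t)) ('D_((0 : R), (1 : R)) phi (x, y)).
Proof.
move=> /derivableP /is_derive_line H; apply/is_derive_line.
rewrite (_ : (fun t => _) = (fun t : R => phi (t *: ((0 : R), (1 : R)) + (x, y))))//.
apply/funext => t; have -> : t *: ((0 : R), (1 : R)) + (x, y) = (t *: (0 : R) + x, t *: (1 : R) + y) by [].
by rewrite scaler0 add0r.
Qed.

End ContinuousCompactSupport.

(** * The strip *)

Section Strip.
Context {R : realType}.
Notation leb := (@lebesgue_measure R).
Notation mR := (measurableTypeR R).
Notation g1 := (@gamma1 R).
Notation g2 := (@gamma2 R).
Notation leb2' := (leb \x leb)%E.

Variables (a : \bar R) (mu : R) (h v : R -> R) (b : R).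
Hypothesis a0 : (0 < a)%E.
Hypothesis gs : ground_state a mu h v.
Let I := oitv (- a) a.
Let mI : measurable (I : set mR) := measurable_oitv (- a) a.
Let S := hypograph a (fun=> b).
Let pc (x : R) : I x -> {for x, continuous (fun=> b : R)}.
Proof. by move=> _; exact: cvg_cst. Qed.
Let pe (x : R) : I x -> b = b. Proof. by []. Qed.
Let pm (x y : R) : 0 <= x -> x <= y -> I y -> b <= b. Proof. by []. Qed.
Let mS : measurable (S : set (mR * mR)) := measurable_hypograph pc pe pm a0.

(** Fubini, as gamma1 is finite. *)
Lemma L2_strip (f : R -> R) : L2 g1 I f -> L2 g2 S (fun z => f z.1).
Proof.
move=> [mf fi].
have mF : measurable_fun (setT : set mR) (f \_ I) by apply: (measurable_restrictT _ _).1.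
have E z : S z -> (f \_ I) z.1 = f z.1 by move=> [Iz _]; rewrite patchE mem_set.
split.
  apply: (@eq_measurable_fun _ _ _ _ S (fun z : mR * mR => (f \_ I) z.1)).
    by move=> z; rewrite inE; exact: E.
  by apply: measurable_funTS; exact: measurableT_comp.
have i1 : g1.-integrable setT (EFin \o (fun x => (f \_ I) x ^+ 2)).
  have := integrable_restrict mI fi; apply: eq_integrable => // x _.
  by congr EFin; rewrite !patchE; case: ifP => _; rewrite ?expr0n.
have i2 : g1.-integrable setT (EFin \o (fun=> 1 : R)) by exact: gamma1_cst_integrable.
have := integrableS measurableT mS (@subsetT _ _) (integrable_tensor i1 i2).
by apply: eq_integrable => // z; rewrite inE => /E Ez; rewrite /= Ez mulr1.
Qed.

(** Integrate by parts on each horizontal line; the integrands are continuous with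
    compact support, so Fubini applies. *)
Lemma weak_deriv_strip_x : weak_deriv2 S (1, 0) (fun z => v z.1) (fun z => h z.1).
Proof.
move=> phi tp; have [r r0 Hr] := test_bounded tp.
have cv := gs_v_cont gs; have ch := gs_cont gs.
have [dphi cphi] : (forall z (w : R * R), derivable phi z w) /\ continuous phi.
  by case: tp => /(_ 1%N)[c [d _]] _ _; split=> [z w'|z]; [exact: d|exact: c].
have cd := @test_continuous_derive _ _ _ _ ((1 : R), (0 : R)) tp.
rewrite (@Rintegral_sub_set _ _ _ leb2' setT S)//; last first.
  by move=> z _ nS; have [_ ->] := test_out_dom ((1 : R), (0 : R)) tp nS; rewrite mulr0.
rewrite (@Rintegral_sub_set _ _ _ leb2' setT S (fun z => h z.1 * phi z))//; last first.
  by move=> z _ nS; have [-> _] := test_out_dom ((1 : R), (0 : R)) tp nS; rewrite mulr0.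
have o1 z : r < `|z| -> v z.1 * 'D_((1 : R), (0 : R)) phi z = 0.
  by move=> rz; have [_ ->] := Hr z ((1 : R), (0 : R)) rz; rewrite mulr0.
have o2 z : r < `|z| -> h z.1 * phi z = 0.
  by move=> rz; have [-> _] := Hr z ((1 : R), (0 : R)) rz; rewrite mulr0.
have c1 : continuous (fun z : R * R => v z.1 * 'D_((1 : R), (0 : R)) phi z).
  by move=> z; apply: cvgM; last exact: cd; apply: (@continuous_comp _ _ _ fst v); [exact: cvg_fst|exact: cv].
have c2 : continuous (fun z : R * R => h z.1 * phi z).
  by move=> z; apply: cvgM; last exact: cphi; apply: (@continuous_comp _ _ _ fst h); [exact: cvg_fst|exact: ch].
have [_ <-] := integrable_Rintegral2 (integrable_cont_compact c1 o1).
have [_ <-] := integrable_Rintegral2 (integrable_cont_compact c2 o2).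
rewrite -[RHS]mulN1r -RintegralZl//; last by have [] := integrable_Rintegral2 (integrable_cont_compact c2 o2).
apply: eq_Rintegral => y _; rewrite mulN1r.
apply: (@ibp_compact _ v h (fun x => phi (x, y)) (fun x => 'D_((1 : R), (0 : R)) phi (x, y)) r) => //.
- exact: (gs_der gs).
- by move=> x; exact: is_derive_section1.
- move=> x; apply: (@continuous_comp _ _ _ (fun t : R => (t, y)) (fun z => 'D_((1 : R), (0 : R)) phi z)); last exact: cd.
  exact: (@cvg_pair _ _ _ (nbhs x) (nbhs x) (nbhs y) _ _ _ id (fun=> y) cvg_id (cvg_cst y)).
- move=> x rx; apply: Hr; rewrite (lt_le_trans rx)//.
  by rewrite [leRHS]/Num.norm/= le_max lexx.
Qed.

Lemma weak_deriv_strip_y : weak_deriv2 S (0, 1) (fun z => v z.1) (fun=> 0).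
Proof.
move=> phi tp; have [r r0 Hr] := test_bounded tp.
have cv := gs_v_cont gs.
have dphi z (e : R * R) : derivable phi z e by case: tp => /(_ 1%N)[_ [d _]] _ _; exact: d.
have cd := @test_continuous_derive _ _ _ _ ((0 : R), (1 : R)) tp.
rewrite (@Rintegral_sub_set _ _ _ leb2' setT S)//; last first.
  by move=> z _ nS; have [_ ->] := test_out_dom ((0 : R), (1 : R)) tp nS; rewrite mulr0.
under [in RHS]eq_Rintegral do rewrite mul0r.
rewrite Rintegral_cst// mul0r oppr0.
have o1 z : r < `|z| -> v z.1 * 'D_((0 : R), (1 : R)) phi z = 0.
  by move=> rz; have [_ ->] := Hr z ((0 : R), (1 : R)) rz; rewrite mulr0.
have c1 : continuous (fun z : R * R => v z.1 * 'D_((0 : R), (1 : R)) phi z).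
  by move=> z; apply: cvgM; last exact: cd; apply: (@continuous_comp _ _ _ fst v); [exact: cvg_fst|exact: cv].
have [_ <-] := integrable_Rintegral1 (integrable_cont_compact c1 o1).
transitivity (\int[leb]_x (cst 0 x : R)); last by rewrite Rintegral_cst// mul0r.
apply: eq_Rintegral => x _.
transitivity (- \int[leb]_y (0 * phi (x, y))); last first.
  under eq_Rintegral do rewrite mul0r.
  by rewrite Rintegral_cst// mul0r oppr0.
apply: (@ibp_compact _ (fun=> v x) (fun=> 0) (fun y => phi (x, y)) (fun y => 'D_((0 : R), (1 : R)) phi (x, y)) r) => //.
- by move=> y; exact: cvg_cst.
- by move=> y; exact: is_derive_section2.
- move=> y; apply: (@continuous_comp _ _ _ (fun t : R => (x, t)) (fun z => 'D_((0 : R), (1 : R)) phi z)); last exact: cd.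
  exact: (@cvg_pair _ _ _ (nbhs y) (nbhs x) (nbhs y) _ _ _ (fun=> x) id (cvg_cst x) cvg_id).
- move=> y ry; apply: Hr; rewrite (lt_le_trans ry)//.
  by rewrite [leRHS]/Num.norm/= le_max lexx orbT.
Qed.

Lemma strip_not_ae0 : ~ {ae g2, forall z, S z -> v z.1 = 0}.
Proof.
move=> /ae_sections2 /ae_gamma1 H.
have bb : b - 1 < b by rewrite gtrBl.
have [y /andP[_ yb] Hy] := ae_exists bb H.
apply: (gs_not_ae0 a0 gs).
by apply: (ae_mono _ Hy) => x + Ix; apply.
Qed.

Lemma L2_section (f : R * R -> R) : L2 g2 S f ->
  {ae g1, forall y, L2 g1 I (fun x => ((f : mR * mR -> R) \_ S) (x, y))}.
Proof.
move=> [mf fi]; set F := _ \_ _.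
have mF : measurable_fun (setT : set (mR * mR)) F by apply: (measurable_restrictT _ _).1.
have iF : g2.-integrable setT (EFin \o (fun z => F z ^+ 2)).
  have := integrable_restrict mS fi; apply: eq_integrable => // z _.
  by congr EFin; rewrite /F !patchE; case: ifP => _; rewrite ?expr0n.
have := ae_integrable2 iF.
apply: (@filterS _ _ (ae_filter_ringOfSetsType g1)) => y iy.
split; first by apply: measurable_funTS; exact: measurable_section1.
exact: integrableS iy.
Qed.

(** For y < b the section of the strip is the whole interval. *)
Lemma strip_slice (f : R -> R) (k : R * R -> R) (y : R) : y < b ->
  L2 g1 I f -> L2 g1 I (fun x => ((k : mR * mR -> R) \_ S) (x, y)) ->
  \int[g1]_x ((fun z : mR * mR => f z.1 * k z) \_ S) (x, y) =
  \int[leb]_(x in I) (f x * ((k : mR * mR -> R) \_ S) (x, y) * w x).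
Proof.
move=> yb fL kL; rewrite -Rintegral_gamma1//; last exact: L2_mul.
rewrite [RHS]Rintegral_mkcond; apply: eq_Rintegral => x _; rewrite !patchE.
have [Ix|nI] := pselect (I x); first by rewrite !mem_set.
by rewrite !memNset// => -[].
Qed.

(** [gs_duality] on almost every horizontal line, with the increments of phi
    supplied by [horizontal_difference]. *)
Lemma strip_equation (phi phix phiy : R * R -> R) : H1_dim2 S phi phix phiy ->
  \int[g2]_(z in S) (h z.1 * phix z + 0 * phiy z) =
  mu * \int[g2]_(z in S) (v z.1 * phi z).
Proof.
move=> [Lphi Lphix _ wd _].
have Lv := L2_strip (gs_L2_v gs); have Lh := L2_strip (gs_L2_h gs).
have i1 := integrable_restrict mS (L2_mul mS Lh Lphix).
have i2 := integrable_restrict mS (L2_mul mS Lv Lphi).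
under eq_Rintegral do rewrite mul0r addr0.
rewrite [LHS]Rintegral_mkcond [in RHS]Rintegral_mkcond.
have [j1 <-] := integrable_Rintegral2 i1; have [j2 <-] := integrable_Rintegral2 i2.
rewrite -RintegralZl//; apply: Rintegral_ae_eq => //.
  under [X in _.-integrable _ X]eq_fun do rewrite /= EFinM.
  exact: integrableZl.
have H := ae_gamma1_leb (horizontal_difference a0 pc pe pm Lphi Lphix wd).
have L := L2_section Lphi; have L' := L2_section Lphix.
apply: (ae_mono3 _ H L L') => y Hy Ly Lx; have [yb|yb] := ltP y b; last first.
  have Z (f : R * R -> R) : \int[g1]_x ((f : mR * mR -> R) \_ S) (x, y) = 0.
    transitivity (\int[g1]_x (cst 0 x : R)); last by rewrite Rintegral_cst// mul0r.
    by apply: eq_Rintegral => x _; rewrite patchE memNset// => -[_ /=]; rewrite ltNge yb.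
  by rewrite !Z mulr0.
rewrite !strip_slice//; [|exact: (gs_L2_v gs)|exact: (gs_L2_h gs)].
apply: (gs_duality gs) => //.
- by case: Ly.
- by case: Lx.
- exact: L2_gamma1_sqw.
- exact: L2_gamma1_sqw.
apply: (ae_mono _ Hy) => x + x0 xa.
have SI t : `|t| <= x -> S (t, y).
  by move=> tx; split=> //=; apply/oitvP; rewrite (le_lt_trans _ xa)// lee_fin.
have E (f : R * R -> R) t : `|t| <= x -> ((f : mR * mR -> R) \_ S) (t, y) = f (t, y).
  by move=> /SI Ot; rewrite patchE mem_set.
case=> // [|_ D]; first by apply: SI; rewrite gtr0_norm.
rewrite !E ?normrN ?gtr0_norm// D; apply: eq_Rintegral => t.
rewrite inE/= in_itv/= => /andP[t0 tx].
by rewrite !E// ?normrN gtr0_norm// ltW.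
Qed.

Lemma strip_odd_eigenvalue : odd_eigenvalue S mu.
Proof.
exists (fun z => v z.1); split; last by apply: aeW => z _ /=; exact: (gs_odd gs).
split; first exact: strip_not_ae0.
exists (fun z => h z.1), (fun=> 0); split; last exact: strip_equation.
split.
- exact: L2_strip (gs_L2_v gs).
- exact: L2_strip (gs_L2_h gs).
- split; first exact: measurable_cst.
  under [X in _.-integrable _ X]eq_fun do rewrite expr0n/=.
  exact: integrable0.
- exact: weak_deriv_strip_x.
- exact: weak_deriv_strip_y.
Qed.

Lemma mu1odd_strip : mu1odd S = mu%:E.
Proof.
apply/eqP; rewrite eq_le (mu1odd_ge a0 gs pc pe pm) andbT.
by apply: ereal_inf_lbound; exists mu => //; exact: strip_odd_eigenvalue.
Qed.

End Strip.

(** * The theorem *)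

Theorem theorem1p2 (R : realType) :
  (forall (Om : set (R * R)) (a : \bar R) (p : R -> R),
    C2_domain Om ->
    convex_set Om ->
    ~ bounded_set Om ->
    (forall x y, Om (x, y) -> Om (- x, y)) ->
    (0 < a)%E ->
    convex_function (oitv (- a) a) (fun x => - p x) ->
    (forall x, oitv (- a) a x -> p (- x) = p x) ->
    Ck (oitv (- a) a) 2 p ->
    Om = [set z | oitv (- a) a z.1 /\ z.2 < p z.1] ->
    uniform_interior_sphere Om ->
    (mu1 (- a) a <= mu1odd Om)%E) /\
  (forall (a : \bar R) (b : R), (0 < a)%E ->
    let S := oitv (- a) a `*` [set y | y < b] in
    mu1odd S = mu1 (- a) a /\
    exists2 m : R, odd_eigenvalue S m & mu1odd S = m%:E).
Proof.
split=> [Om a p _ _ _ _ a0 cx pe [pc _] -> _|a b a0 S].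
  have [mu [h [v gs]]] := exists_ground_state a0.
  rewrite (mu1_eq a0 gs).
  exact: (mu1odd_ge a0 gs pc pe (concave_even_nonincreasing cx pe)).
have [mu [h [v gs]]] := exists_ground_state a0.
rewrite (mu1_eq a0 gs); split; first exact: (mu1odd_strip b a0 gs).
by exists mu; [exact: (strip_odd_eigenvalue b a0 gs)|exact: (mu1odd_strip b a0 gs)].
Qed.
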